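(* Let $R=k[x_1,\dots,x_m]$ be a standard graded polynomial ring over an infinite field $k$, let $I$ be a homogeneous ideal with $\dim R/I\le1$, and let $\operatorname{in}(\cdot)$ denote the initial ideal with respect to a fixed term order on $R$. Then: (i) $\operatorname{reg}(\operatorname{in}(I^n))\le\operatorname{reg}(\operatorname{in}(I))\,n$ for all $n\ge0$; (ii) the limit $c=\lim_{n\to\infty}\operatorname{reg}(\operatorname{in}(I^n))/n$ exists and $c\le\max\{d(I),\,r(R/\operatorname{in}(I))+1\}$.
   Context: For a finitely generated graded $R$-module $E$, with $\mathfrak m=(x_1,\dots,x_m)$, $a_i(E)=\max\{r: H^i_{\mathfrak m}(E)_r\neq0\}$ and $\operatorname{reg}(E)=\max_i\{a_i(E)+i\}$. $d(I)$ is the maximum degree of a minimal homogeneous generator of $I$. For a graded quotient $E=R/L$: a reduction of $E$ is an ideal $Q$ generated by linear forms such that $(QE)_n=E_n$ for all large $n$; $r_Q(E)$ is the least $n_0$ with $(QE)_n=E_n$ for all $n>n_0$; $Q$ is minimal if it contains no other reduction of $E$; $r(E)=\min\{r_Q(E): Q \text{ a minimal reduction of }E\}$. *)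

(* Defs.v *)
From Stdlib Require Import ZArith ClassicalEpsilon.
From HB Require Import structures.
From mathcomp Require Import all_boot all_algebra.
From mathcomp Require Import mpoly.

Set Implicit Arguments.
Unset Strict Implicit.
Unset Printing Implicit Defensive.

Import GRing.Theory.
Local Open Scope ring_scope.

Definition is_ideal (k : fieldType) (m : nat) (I : {mpoly k[m]} -> Prop) : Prop :=
  I 0 /\ (forall p q, I p -> I q -> I (p + q)) /\ (forall a p, I p -> I (a * p)).

(* p is homogeneous of degree d (the zero polynomial is homogeneous of every degree) *)
Definition is_homog (k : fieldType) (m : nat) (d : nat) (p : {mpoly k[m]}) : bool :=
  all (fun u => mdeg u == d) (msupp p).

Definition hcomp (k : fieldType) (m : nat) (d : nat) (p : {mpoly k[m]}) : {mpoly k[m]} :=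
  \sum_(u <- msupp p | mdeg u == d) p@_u *: 'X_[u].

Definition homog_ideal (k : fieldType) (m : nat) (I : {mpoly k[m]} -> Prop) : Prop :=
  is_ideal I /\ (forall p d, I p -> I (hcomp d p)).

Definition gen_ideal (k : fieldType) (m : nat) (G : {mpoly k[m]} -> Prop)
  (p : {mpoly k[m]}) : Prop :=
  exists s : seq ({mpoly k[m]} * {mpoly k[m]}),
    (forall x, x \in s -> G x.2) /\ p = \sum_(x <- s) x.1 * x.2.

Definition ideal_pow (k : fieldType) (m : nat) (I : {mpoly k[m]} -> Prop) (n : nat) :
  {mpoly k[m]} -> Prop :=
  gen_ideal (fun q => exists s : seq {mpoly k[m]},
     size s = n /\ (forall x, x \in s -> I x) /\ q = \prod_(x <- s) x).

Definition term_order (m : nat) (le : rel 'X_{1..m}) : Prop :=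
  reflexive le /\ antisymmetric le /\ transitive le /\ total le /\
  (forall u, le 0%MM u) /\
  (forall u v w, le u v -> le (u + w)%MM (v + w)%MM).

Definition is_lead (k : fieldType) (m : nat) (le : rel 'X_{1..m}) (f : {mpoly k[m]})
  (u : 'X_{1..m}) : Prop :=
  u \in msupp f /\ forall v, v \in msupp f -> le v u.

(* initial ideal in(J): the k-span of the leading monomials of the nonzero f in J *)
Definition initial (k : fieldType) (m : nat) (le : rel 'X_{1..m})
  (J : {mpoly k[m]} -> Prop) (p : {mpoly k[m]}) : Prop :=
  forall u, u \in msupp p -> exists f, J f /\ is_lead le f u.

Definition prime_ideal (k : fieldType) (m : nat) (P : {mpoly k[m]} -> Prop) : Prop :=
  is_ideal P /\ ~ P 1 /\ (forall a b, P (a * b) -> P a \/ P b).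

Definition strict_incl (k : fieldType) (m : nat) (A B : {mpoly k[m]} -> Prop) : Prop :=
  (forall p, A p -> B p) /\ exists p, B p /\ ~ A p.

Definition krull_dim_le1 (k : fieldType) (m : nat) (I : {mpoly k[m]} -> Prop) : Prop :=
  ~ exists P0 P1 P2 : {mpoly k[m]} -> Prop,
      [/\ prime_ideal P0, prime_ideal P1, prime_ideal P2
        & [/\ (forall p, I p -> P0 p), strict_incl P0 P1 & strict_incl P1 P2]].

Definition infinite_field (k : fieldType) : Prop :=
  forall s : seq k, exists x, x \notin s.

(* ---------- Local cohomology H^i_m(J) of an ideal J (as a graded R-module),
   computed by the Cech complex on x_1..x_m.  Since J is torsion free, an element
   of the localization J_{x_S} is written f / x_S^t with f in J; a cochain of
   "level t" is a family (f_S)_{|S| = i} representing (f_S / x_S^t)_S. ---------- *)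

Definition xpow (k : fieldType) (m : nat) (S : {set 'I_m}) (t : nat) : {mpoly k[m]} :=
  \prod_(j in S) 'X_j ^+ t.

Definition csign (k : fieldType) (m : nat) (j : 'I_m) (T : {set 'I_m}) : {mpoly k[m]} :=
  (-1) ^+ #|[set i in T | (i < j)%N]|.

(* numerator (over x_T^t) of the T-component of the Cech differential of a level-t
   cochain f *)
Definition cech_d (k : fieldType) (m : nat) (f : {set 'I_m} -> {mpoly k[m]}) (t : nat)
  (T : {set 'I_m}) : {mpoly k[m]} :=
  \sum_(j in T) csign k j T * 'X_j ^+ t * f (T :\ j).

(* homogeneous i-cochain of degree r, level t : deg (f_S / x_S^t) = r *)
Definition cochain (k : fieldType) (m : nat) (J : {mpoly k[m]} -> Prop) (i : nat)
  (r : Z) (t : nat) (f : {set 'I_m} -> {mpoly k[m]}) : Prop :=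
  forall S : {set 'I_m}, #|S| = i ->
    J (f S) /\ (f S = 0 \/ exists d : nat,
        is_homog d (f S) /\ Z.of_nat d = Z.add r (Z.of_nat (t * i))).

Definition cocycle (k : fieldType) (m : nat) (i : nat) (t : nat)
  (f : {set 'I_m} -> {mpoly k[m]}) : Prop :=
  forall T : {set 'I_m}, #|T| = i.+1 -> cech_d f t T = 0.

Definition coboundary (k : fieldType) (m : nat) (J : {mpoly k[m]} -> Prop) (i : nat)
  (t : nat) (f : {set 'I_m} -> {mpoly k[m]}) : Prop :=
  if i is i'.+1 then
    exists (s : nat) (g : {set 'I_m} -> {mpoly k[m]}),
      (forall S : {set 'I_m}, #|S| = i' -> J (g S)) /\
      (forall S : {set 'I_m}, #|S| = i ->
         cech_d g s S * xpow k S t = f S * xpow k S s)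
  else forall S : {set 'I_m}, #|S| = 0%N -> f S = 0.

Definition lc_nonzero (k : fieldType) (m : nat) (J : {mpoly k[m]} -> Prop) (i : nat)
  (r : Z) : Prop :=
  exists (t : nat) (f : {set 'I_m} -> {mpoly k[m]}),
    cochain J i r t f /\ cocycle i t f /\ ~ coboundary J i t f.

Definition is_reg (k : fieldType) (m : nat) (J : {mpoly k[m]} -> Prop) (c : Z) : Prop :=
  (forall i r, lc_nonzero J i r -> Z.le (Z.add r (Z.of_nat i)) c) /\
  (exists i r, lc_nonzero J i r /\ Z.add r (Z.of_nat i) = c).

Definition reg (k : fieldType) (m : nat) (J : {mpoly k[m]} -> Prop) : Z :=
  epsilon (inhabits Z0) (is_reg J).

Definition min_homog_gens (k : fieldType) (m : nat) (I : {mpoly k[m]} -> Prop)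
  (G : seq {mpoly k[m]}) : Prop :=
  [/\ uniq G, (forall g, g \in G -> exists d, is_homog d g),
      (forall p, I p <-> gen_ideal (fun g => g \in G) p)
    & forall g0, g0 \in G ->
        ~ (forall p, I p <-> gen_ideal (fun g => (g \in G) && (g != g0)) p)].

Definition max_deg (k : fieldType) (m : nat) (G : seq {mpoly k[m]}) : nat :=
  \max_(g <- G) \max_(u <- msupp g) mdeg u.

Definition linear_ideal (k : fieldType) (m : nat) (Q : {mpoly k[m]} -> Prop) : Prop :=
  exists s : seq {mpoly k[m]}, (forall x, x \in s -> is_homog 1 x) /\
    (forall p, Q p <-> gen_ideal (fun g => g \in s) p).

(* (QE)_n = E_n for E = R/L, i.e. R_n is contained in Q + L *)
Definition covers (k : fieldType) (m : nat) (Q L : {mpoly k[m]} -> Prop) (n : nat) : Prop :=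
  forall p, is_homog n p -> exists a b, Q a /\ L b /\ p = a + b.

Definition reduction (k : fieldType) (m : nat) (Q L : {mpoly k[m]} -> Prop) : Prop :=
  linear_ideal Q /\ exists N, forall n, (N <= n)%N -> covers Q L n.

Definition min_reduction (k : fieldType) (m : nat) (Q L : {mpoly k[m]} -> Prop) : Prop :=
  reduction Q L /\ ~ exists Q', reduction Q' L /\ strict_incl Q' Q.

Definition red_num_Q (k : fieldType) (m : nat) (Q L : {mpoly k[m]} -> Prop) (n0 : nat) : Prop :=
  (forall n, (n0 < n)%N -> covers Q L n) /\
  (forall n1, (n1 < n0)%N -> ~ (forall n, (n1 < n)%N -> covers Q L n)).

Definition red_num (k : fieldType) (m : nat) (L : {mpoly k[m]} -> Prop) (r : nat) : Prop :=
  (exists Q, min_reduction Q L /\ red_num_Q Q L r) /\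
  (forall Q n0, min_reduction Q L -> red_num_Q Q L n0 -> (r <= n0)%N).

(* Main.v *)
Require Import Defs.
From Stdlib Require Import Reals Lra Lia ZArith Classical ClassicalEpsilon.
From Stdlib Require Import FunctionalExtensionality PropExtensionality.

(** Write R = k[x_1..x_m], J_n = in(I^n), z0 = x_1 + ... + x_m.  For an ideal A with
    dim R/A <= 1 and a linear form z, consider multiplication by z on R/A.

    For a monomial ideal J with dim R/J <= 1, decomposing the Cech complex by multidegree
    shows that reg J is the least a such that z0 acts bijectively on R/J from degree a on
    (onto degree a included), and that any linear form acting bijectively from degree a on
    bounds reg J by a.

    If z acts surjectively onto degree a, bijectivity from a on means that the Hilbert
    function is constant from a on; and R/A and R/in(A) have the same Hilbert function.  A
    generic form inherits surjectivity from in(A) and z0, so bijectivity passes back and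
    forth between R/I^n (with z generic) and R/J_n (with z0).  Bijectivity for A from a on
    and for B from b on implies it for AB from a + b on, hence reg J_(n+p) <= reg J_n +
    reg J_p.  This gives (i), and the limit by Fekete's lemma.

    For the bound: a minimal reduction of R/in(I) is generated by one linear form y, which
    is surjective for J_n from degree n (r + 1) on.  By Hilbert's basis theorem applied to
    the Rees algebra, the Hilbert function of R/I^n is constant from degree n d(I) + e on
    with e independent of n.  So reg J_n <= n max(d(I), r + 1) + e. *)

(** * Subadditive sequences *)

(** Bijectivity can replace regularity because in dimension at most one only H^0 and H^1 of R/J
    matter: since H^i(J) comes from H^(i-1)(R/J), reg J <= a asks that H^0(R/J) vanish from degree a
    on and H^1(R/J) from degree a - 1 on. The first makes z0 injective from a on; both together make
    it onto degree a. The obstacle is that in(I)^n may be strictly smaller than in(I^n), so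
    subadditivity cannot be proved among initial ideals. It is proved for the powers of I, and only
    the Hilbert function carries it back. The product step rests on A/zA -> R/zR being bijective in
    high degrees: a monomial factored as w1 w2 is sent to the product of its representatives in A
    and B, which gives a map from R/zR to AB/zAB in degrees above a + b. The generic form inherits
    surjectivity because in(I) is a monomial ideal: rescaling the variables turns a form with
    undetermined coefficients into z0. *)

Section Fekete.
Local Open Scope R_scope.

Variable a : nat -> nat.
Hypothesis sub : forall n p, (a (n + p) <= a n + a p)%nat.

Lemma subadditive_mul p q s : (a (q * p + s) <= q * a p + a s)%nat.
Proof.
induction q as [|q IH]; simpl; [lia|].
rewrite <- Nat.add_assoc. pose proof (sub p (q * p + s)). lia.
Qed.

Lemma bounded_initial p : exists A, forall s, (s < p)%nat -> (a s <= A)%nat.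
Proof.
induction p as [|p [A HA]]; [exists 0%nat; intros; lia|].
exists (A + a p)%nat; intros s Hs.
destruct (Nat.eq_dec s p) as [->|Hne]; [lia|].
pose proof (HA s ltac:(lia)); lia.
Qed.

Lemma inv_small (x eps : R) : 0 < eps -> exists N, forall n, (N <= n)%nat -> (1 <= n)%nat -> x / INR n < eps.
Proof.
intros He. destruct (INR_unbounded (x / eps)) as [N HN].
exists N; intros n Hn H1.
assert (Hn' : INR N <= INR n) by (apply le_INR; lia).
assert (H0 : 0 < INR n) by (apply lt_0_INR; lia).
apply (Rmult_lt_reg_r (INR n)); [exact H0|].
unfold Rdiv. rewrite Rmult_assoc, Rinv_l, Rmult_1_r by lra.
apply (Rmult_lt_reg_r (/ eps)); [now apply Rinv_0_lt_compat|].
replace (eps * INR n * / eps) with (INR n) by (field; lra).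
unfold Rdiv in HN; lra.
Qed.

Lemma fekete : exists c, Un_cv (fun n => INR (a n) / INR n) c /\
  forall D e, (forall n, (a n <= n * D + e)%nat) -> c <= INR D.
Proof.
(* The limit is the infimum of the ratios; [completeness] supplies suprema, hence the minus sign. *)
set (E := fun x => exists n, (1 <= n)%nat /\ x = - (INR (a n) / INR n)).
assert (HB : bound E).
{ exists 0; intros x [n [Hn ->]].
  assert (0 <= INR (a n) / INR n); [|lra].
  apply Rle_mult_inv_pos; [apply pos_INR|apply lt_0_INR; lia]. }
assert (HE : exists x, E x).
{ exists (- (INR (a 1%nat) / INR 1)), 1%nat; split; [lia|reflexivity]. }
destruct (completeness E HB HE) as [M [HM1 HM2]].
assert (Hc : forall n, (1 <= n)%nat -> - M <= INR (a n) / INR n).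
{ intros n Hn. pose proof (HM1 (- (INR (a n) / INR n))) as H.
  assert (E (- (INR (a n) / INR n))) by (exists n; split; [exact Hn|reflexivity]).
  specialize (H H0); lra. }
exists (- M); split.
- intros eps He.
  (* Divide n by a fixed p whose ratio is within eps/2 of the infimum; the remainder costs at most A
     / n, which takes up the other eps/2. *)
  assert (Hp : exists p, (1 <= p)%nat /\ INR (a p) / INR p < - M + eps / 2).
  { apply NNPP; intros Hno.
    assert (HU : is_upper_bound E (M - eps / 2)).
    { intros x [n [Hn ->]].
      apply Rnot_lt_le; intros Hlt; apply Hno; exists n; split; [exact Hn|lra]. }
    pose proof (HM2 _ HU); lra. }
  destruct Hp as [p [Hp1 Hp2]].
  destruct (bounded_initial p) as [A HA].
  destruct (@inv_small (INR A) (eps / 2) ltac:(lra)) as [N HN].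
  exists (S N); intros n Hn. unfold Rdist.
  assert (Hn1 : (1 <= n)%nat) by lia.
  pose proof (Hc n Hn1) as Hlow.
  assert (Hn0 : 0 < INR n) by (apply lt_0_INR; lia).
  assert (Hp0 : 0 < INR p) by (apply lt_0_INR; lia).
  assert (Hup : INR (a n) / INR n <= INR (a p) / INR p + INR A / INR n).
  { pose proof (Nat.div_mod_eq n p) as Hdm.
    pose proof (Nat.mod_upper_bound n p ltac:(lia)) as Hmod.
    set (q := (n / p)%nat) in *. set (s := (n mod p)%nat) in *.
    assert (Ha : (a n <= q * a p + A)%nat).
    { rewrite Hdm, (Nat.mul_comm p q).
      pose proof (subadditive_mul p q s). pose proof (HA s Hmod). lia. }
    apply le_INR in Ha. rewrite plus_INR, mult_INR in Ha.
    assert (Hq : INR q * INR p <= INR n) by (rewrite <- mult_INR; apply le_INR; lia).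
    apply (Rmult_le_reg_r (INR n)); [exact Hn0|].
    replace (INR (a n) / INR n * INR n) with (INR (a n)) by (field; lra).
    replace ((INR (a p) / INR p + INR A / INR n) * INR n)
      with (INR (a p) / INR p * INR n + INR A) by (field; lra).
    assert (Hr : 0 <= INR (a p) / INR p) by (apply Rle_mult_inv_pos; [apply pos_INR|exact Hp0]).
    assert (INR q * INR (a p) = INR (a p) / INR p * (INR q * INR p)) by (field; lra).
    assert (INR (a p) / INR p * (INR q * INR p) <= INR (a p) / INR p * INR n)
      by (apply Rmult_le_compat_l; assumption).
    lra. }
  pose proof (HN n ltac:(lia) Hn1).
  apply Rabs_def1; lra.
- intros D e HD. apply Rnot_lt_le; intros Hlt.
  destruct (@inv_small (INR e) (- M - INR D) ltac:(lra)) as [N HN].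
  pose proof (HN (S N) ltac:(lia) ltac:(lia)) as H1.
  pose proof (Hc (S N) ltac:(lia)) as H2.
  pose proof (HD (S N)) as H3. apply le_INR in H3. rewrite plus_INR, mult_INR in H3.
  assert (Hn0 : 0 < INR (S N)) by (apply lt_0_INR; lia).
  assert (INR (a (S N)) / INR (S N) <= INR D + INR e / INR (S N)); [|lra].
  apply (Rmult_le_reg_r (INR (S N))); [exact Hn0|].
  replace (INR (a (S N)) / INR (S N) * INR (S N)) with (INR (a (S N))) by (field; lra).
  replace ((INR D + INR e / INR (S N)) * INR (S N)) with (INR (S N) * INR D + INR e) by (field; lra).
  exact H3.
Qed.

End Fekete.

From mathcomp Require Import all_boot all_order all_algebra generic_quotient.
From mathcomp Require Import mpoly zify ring.

Set Implicit Arguments.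
Unset Strict Implicit.
Unset Printing Implicit Defensive.

Import GRing.Theory.
Local Open Scope ring_scope.

(** * Homogeneous and monomial ideals *)

Definition mono_ideal (k : fieldType) (m : nat) (J : {mpoly k[m]} -> Prop) : Prop :=
  is_ideal J /\ forall p u, J p -> u \in msupp p -> J 'X_[u].

(* Multiplication by z on R/A: mul_onto says that it is onto in degree j, mul_inj that it is injective
   on degree j, mul_bij that it is onto degree a and bijective from degree a on. *)
Definition mul_onto (k : fieldType) (m : nat) (A : {mpoly k[m]} -> Prop) (z : {mpoly k[m]}) (j : nat) :=
  forall p, is_homog j p -> exists b, A (p - z * b).

Definition mul_inj (k : fieldType) (m : nat) (A : {mpoly k[m]} -> Prop) (z : {mpoly k[m]}) (j : nat) :=
  forall f, is_homog j f -> A (z * f) -> A f.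

Definition mul_bij (k : fieldType) (m : nat) (A : {mpoly k[m]} -> Prop) (z : {mpoly k[m]}) (a : nat) :=
  forall j, (a <= j)%N -> mul_onto A z j /\ mul_inj A z j.

Section Basics.
Variables (k : fieldType) (m : nat).
Implicit Types (A B I J : {mpoly k[m]} -> Prop) (p q f g z : {mpoly k[m]}).
Implicit Types (u v w : 'X_{1..m}).

Lemma is_homogP d p : reflect (forall u, u \in msupp p -> mdeg u = d) (is_homog d p).
Proof. by apply: (iffP allP) => H u /H /eqP. Qed.

Lemma is_homogE d p : is_homog d p = (p \is d.-homog).
Proof. by []. Qed.

Lemma homogXm u : is_homog (mdeg u) ('X_[u] : {mpoly k[m]}).
Proof. by rewrite is_homogE dhomogX. Qed.

Lemma homogXd u d : mdeg u = d -> is_homog d ('X_[u] : {mpoly k[m]}).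
Proof. by move=> <-; apply: homogXm. Qed.

Lemma homog0 d : is_homog d (0 : {mpoly k[m]}).
Proof. by rewrite is_homogE dhomog0. Qed.

Lemma homogD d p q : is_homog d p -> is_homog d q -> is_homog d (p + q).
Proof. by rewrite !is_homogE; apply: dhomogD. Qed.

Lemma homogN d p : is_homog d p -> is_homog d (- p).
Proof. by rewrite !is_homogE dhomogN. Qed.

Lemma homogB d p q : is_homog d p -> is_homog d q -> is_homog d (p - q).
Proof. by move=> hp hq; apply: homogD => //; apply: homogN. Qed.

Lemma homogZ d c p : is_homog d p -> is_homog d (c *: p).
Proof. by rewrite !is_homogE; apply: dhomogZ. Qed.

Lemma homogM d e p q : is_homog d p -> is_homog e q -> is_homog (d + e) (p * q).
Proof. by rewrite !is_homogE; apply: dhomogM. Qed.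

Lemma homog_sum (T : eqType) (r : seq T) (P : pred T) (F : T -> {mpoly k[m]}) d :
  (forall x, x \in r -> P x -> is_homog d (F x)) -> is_homog d (\sum_(x <- r | P x) F x).
Proof.
move=> H; rewrite big_seq_cond; apply: (big_ind (fun x => is_homog d x)).
- exact: homog0.
- by move=> x y; apply: homogD.
- by move=> x /andP[]; apply: H.
Qed.

Lemma homog_msize d p : is_homog d p -> (msize p <= d.+1)%N.
Proof.
move/is_homogP=> H; rewrite msizeE; apply/bigmax_leqP_seq => u hu _.
by rewrite H.
Qed.

Lemma hcompE d p : hcomp d p = pihomog mdeg d p.
Proof. by []. Qed.

Lemma coeff_hcomp d p u : (hcomp d p)@_u = if mdeg u == d then p@_u else 0.
Proof.
rewrite /hcomp raddf_sum /=.
have [hu|hu] := boolP (u \in msupp p).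
  rewrite (big_rem u) //= [X in _ + X]big_seq_cond [X in _ + X]big1 => [|v /andP[hv _]].
    by rewrite addr0 mcoeffZ mcoeffX eqxx mulr1; case: ifP.
  rewrite mcoeffZ mcoeffX; case: eqP => [evu|_]; last by rewrite mulr0.
  by move: hv; rewrite evu mem_rem_uniqF.
rewrite (memN_msupp_eq0 hu) if_same big_seq_cond big1 // => v /andP[hv _].
rewrite mcoeffZ mcoeffX; case: eqP => [evu|_]; last by rewrite mulr0.
by move: hu; rewrite -evu hv.
Qed.

Lemma homog_hcomp d p : is_homog d (hcomp d p).
Proof. by rewrite is_homogE hcompE pihomogP. Qed.

Lemma hcompD d p q : hcomp d (p + q) = hcomp d p + hcomp d q.
Proof. by rewrite !hcompE pihomogD. Qed.

Lemma hcompB d p q : hcomp d (p - q) = hcomp d p - hcomp d q.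
Proof. by rewrite !hcompE pihomogB. Qed.

Lemma hcomp0 d : hcomp d (0 : {mpoly k[m]}) = 0.
Proof. by rewrite !hcompE pihomog0. Qed.

Lemma hcomp_sum d (T : Type) (r : seq T) (F : T -> {mpoly k[m]}) :
  hcomp d (\sum_(x <- r) F x) = \sum_(x <- r) hcomp d (F x).
Proof. exact: (big_morph (hcomp d) (hcompD d) (hcomp0 d)). Qed.

Lemma hcomp_id d p : is_homog d p -> hcomp d p = p.
Proof. by rewrite hcompE; apply: pihomog_dE. Qed.

Lemma hcomp_neq d e p : is_homog d p -> d != e -> hcomp e p = 0.
Proof.
move/is_homogP=> hp hde; apply/mpolyP => u; rewrite coeff_hcomp mcoeff0.
case: eqP => // hu; apply: memN_msupp_eq0; apply/negP => /hp hd.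
by move: hde; rewrite -hd hu eqxx.
Qed.

Lemma hcomp_partition p n : (msize p <= n)%N -> p = \sum_(d < n) hcomp d p.
Proof.
move=> hn; apply/mpolyP => u; rewrite raddf_sum /=.
under eq_bigr => d _ do rewrite coeff_hcomp.
have [hu|hu] := ltnP (mdeg u) n.
  rewrite (bigD1 (Ordinal hu)) //= eqxx big1 ?addr0 // => d hd.
  by case: eqP => // e; move: hd; rewrite -val_eqE /= e eqxx.
rewrite (memN_msupp_eq0 (msize_mdeg_ge (leq_trans hn hu))).
by rewrite big1 // => d _; rewrite if_same.
Qed.

Lemma hcompM_homog d e p q : is_homog d p -> hcomp (d + e) (p * q) = p * hcomp e q.
Proof.
move=> hp; rewrite {1}(@hcomp_partition q (maxn (msize q) e.+1)) ?leq_maxl //.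
rewrite mulr_sumr hcomp_sum.
have he : (e < maxn (msize q) e.+1)%N by rewrite leq_max ltnSn orbT.
rewrite (bigD1 (Ordinal he)) //= hcomp_id ?big1 ?addr0 //.
  move=> i hi; apply: (@hcomp_neq (d + i)); first exact: (homogM hp (homog_hcomp i q)).
  by rewrite eqn_add2l.
exact: (homogM hp (homog_hcomp e q)).
Qed.

Lemma hcompM_low d e p q : is_homog d p -> (e < d)%N -> hcomp e (p * q) = 0.
Proof.
move=> hp hed; rewrite {1}(@hcomp_partition q (msize q)) // mulr_sumr hcomp_sum big1 // => i _.
apply: (@hcomp_neq (d + i)); first exact: (homogM hp (homog_hcomp i q)).
by rewrite gtn_eqF // (leq_trans hed) // leq_addr.
Qed.

Section Ideal.
Variable A : {mpoly k[m]} -> Prop.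
Hypothesis hA : is_ideal A.

Lemma id0 : A 0. Proof. by case: hA. Qed.
Lemma idD p q : A p -> A q -> A (p + q). Proof. by case: hA => _ [H _]; apply: H. Qed.
Lemma idMl p q : A q -> A (p * q). Proof. by case: hA => _ [_ H]; apply: H. Qed.
Lemma idMr p q : A p -> A (p * q). Proof. by rewrite mulrC; apply: idMl. Qed.
Lemma idN p : A p -> A (- p). Proof. by rewrite -mulN1r; apply: idMl. Qed.
Lemma idB p q : A p -> A q -> A (p - q). Proof. by move=> hp hq; apply: idD => //; apply: idN. Qed.
Lemma idZ c p : A p -> A (c *: p). Proof. by rewrite -mul_mpolyC; apply: idMl. Qed.
Lemma id_sum (T : eqType) (r : seq T) (P : pred T) (F : T -> {mpoly k[m]}) :
  (forall x, x \in r -> P x -> A (F x)) -> A (\sum_(x <- r | P x) F x).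
Proof.
move=> H; rewrite big_seq_cond; apply: (big_ind A).
- exact: id0.
- by move=> x y; apply: idD.
- by move=> x /andP[]; apply: H.
Qed.
Lemma id_trans p q r : A (p - q) -> A (q - r) -> A (p - r).
Proof. by move=> h1 h2; have := idD h1 h2; rewrite addrA subrK. Qed.
Lemma id_sym p q : A (p - q) -> A (q - p).
Proof. by move/idN; rewrite opprB. Qed.
Lemma id_move p q : A (p - q) -> A q -> A p.
Proof. by move=> h1 h2; have := idD h1 h2; rewrite subrK. Qed.
Lemma id_mdvd u v : (u <= v)%MM -> A 'X_[u] -> A 'X_[v].
Proof. by move=> h hu; rewrite -(submK h) mpolyXD; apply: idMl. Qed.
End Ideal.

Lemma homog_is_ideal A : homog_ideal A -> is_ideal A. Proof. by case. Qed.

Lemma mono_is_ideal A : mono_ideal A -> is_ideal A. Proof. by case. Qed.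

Lemma mono_memP A p : mono_ideal A -> A p <-> forall u, u \in msupp p -> A 'X_[u].
Proof.
move=> [hA hm]; split=> [hp u|H]; first exact: hm.
rewrite (mpolyE p); apply: id_sum => // u hu _.
by apply: idZ => //; apply: H.
Qed.

Lemma mono_homog A : mono_ideal A -> homog_ideal A.
Proof.
move=> hA; split; first exact: mono_is_ideal.
move=> p d /(mono_memP _ hA) H; apply/(mono_memP _ hA) => u.
rewrite mcoeff_msupp coeff_hcomp; case: ifP => [_|]; last by rewrite eqxx.
by rewrite -mcoeff_msupp; apply: H.
Qed.

Lemma coeff_X_mul u p w : ('X_[u] * p)@_w = if (u <= w)%MM then p@_(w - u) else 0.
Proof.
case: ifP => [h|/negbT h].
  by rewrite mulrC -{1}(submK h) [(w - u + u)%MM]addmC mcoeffMX.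
rewrite mulrC; apply: memN_msupp_eq0; rewrite (perm_mem (msuppMX p u)).
by apply: contra h => /mapP[v _ ->]; apply: lem_addr.
Qed.

Lemma mem_msuppXM u p w : (w \in msupp ('X_[u] * p)) -> (u <= w)%MM /\ (w - u)%MM \in msupp p.
Proof.
by rewrite mcoeff_msupp coeff_X_mul; case: ifP => // h; rewrite ?eqxx // mcoeff_msupp.
Qed.

Lemma coeff_X_mulD u p w : ('X_[u] * p)@_(u + w) = p@_w.
Proof. by rewrite mulrC mcoeffMX. Qed.

Lemma mdvdX_ex u v : (u <= v)%MM -> exists w, v = (u + w)%MM.
Proof. by move=> h; exists (v - u)%MM; rewrite addmC submK. Qed.

Lemma mdeg_split w a : (a <= mdeg w)%N -> exists w1 w2, w = (w1 + w2)%MM /\ mdeg w1 = a.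
Proof.
elim: a => [|a IH] h; first by exists 0%MM, w; rewrite add0m mdeg0.
have [w1 [w2 [ew hw1]]] := IH (ltnW h).
have : (0 < mdeg w2)%N by move: h; rewrite ew mdegD hw1; lia.
rewrite lt0n mdeg_eq0 => /eqP hw2.
have [i hi] : exists i, w2 i != 0%N.
  apply/existsP; apply: contra_notT hw2 => /existsPn H; apply/mnmP => i.
  by rewrite mnm0E; apply/eqP/negPn/H.
exists (w1 + U_(i))%MM, (w2 - U_(i))%MM; rewrite mdegD mdeg1 hw1 addn1; split=> //.
by rewrite ew -addmA; congr (_ + _)%MM; rewrite addmC submK // lep1mP.
Qed.

Lemma mdegS_var w : (0 < mdeg w)%N -> exists i w', w = (U_(i) + w')%MM.
Proof.
move=> /mdeg_split[w1 [w2 [-> /eqP /mdeg1P[i /eqP ->]]]]; by exists i, w2.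
Qed.

Lemma addmCA u v w : (u + (v + w) = v + (u + w))%MM.
Proof. by rewrite !addmA [(u + v)%MM]addmC. Qed.

Lemma homog1E z : is_homog 1 z -> z = \sum_(i < m) z@_U_(i) *: 'X_i.
Proof.
move/is_homogP=> hz; apply/mpolyP => u; rewrite raddf_sum /=.
under eq_bigr => i _ do rewrite mcoeffZ mcoeffX.
have [/eqP /mdeg1P[j /eqP ->]|/eqP hu] := altP (mdeg u =P 1%N).
  rewrite (bigD1 j) //= eqxx mulr1 big1 ?addr0 // => i hij.
  by rewrite eq_mnm1 (negbTE hij) mulr0.
rewrite memN_msupp_eq0; last by apply/negP => /hz.
rewrite big1 // => i _; case: eqP => [e|_]; last by rewrite mulr0.
by case: hu; rewrite -e mdeg1.
Qed.

(** [mul_onto] leaves the cofactor arbitrary; as A and z are homogeneous, its component of degree j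
    serves as well. *)
Lemma onto_homog A z j p : homog_ideal A -> is_homog 1 z -> mul_onto A z j.+1 -> is_homog j.+1 p ->
  exists2 b, is_homog j b & A (p - z * b).
Proof.
move=> [hA hh] hz hc hp; have [b hb] := hc _ hp.
exists (hcomp j b); first exact: homog_hcomp.
have := hh _ j.+1 hb; rewrite hcompB (hcomp_id hp).
by rewrite -{1}[j.+1]add1n hcompM_homog.
Qed.

(** A multiple of z has no constant term, so being onto in degree 0 forces the constants into A. *)
Lemma onto_deg0 A z p : homog_ideal A -> is_homog 1 z -> mul_onto A z 0 -> is_homog 0 p -> A p.
Proof.
move=> [hA hh] hz hc hp; have [b hb] := hc _ hp.
by have := hh _ 0%N hb; rewrite hcompB (hcomp_id hp) (hcompM_low _ hz) // subr0.
Qed.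

Lemma ontoX A z j : is_ideal A -> (forall u, mdeg u = j -> exists b, A ('X_[u] - z * b)) -> mul_onto A z j.
Proof.
move=> hA H p /is_homogP hp.
have {}H u : exists b, u \in msupp p -> A ('X_[u] - z * b).
  case: (boolP (u \in msupp p)) => [/hp /H [b hb]|_]; first by exists b.
  by exists 0.
pose F u := proj1_sig (constructive_indefinite_description _ (H u)).
have hF u : u \in msupp p -> A ('X_[u] - z * F u).
  by rewrite /F; case: constructive_indefinite_description.
exists (\sum_(u <- msupp p) p@_u *: F u).
rewrite {1}(mpolyE p) mulr_sumr -sumrB; apply: id_sum => // u hu _.
by rewrite -scalerAr -scalerBr; apply: idZ => //; apply: hF.
Qed.

(** Split a monomial of degree a + b and multiply the relations of the two factors: apart from the
    monomial itself, every term of the product is a multiple of z. *)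
Lemma onto_mul A B C z a b : is_ideal C -> (forall x y, A x -> B y -> C (x * y)) ->
  mul_onto A z a -> mul_onto B z b -> mul_onto C z (a + b).
Proof.
move=> hC hAB hA hB; apply: ontoX => // u hu.
have [w1 [w2 [eu h1]]] : exists w1 w2, u = (w1 + w2)%MM /\ mdeg w1 = a.
  by apply: mdeg_split; rewrite hu leq_addr.
have h2 : mdeg w2 = b by move: hu; rewrite eu mdegD h1 => /addnI.
have [x hx] := hA _ (homogXd h1); have [y hy] := hB _ (homogXd h2).
exists ('X_[w1] * y + x * ('X_[w2] - z * y)).
have -> : 'X_[u] - z * ('X_[w1] * y + x * ('X_[w2] - z * y))
  = ('X_[w1] - z * x) * ('X_[w2] - z * y).
  by rewrite eu mpolyXD; ring.
exact: hAB.
Qed.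

Lemma onto_mono A z a j : is_ideal A -> (a <= j)%N -> mul_onto A z a -> mul_onto A z j.
Proof.
move=> hA haj hc; rewrite -(subnKC haj).
(* The second factor is the unit ideal, for which every degree is onto. *)
refine (@onto_mul A (fun=> True) A z a (j - a) hA _ hc _).
  by move=> x y hx _; apply: idMr.
by move=> p _; exists 0.
Qed.

Lemma mul_bij_onto A z a j : mul_bij A z a -> (a <= j)%N -> mul_onto A z j.
Proof. by move=> h /h []. Qed.

Lemma mul_bij_inj A z a j : mul_bij A z a -> (a <= j)%N -> mul_inj A z j.
Proof. by move=> h /h []. Qed.

(** Injectivity on R/A amounts to A ∩ zR = zA in degrees above a; lifts of monomials are compared
    through this form of it. *)
Lemma mul_bij_div A z a j h g : homog_ideal A -> is_homog 1 z -> mul_bij A z a -> (a <= j)%N ->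
  A h -> is_homog j.+1 h -> h = z * g -> exists2 g', A g' & h = z * g'.
Proof.
move=> [hA hh] hz hcm haj hAh hhh eh.
have e : h = z * hcomp j g.
  by rewrite -(hcompM_homog j g hz) add1n -eh hcomp_id.
exists (hcomp j g) => //; apply: (mul_bij_inj hcm haj); first exact: homog_hcomp.
by rewrite -e.
Qed.

Lemma gen_ideal_is_ideal (G : {mpoly k[m]} -> Prop) : is_ideal (gen_ideal G).
Proof.
split; first by exists [::]; split=> //; rewrite big_nil.
split=> [p q [s [hs ->]] [t [ht ->]]|a p [s [hs ->]]].
  exists (s ++ t); split; last by rewrite big_cat.
  by move=> x; rewrite mem_cat => /orP[/hs|/ht].
exists [seq (a * x.1, x.2) | x <- s]; split; first by move=> x /mapP[y /hs hy ->].
by rewrite big_map mulr_sumr; apply: eq_bigr => x _ /=; rewrite mulrA.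
Qed.

Lemma gen_ideal_incl (G : {mpoly k[m]} -> Prop) p : G p -> gen_ideal G p.
Proof.
move=> hp; exists [:: (1, p)]; split; first by move=> x; rewrite inE => /eqP ->.
by rewrite big_seq1 mul1r.
Qed.

Lemma gen_ideal_min (G : {mpoly k[m]} -> Prop) A p : is_ideal A ->
  (forall g, G g -> A g) -> gen_ideal G p -> A p.
Proof. by move=> hA H [s [hs ->]]; apply: id_sum => // x /hs /H h _; apply: idMl. Qed.

Lemma ideal_pow_is_ideal A n : is_ideal (ideal_pow A n).
Proof. exact: gen_ideal_is_ideal. Qed.

Lemma ideal_powM A n n' p q : ideal_pow A n p -> ideal_pow A n' q -> ideal_pow A (n + n') (p * q).
Proof.
move=> [s [hs ->]] [t [ht ->]]; rewrite mulr_suml; apply: id_sum => // [|x hx _].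
  exact: ideal_pow_is_ideal.
rewrite mulr_sumr; apply: id_sum => // [|y hy _]; first exact: ideal_pow_is_ideal.
rewrite mulrACA; apply: idMl; first exact: ideal_pow_is_ideal.
apply: gen_ideal_incl; have [s1 [h1 [h2 ->]]] := hs _ hx; have [s2 [h3 [h4 ->]]] := ht _ hy.
exists (s1 ++ s2); rewrite size_cat h1 h3 big_cat; split=> //; split=> // w.
by rewrite mem_cat => /orP[/h2|/h4].
Qed.

Lemma ideal_pow0 A p : ideal_pow A 0 p.
Proof.
rewrite -[p]mulr1; apply: idMl; first exact: ideal_pow_is_ideal.
by apply: gen_ideal_incl; exists [::]; rewrite big_nil.
Qed.

Lemma ideal_pow1 A p : is_ideal A -> ideal_pow A 1 p <-> A p.
Proof.
move=> hA; split.
  apply: (gen_ideal_min hA) => g [s [hs [hx ->]]]; case: s hs hx => [|x [|y s]] // _ hx.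
  by rewrite big_seq1; apply: hx; rewrite inE.
move=> hp; apply: gen_ideal_incl; exists [:: p]; rewrite big_seq1; split=> //; split=> // x.
by rewrite inE => /eqP ->.
Qed.

(** The degrees of both factors are recorded because [Good_all] moves variables from one factor to
    the other. *)
Definition prod_span A B (q : nat) p :=
  exists s : seq (nat * ({mpoly k[m]} * {mpoly k[m]})),
    (forall x, x \in s -> [/\ (x.1 <= q)%N, A x.2.1, is_homog x.1 x.2.1, B x.2.2 & is_homog (q - x.1) x.2.2])
    /\ p = \sum_(x <- s) x.2.1 * x.2.2.

Lemma prod_span0 A B (q : nat) : prod_span A B q 0.
Proof. by exists [::]; rewrite big_nil. Qed.

Lemma prod_spanD A B (q : nat) p p' : prod_span A B q p -> prod_span A B q p' -> prod_span A B q (p + p').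
Proof.
move=> [s [hs ->]] [t [ht ->]]; exists (s ++ t); rewrite big_cat; split=> // x.
by rewrite mem_cat => /orP[/hs|/ht].
Qed.

Lemma prod_span_sum A B (q : nat) (T : eqType) (r : seq T) (F : T -> {mpoly k[m]}) :
  (forall x, x \in r -> prod_span A B q (F x)) -> prod_span A B q (\sum_(x <- r) F x).
Proof.
move=> H; rewrite big_seq; apply: (big_ind (prod_span A B q)).
- exact: prod_span0.
- by move=> x y; apply: prod_spanD.
- by move=> x; apply: H.
Qed.

Lemma prod_span_hcompM A B (q : nat) a b : homog_ideal A -> homog_ideal B -> A a -> B b ->
  prod_span A B q (hcomp q (a * b)).
Proof.
move=> [_ hA] [_ hB] ha hb.
rewrite {1}(@hcomp_partition a (msize a)) // mulr_suml hcomp_sum.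
apply: prod_span_sum => i _.
have [hi|hi] := leqP i q; last by rewrite (hcompM_low _ (homog_hcomp i a)) //; apply: prod_span0.
rewrite -(subnKC hi) hcompM_homog ?homog_hcomp // subnKC //.
exists [:: (nat_of_ord i, (hcomp i a, hcomp (q - i) b))]; rewrite big_seq1; split=> // x.
rewrite inE => /eqP -> /=; split=> //; try exact: homog_hcomp.
  exact: hA.
exact: hB.
Qed.

Lemma ideal_powD_span A n n' p (q : nat) : homog_ideal A -> homog_ideal (ideal_pow A n) ->
  homog_ideal (ideal_pow A n') -> ideal_pow A (n + n') p ->
  prod_span (ideal_pow A n) (ideal_pow A n') q (hcomp q p).
Proof.
move=> hA hn hn' [s [hs ->]]; rewrite hcomp_sum; apply: prod_span_sum => x /hs [t [ht [hx ->]]].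
rewrite -{1}(cat_take_drop n t) big_cat /= mulrA.
apply: prod_span_hcompM => //.
  apply: idMl; first exact: ideal_pow_is_ideal.
  apply: gen_ideal_incl; exists (take n t); split; first by rewrite size_takel // ht leq_addr.
  by split=> // y /mem_take /hx.
apply: gen_ideal_incl; exists (drop n t); split; first by rewrite size_drop ht addKn.
by split=> // y /mem_drop /hx.
Qed.

Lemma ideal_pow_homog A n : homog_ideal A -> homog_ideal (ideal_pow A n).
Proof.
move=> hA; elim: n => [|n IH].
  by split=> [|p d _]; [exact: ideal_pow_is_ideal|exact: ideal_pow0].
split=> [|p d hp]; first exact: ideal_pow_is_ideal.
have h1 : homog_ideal (ideal_pow A 1).
  split=> [|f e /(ideal_pow1 _ (homog_is_ideal hA)) hf]; first exact: ideal_pow_is_ideal.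
  by apply/(ideal_pow1 _ (homog_is_ideal hA)); case: hA => _; apply.
have := @ideal_powD_span A n 1 p d hA IH h1; rewrite addn1 => /(_ hp) [s [hs ->]].
apply: id_sum => [|x /hs [_ ha _ hb _] _]; first exact: ideal_pow_is_ideal.
by rewrite -addn1; apply: ideal_powM.
Qed.

End Basics.

(** * Products of ideals *)

Definition zmul (k : fieldType) (m : nat) (z : {mpoly k[m]}) (A : {mpoly k[m]} -> Prop) (h : {mpoly k[m]}) :=
  exists2 g, A g & h = z * g.

(** A representative in A of the class of X_w in R/zR. It exists where z is onto on R/A, and above
    the bijectivity bound it is unique modulo zA. *)
Definition is_lift (k : fieldType) (m : nat) (A : {mpoly k[m]} -> Prop) (z : {mpoly k[m]}) (w : 'X_{1..m})
    (a : {mpoly k[m]}) :=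
  [/\ A a, is_homog (mdeg w) a & exists g, a = 'X_[w] - z * g].

Section ZMul.
Variables (k : fieldType) (m : nat) (z : {mpoly k[m]}) (A : {mpoly k[m]} -> Prop).
Hypothesis hA : is_ideal A.

Lemma zmul0 : zmul z A 0.
Proof. by exists 0; rewrite ?mulr0 //; apply: id0. Qed.
Lemma zmulD p q : zmul z A p -> zmul z A q -> zmul z A (p + q).
Proof. by move=> [a ha ->] [b hb ->]; exists (a + b); rewrite ?mulrDr //; apply: idD. Qed.
Lemma zmulM r p : zmul z A p -> zmul z A (r * p).
Proof. by move=> [a ha ->]; exists (r * a); rewrite ?(mulrCA r) //; apply: idMl. Qed.
Lemma zmul_ideal : is_ideal (zmul z A).
Proof. split; [exact: zmul0 | split; [exact: zmulD | exact: zmulM]]. Qed.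
End ZMul.

(** * Lifts of monomials modulo z *)

Section Lift.
Variables (k : fieldType) (m : nat) (z : {mpoly k[m]}) (A : {mpoly k[m]} -> Prop) (al : nat).
Hypothesis hA : homog_ideal A.
Hypothesis hz : is_homog 1 z.
Hypothesis hcm : mul_bij A z al.
Let iA : is_ideal A := homog_is_ideal hA.

Lemma lift_ex w : (al <= mdeg w)%N -> exists a, is_lift A z w a.
Proof.
move=> hw; have hc := mul_bij_onto hcm hw.
case e : (mdeg w) hc => [|d] hc.
  exists 'X_[w]; split; [|exact: homogXm|by exists 0; rewrite mulr0 subr0].
  by apply: (onto_deg0 hA hz hc); apply: homogXd.
have [b hb1 hb2] := onto_homog hA hz hc (homogXd k e).
exists ('X_[w] - z * b); split=> //; last by exists b.
apply: homogB; first exact: homogXm.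
by rewrite e -add1n; apply: homogM.
Qed.

Definition mlift w : {mpoly k[m]} := epsilon (inhabits 0) (is_lift A z w).

Lemma liftP w : (al <= mdeg w)%N -> is_lift A z w (mlift w).
Proof. by move=> /lift_ex; apply: epsilon_spec. Qed.

Lemma lift_in w : (al <= mdeg w)%N -> A (mlift w).
Proof. by case/liftP. Qed.

(** In degrees above [al] the map A/zA -> R/zR is bijective: lifts make it onto and [mul_bij_div]
    makes it injective. So an element of A is determined modulo zA by its monomials. *)
Lemma lift_sum (r : seq 'X_{1..m}) (c : 'X_{1..m} -> k) u t :
  (al < t)%N -> (forall v, v \in r -> mdeg (u + v)%MM = t) ->
  A ('X_[u] * \sum_(v <- r) c v *: 'X_[v]) ->
  zmul z A ('X_[u] * (\sum_(v <- r) c v *: 'X_[v]) - \sum_(v <- r) c v *: mlift (u + v)%MM).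
Proof.
move=> ht hr hS.
have hl v : v \in r -> is_lift A z (u + v)%MM (mlift (u + v)%MM).
  by move=> hv; apply: liftP; rewrite hr // ltnW.
have hm : 'X_[u] * (\sum_(v <- r) c v *: 'X_[v]) = \sum_(v <- r) c v *: 'X_[u + v] :> {mpoly k[m]}.
  by rewrite mulr_sumr; apply: eq_bigr => v _; rewrite mpolyXD -scalerAr.
have [g hg] : exists g, 'X_[u] * (\sum_(v <- r) c v *: 'X_[v]) - \sum_(v <- r) c v *: mlift (u + v)%MM = z * g.
  rewrite hm -sumrB; rewrite big_seq.
  apply: (big_ind (fun x => exists g, x = z * g)) => [|x y [a ->] [b ->]|v /hl[_ _ [g ->]]].
  - by exists 0; rewrite mulr0.
  - by exists (a + b); rewrite mulrDr.
  - by exists (c v *: g); rewrite -scalerBr opprB addrCA subrr addr0 scalerAr.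
have [t' et] : exists t', t = t'.+1 by case: t ht {hr} => // t' _; exists t'.
have [|||g' hg' e] := mul_bij_div hA hz hcm _ _ _ hg (j := t').
- by rewrite -ltnS -et.
- by apply: idB => //; apply: id_sum => // v /hl[h _ _] _; apply: idZ.
- rewrite -et; apply: homogB; last by apply: homog_sum => v hv _; apply: homogZ; case: (hl _ hv) => _ + _; rewrite hr.
  by rewrite hm; apply: homog_sum => v hv _; apply: homogZ; apply: homogXd; rewrite hr.
by exists g'.
Qed.

Lemma lift_var i w : (al <= mdeg w)%N -> zmul z A (mlift (U_(i) + w)%MM - 'X_i * mlift w).
Proof.
move=> hw; have [h1 h2 [g1 e1]] := liftP hw.
have hw' : (al <= mdeg (U_(i) + w)%MM)%N by rewrite mdegD; apply: leq_trans hw _; apply: leq_addl.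
have [h3 h4 [g2 e2]] := liftP hw'.
have e : mlift (U_(i) + w)%MM - 'X_i * mlift w = z * ('X_i * g1 - g2).
  by rewrite e1 e2 mpolyXD; ring.
have [||g' hg' e'] := mul_bij_div hA hz hcm hw _ _ e.
- by apply: idB => //; apply: idMl.
- apply: homogB; first by move: h4; rewrite mdegD mdeg1 add1n.
  by rewrite -add1n; apply: homogM => //; apply: homogXd; rewrite mdeg1.
by exists g'.
Qed.

(** Modulo zA, an element of degree above [al] is a combination of lifts, and the lift of X_i X_w is
    X_i times the lift of X_w. The correction in zA also has the required form, z being a
    combination of the variables. *)
Lemma gen_var t b : (al <= t)%N -> A b -> is_homog t.+1 b ->
  exists2 bf : 'I_m -> {mpoly k[m]}, (forall i, A (bf i) /\ is_homog t (bf i)) & b = \sum_i 'X_i * bf i.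
Proof.
move=> ht hb hh.
pose G b := exists2 bf : 'I_m -> {mpoly k[m]}, (forall i, A (bf i) /\ is_homog t (bf i)) & b = \sum_i 'X_i * bf i.
have GD x y : G x -> G y -> G (x + y).
  move=> [f hf ->] [g hg ->]; exists (fun i => f i + g i).
    by move=> i; case: (hf i) (hg i) => ? ? [? ?]; split; [apply: idD|apply: homogD].
  by rewrite -big_split; apply: eq_bigr => i _; rewrite mulrDr.
have GZ c x : G x -> G (c *: x).
  move=> [f hf ->]; exists (fun i => c *: f i).
    by move=> i; case: (hf i) => ? ?; split; [apply: idZ|apply: homogZ].
  by rewrite scaler_sumr; apply: eq_bigr => i _; rewrite scalerAr.
have G0 : G 0.
  exists (fun=> 0); first by move=> i; split; [apply: id0|apply: homog0].
  by rewrite big1 // => i _; rewrite mulr0.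
have G1 i g : A g -> is_homog t g -> G ('X_i * g).
  move=> hg1 hg2; exists (fun j => if j == i then g else 0).
    by move=> j; case: eqP => _; split=> //; [apply: id0|apply: homog0].
  rewrite (bigD1 i) //= eqxx big1 ?addr0 // => j /negbTE ->; by rewrite mulr0.
have Gz g : A g -> is_homog t g -> G (z * g).
  move=> hg1 hg2; rewrite (homog1E hz) mulr_suml.
  apply: (big_ind G) => // i _; rewrite -scalerAl; apply: (GZ); exact: G1.
have hd : forall v, v \in msupp b -> mdeg v = t.+1 by apply/is_homogP.
have zG h : zmul z A h -> is_homog t.+1 h -> G h.
  move=> [g hg ->] hgh.
  rewrite -(hcomp_id hgh) -{1}[t.+1]add1n hcompM_homog //.
  by apply: Gz (homog_hcomp _ _); case: hA => _; apply.
have := @lift_sum (msupp b) (fun v => b@_v) 0%MM t.+1 ht.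
rewrite mpolyX0 mul1r -mpolyE => H.
have {}H := H (fun v hv => etrans (congr1 _ (add0m v)) (hd v hv)) hb.
have hlv v : v \in msupp b -> is_lift A z v (mlift v).
  by move=> hv; apply: liftP; rewrite hd // ltnW.
rewrite -[b](subrK (\sum_(v <- msupp b) b@_v *: mlift (0 + v)%MM)); apply: (GD).
  apply: (zG) => //; apply: homogB => //; apply: homog_sum => v hv _; apply: homogZ.
  by rewrite add0m -(hd _ hv); case: (hlv _ hv).
rewrite big_seq; apply: (big_ind G) => // v hv; apply: (GZ); rewrite add0m.
have [i [w ew]] : exists i w, v = (U_(i) + w)%MM by apply: mdegS_var; rewrite hd.
have hw : mdeg w = t by move: (hd _ hv); rewrite ew mdegD mdeg1 add1n => -[].
have [hw1 hw2 _] : is_lift A z w (mlift w) by apply: liftP; rewrite hw.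
rewrite -[mlift v](subrK ('X_i * mlift w)); apply: (GD); last by apply: (G1); rewrite -?hw.
apply: (zG); first by rewrite ew; apply: lift_var; rewrite hw.
apply: homogB; first by rewrite -(hd _ hv); case: (hlv _ hv).
by rewrite -add1n; apply: homogM; [apply: homogXd; rewrite mdeg1|rewrite -hw].
Qed.

End Lift.

Definition low_part (m : nat) (al : nat) (w : 'X_{1..m}) : 'X_{1..m} :=
  epsilon (inhabits 0%MM) (fun u => (u <= w)%MM /\ mdeg u = al).

Lemma low_partP (m : nat) (al : nat) (w : 'X_{1..m}) : (al <= mdeg w)%N ->
  (low_part al w <= w)%MM /\ mdeg (low_part al w) = al.
Proof.
move=> hw; apply: (epsilon_spec (inhabits 0%MM) (fun u => (u <= w)%MM /\ mdeg u = al)).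
by have [u [v [-> <-]]] := mdeg_split hw; exists u; split=> //; apply: lem_addr.
Qed.

(** * Bijectivity for a product of ideals *)

Section Prod.
Variables (k : fieldType) (m : nat) (z : {mpoly k[m]}) (A B P : {mpoly k[m]} -> Prop) (al be : nat).
Hypothesis hA : homog_ideal A.
Hypothesis hB : homog_ideal B.
Hypothesis hP : homog_ideal P.
Hypothesis hAB : forall x y, A x -> B y -> P (x * y).
Hypothesis hspan : forall q p, P p -> is_homog q p -> prod_span A B q p.
Hypothesis hz : is_homog 1 z.
Hypothesis cA : mul_bij A z al.
Hypothesis cB : mul_bij B z be.
Let iA : is_ideal A := homog_is_ideal hA.
Let iB : is_ideal B := homog_is_ideal hB.
Let iP : is_ideal P := homog_is_ideal hP.
Let T := zmul z P.
Let iT : is_ideal T := zmul_ideal z iP.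
Let aw := mlift z A.
Let bw := mlift z B.

Let TA a b : zmul z A a -> B b -> T (a * b).
Proof. by move=> [g hg ->] hb; exists (g * b); rewrite ?mulrA //; apply: hAB. Qed.
Let TB a b : A a -> zmul z B b -> T (a * b).
Proof. by move=> ha [g hg ->]; exists (a * g); rewrite 1?mulrCA //; apply: hAB. Qed.

(** Both products are X_i times [aw w1 * bw w2] modulo zP. *)
Lemma prod_move i w1 w2 : (al <= mdeg w1)%N -> (be <= mdeg w2)%N ->
  T (aw (U_(i) + w1)%MM * bw w2 - aw w1 * bw (U_(i) + w2)%MM).
Proof.
move=> h1 h2.
have e1 := TA (lift_var hA hz cA i h1) (lift_in hB hz cB h2).
have e2 := TB (lift_in hA hz cA h1) (lift_var hB hz cB i h2).
have := idB iT e1 e2; rewrite -/aw -/bw; congr (T _); ring.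
Qed.

(** Single-variable moves join the two factorizations; the induction is on the distance from w1 to
    v1. A variable can leave a factor only if its degree exceeds the bound, and since the total
    degree is above al + be, the two factors are never both at their bounds. *)
Lemma prod_conn w1 w2 v1 v2 : (w1 + w2 = v1 + v2)%MM -> (al + be < mdeg (w1 + w2)%MM)%N ->
  (al <= mdeg w1)%N -> (be <= mdeg w2)%N -> (al <= mdeg v1)%N -> (be <= mdeg v2)%N ->
  T (aw w1 * bw w2 - aw v1 * bw v2).
Proof.
have [n] := ubnP (mdeg (w1 - v1)%MM + mdeg (v1 - w1)%MM)%N.
elim: n w1 w2 => // n IH w1 w2 hn e ht ha hb ha' hb'.
have ei i : (w1 i + w2 i = v1 i + v2 i)%N by rewrite -!mnmDE e.
have ed : (mdeg w1 + mdeg w2 = mdeg v1 + mdeg v2)%N by rewrite -!mdegD e.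
have hex (u v : 'X_{1..m}) : (0 < mdeg (u - v)%MM)%N -> exists i, (v i < u i)%N.
  move=> /mdegS_var[i [w /mnmP /(_ i)]]; rewrite mnmBE mnmDE mnm1E eqxx => h.
  by exists i; lia.
have hnex (u v : 'X_{1..m}) : mdeg (u - v)%MM = 0%N -> forall i, (u i <= v i)%N.
  by move/eqP; rewrite mdeg_eq0 => /eqP /mnmP h i; move: (h i); rewrite mnmBE mnm0E; lia.
have hle (u v : 'X_{1..m}) : (forall i, (u i <= v i)%N) -> (mdeg u + mdeg (v - u)%MM = mdeg v)%N.
  by move=> h; rewrite -mdegD; congr mdeg; apply/mnmP => i; rewrite mnmDE mnmBE subnKC.
have hdS (u v : 'X_{1..m}) i : (v i < u i)%N -> mdeg (u - v)%MM = (mdeg (u - (U_(i) + v))%MM).+1.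
  move=> hi; rewrite -add1n -(mdeg1 i) -mdegD; congr mdeg; apply/mnmP => j.
  by rewrite mnmDE !mnmBE mnmDE mnm1E; case: eqP => [<-|_]; lia.
have hdE (u v : 'X_{1..m}) i : (v i < u i)%N -> (U_(i) + v - u)%MM = (v - u)%MM.
  by move=> hi; apply/mnmP => j; rewrite !mnmBE mnmDE mnm1E; case: eqP => [<-|_]; lia.
have [/andP[E2 hw2]|C1] := boolP ((0 < mdeg (v1 - w1)%MM)%N && (be < mdeg w2)%N).
  have [i hi] := hex _ _ E2.
  have [u eu] : exists u, w2 = (U_(i) + u)%MM.
    by apply: mdvdX_ex; rewrite lep1mP; move: (ei i); lia.
  have hu : mdeg w2 = (mdeg u).+1 by rewrite eu mdegD mdeg1 add1n.
  rewrite eu; apply: (id_trans iT (q := aw (U_(i) + w1)%MM * bw u)).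
    by apply: id_sym => //; apply: prod_move => //; lia.
  apply: IH => //.
  + by rewrite (hdE _ _ _ hi); move: hn; rewrite (hdS _ _ _ hi); lia.
  + by rewrite -e eu addmCA addmA.
  + by move: ht; rewrite eu !mdegD; lia.
  + by rewrite mdegD; lia.
  + by lia.
have [/andP[E1 hw1]|C2] := boolP ((0 < mdeg (w1 - v1)%MM)%N && (al < mdeg w1)%N).
  have [i hi] := hex _ _ E1.
  have [u eu] : exists u, w1 = (U_(i) + u)%MM.
    by apply: mdvdX_ex; rewrite lep1mP; lia.
  have hu : mdeg w1 = (mdeg u).+1 by rewrite eu mdegD mdeg1 add1n.
  rewrite eu; apply: (id_trans iT (q := aw u * bw (U_(i) + w2)%MM)).
    by apply: prod_move => //; lia.
  have hui : (v1 i <= u i)%N by move: hi; rewrite eu mnmDE mnm1E eqxx.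
  apply: IH => //.
  + move: hn; rewrite eu (hdS (U_(i) + u)%MM v1 i) ?mnmDE ?mnm1E ?eqxx //.
    have -> : (U_(i) + u - (U_(i) + v1))%MM = (u - v1)%MM.
      by apply/mnmP => j; rewrite !mnmBE !mnmDE mnm1E; lia.
    have -> : (v1 - (U_(i) + u))%MM = (v1 - u)%MM.
      by apply/mnmP => j; rewrite !mnmBE !mnmDE mnm1E; case: eqP => [<-|_]; lia.
    by lia.
  + by rewrite -e eu addmCA addmA.
  + by move: ht; rewrite eu !mdegD; lia.
  + by lia.
  + by rewrite mdegD; lia.
have := ht; rewrite mdegD => ht'.
have [E2|E2] := posnP (mdeg (v1 - w1)%MM); last first.
  have E1 : mdeg (w1 - v1)%MM = 0%N by lia.
  by have := hle _ _ (hnex _ _ E1); lia.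
have [E1|E1] := posnP (mdeg (w1 - v1)%MM); last first.
  by have := hle _ _ (hnex _ _ E2); lia.
have ew : w1 = v1 by apply/mnmP => i; apply/eqP; rewrite eqn_leq !hnex.
have -> : w2 = v2 by apply/mnmP => i; move: (ei i); rewrite ew => /addnI.
by rewrite ew subrr; apply: id0.
Qed.

Definition fw w := aw (low_part al w) * bw (w - low_part al w)%MM.

Lemma fwP w1 w2 w : w = (w1 + w2)%MM -> (al + be < mdeg w)%N -> (al <= mdeg w1)%N -> (be <= mdeg w2)%N ->
  T (aw w1 * bw w2 - fw w).
Proof.
move=> e hw h1 h2; rewrite /fw.
have [|hle hd] := @low_partP m al w; first by lia.
have ew : (low_part al w + (w - low_part al w) = w)%MM by rewrite addmC submK.
have hd2 : (mdeg (low_part al w) + mdeg (w - low_part al w)%MM = mdeg w)%N by rewrite -mdegD ew.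
apply: prod_conn => //; rewrite -?e //; lia.
Qed.

(* Since fw w does not depend on the factorization modulo zP, Phi sends a form of degree
   > al + be to a well-defined class modulo zP; it is the identity on P and kills zR. *)
Variable n : nat.
Definition Phi (f : {mpoly k[m]}) := \sum_(w : 'X_{1..m < n}) f@_w *: fw w.

Lemma Phi0 : Phi 0 = 0.
Proof. by rewrite /Phi big1 // => w _; rewrite mcoeff0 scale0r. Qed.
Lemma PhiD f g : Phi (f + g) = Phi f + Phi g.
Proof. by rewrite /Phi -big_split; apply: eq_bigr => w _; rewrite mcoeffD scalerDl. Qed.
Lemma PhiZ c f : Phi (c *: f) = c *: Phi f.
Proof. by rewrite /Phi scaler_sumr; apply: eq_bigr => w _; rewrite mcoeffZ scalerA. Qed.
Lemma Phi_sum (I : Type) (r : seq I) (p : pred I) (F : I -> {mpoly k[m]}) :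
  Phi (\sum_(x <- r | p x) F x) = \sum_(x <- r | p x) Phi (F x).
Proof. exact: (big_morph Phi PhiD Phi0). Qed.
Lemma PhiX w : (mdeg w < n)%N -> Phi 'X_[w] = fw w.
Proof.
move=> hw; rewrite /Phi (bigD1 (BMultinom hw)) //= mcoeffX eqxx scale1r big1 ?addr0 // => v hv.
rewrite mcoeffX; case: eqP => [e|_]; last by rewrite scale0r.
by case/eqP: hv; apply: val_inj; rewrite /= e.
Qed.

Definition Good h := T (h - Phi h).
Lemma Good0 : Good 0.
Proof. by rewrite /Good Phi0 subr0; apply: id0. Qed.
Lemma GoodD f g : Good f -> Good g -> Good (f + g).
Proof. by move=> hf hg; rewrite /Good PhiD opprD addrACA; apply: idD. Qed.

Lemma Good_high a b s t : (al < s)%N -> (be <= t)%N -> (s + t < n)%N ->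
  A a -> is_homog s a -> B b -> is_homog t b -> Good (a * b).
Proof.
move=> hs ht hn ha has hb hbt; rewrite /Good.
have hda v : v \in msupp a -> mdeg v = s by apply/is_homogP.
have hdb v : v \in msupp b -> mdeg v = t by apply/is_homogP.
pose S1 := \sum_(w <- msupp a) a@_w *: (mlift z A w * b).
apply: (id_trans iT (q := S1)).
  have := @lift_sum k m z A al hA hz cA (msupp a) (fun v => a@_v) 0%MM s hs.
  rewrite mpolyX0 !mul1r -mpolyE => H.
  have {}H := H (fun v hv => etrans (congr1 _ (add0m v)) (hda v hv)) ha.
  have := TA H hb; rewrite mulrBl mulr_suml /S1.
  by under eq_bigr => i _ do rewrite add0m -scalerAl.
rewrite {1}(mpolyE a) mulr_suml Phi_sum /S1 -sumrB; apply: id_sum => // w hw _.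
rewrite -!scalerAl PhiZ -scalerBr; apply: idZ => //.
(* [a] is now expanded into lifts; one variable is passed to [b], whose degree t + 1 then exceeds
   [be] as [lift_sum] for B demands. *)
have [i [u eu]] : exists i u, w = (U_(i) + u)%MM by apply: mdegS_var; rewrite hda //; lia.
have hu : (al <= mdeg u)%N by move: (hda _ hw); rewrite eu mdegD mdeg1; lia.
rewrite eu; apply: (id_trans iT (q := mlift z A u * ('X_i * b))).
  have := TA (lift_var hA hz cA i hu) hb; congr (T _); ring.
pose S2 := \sum_(v <- msupp b) b@_v *: (mlift z A u * mlift z B (U_(i) + v)%MM).
have hiv v : v \in msupp b -> mdeg (U_(i) + v)%MM = t.+1.
  by move=> /hdb hv; rewrite mdegD mdeg1 hv.
apply: (id_trans iT (q := S2)).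
  have ht' : (be < t.+1)%N by [].
  have := @lift_sum k m z B be hB hz cB (msupp b) (fun v => b@_v) U_(i)%MM t.+1 ht' hiv.
  rewrite -mpolyE => /(_ (idMl iB _ hb)) H.
  have := TB (lift_in hA hz cA hu) H; rewrite mulrBr mulr_sumr /S2.
  by under [X in T (_ - X)]eq_bigr => j _ do rewrite -scalerAr.
rewrite {1}(mpolyE b) mulr_sumr Phi_sum /S2 -sumrB; apply: id_sum => // v hv _.
rewrite -scalerAr PhiZ -scalerBr; apply: idZ => //.
rewrite -mpolyXD PhiX; last first.
  by move: (hda _ hw); rewrite eu !mdegD mdeg1 (hdb _ hv); lia.
apply: fwP => //; first by rewrite addmCA addmA.
  by rewrite -eu mdegD (hda _ hw) (hdb _ hv); lia.
by rewrite hiv //; lia.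
Qed.

(** Reduction to [Good_high]: when one factor has too low a degree, the other is above its own
    bound, so [gen_var] extracts a variable from it and hands it over. The total degree above al +
    be makes the measure drop. *)
Lemma Good_all a b s t : (al + be < s + t)%N -> (s + t < n)%N ->
  A a -> is_homog s a -> B b -> is_homog t b -> Good (a * b).
Proof.
have GS (F : 'I_m -> {mpoly k[m]}) : (forall i, Good (F i)) -> Good (\sum_i F i).
  by move=> H; apply: (big_ind Good) => //; [exact: Good0|exact: GoodD].
have [l] := ubnP (al.+1 - s + (be - t))%N; elim: l s t a b => // l IH s t a b hl ht hn ha hsa hb hsb.
have hX i : is_homog 1 ('X_i : {mpoly k[m]}) by apply: homogXd; rewrite mdeg1.
have [hs|hs] := ltnP al s.
  have [hbt|hbt] := leqP be t; first exact: (Good_high hs hbt hn ha hsa hb hsb).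
  case: s hs hsa hl ht hn => // s hs hsa hl ht hn.
  have [f hf ->] := gen_var hA hz cA hs ha hsa.
  rewrite mulr_suml; apply: (GS) => i; have [hf1 hf2] := hf i.
  rewrite mulrAC mulrC; apply: (IH s t.+1) => //; try lia.
    exact: idMl.
  by rewrite -add1n; apply: homogM.
case: t hsb hl ht hn => [|t] hsb hl ht hn; first by lia.
have [|f hf ->] := gen_var hB hz cB _ hb hsb; first by lia.
rewrite mulr_sumr; apply: (GS) => i; have [hf1 hf2] := hf i.
rewrite mulrA; apply: (IH s.+1 t) => //; try lia.
  exact: idMr.
by rewrite -addn1; apply: homogM.
Qed.

(** Modulo zP the image of X_i X_v is X_i times the product of lifts attached to v; combining these
    with the coefficients of z gives z times an element of P. *)
Lemma Phi_z g q : (al + be <= q)%N -> (q.+1 < n)%N -> is_homog q g -> T (Phi (z * g)).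
Proof.
move=> hq hn /is_homogP hg; rewrite (mpolyE g) mulr_sumr Phi_sum; apply: id_sum => // v /hg hv _.
rewrite -scalerAr PhiZ; apply: idZ => //.
have [v1 [v2 [ev h1]]] : exists v1 v2, v = (v1 + v2)%MM /\ mdeg v1 = al.
  by apply: mdeg_split; rewrite hv; lia.
have h2 : (be <= mdeg v2)%N by move: hv; rewrite ev mdegD; lia.
have h1' : (al <= mdeg v1)%N by lia.
have hT : T (z * (aw v1 * bw v2)).
  by exists (aw v1 * bw v2) => //; apply: hAB; [apply: (lift_in hA hz cA)|apply: (lift_in hB hz cB)].
apply: (id_move iT _ hT).
rewrite {1 2}(homog1E hz) !mulr_suml Phi_sum -sumrB; apply: id_sum => // i _ _.
rewrite -!scalerAl PhiZ -scalerBr; apply: idZ => //.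
have hd : mdeg (U_(i) + v)%MM = q.+1 by rewrite mdegD mdeg1 hv.
rewrite -mpolyXD PhiX ?hd //.
apply: (id_trans iT (q := aw (U_(i) + v1)%MM * bw v2)).
  apply: id_sym => //; apply: fwP => //; rewrite ?hd //; first by rewrite ev addmA.
  by rewrite mdegD; lia.
have := TA (lift_var hA hz cA i h1') (lift_in hB hz cB h2); congr (T _); rewrite -/aw -/bw; ring.
Qed.

End Prod.

Lemma mul_bij_prod (k : fieldType) (m : nat) (z : {mpoly k[m]}) (A B P : {mpoly k[m]} -> Prop) al be :
  homog_ideal A -> homog_ideal B -> homog_ideal P -> (forall x y, A x -> B y -> P (x * y)) ->
  (forall q p, P p -> is_homog q p -> prod_span A B q p) -> is_homog 1 z ->
  mul_bij A z al -> mul_bij B z be -> mul_bij P z (al + be).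
Proof.
move=> hA hB hP hAB hsp hz cA cB j hj.
have iP := homog_is_ideal hP.
have hc : mul_onto P z j.
  apply: (onto_mono iP hj); apply: (onto_mul iP hAB); first exact: (mul_bij_onto cA).
  exact: (mul_bij_onto cB).
split=> // f hf hzf.
(* For z = 0, being onto already puts every form of degree j in P. *)
have [z0|z0] := eqVneq z 0.
  by have [b] := hc _ hf; rewrite z0 mul0r subr0.
have iT := zmul_ideal z iP.
suff [g hg /(mulfI z0) ->] : zmul z P (z * f) by [].
have hzf' : is_homog j.+1 (z * f) by rewrite -add1n; apply: homogM.
(* zf agrees with its image under [Phi] modulo zP because it lies in P, and that image is in zP
   because zf is a multiple of z. The cut-off j + 2 lets [Phi] see degree j + 1. *)
apply: (id_move iT (q := Phi z A B al j.+2 (z * f))); last first.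
  exact: (Phi_z hA hB hP hAB hz cA cB hj).
have [s [hs ->]] := hsp _ _ hzf hzf'.
rewrite big_seq; apply: (big_ind (Good z A B P al j.+2)).
- exact: Good0.
- by move=> x y; apply: GoodD.
- move=> x /hs [h1 h2 h3 h4 h5]; apply: (Good_all hA hB hP hAB hz cA cB _ _ h2 h3 h4 h5); lia.
Qed.

(** * Initial ideals and Hilbert functions *)

Definition asbool (P : Prop) : bool := if excluded_middle_informative P then true else false.

Lemma asboolP P : reflect P (asbool P).
Proof. by rewrite /asbool; case: excluded_middle_informative => h; constructor. Qed.

Definition mons (m d : nat) : seq 'X_{1..m} :=
  [seq u <- [seq bmnm u | u <- enum {: 'X_{1..m < d.+1}}] | mdeg u == d].

Lemma mem_mons m d u : (u \in mons m d) = (mdeg u == d).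
Proof.
rewrite mem_filter; apply: andb_idr => /eqP hu.
have h : (mdeg u < d.+1)%N by rewrite hu.
by apply/mapP; exists (BMultinom h) => //; rewrite mem_enum.
Qed.

Lemma mons_uniq m d : uniq (mons m d).
Proof. by apply/filter_uniq; rewrite map_inj_uniq ?enum_uniq //; apply: val_inj. Qed.

(** * Polynomials with prescribed support as row vectors *)

Section PolV.
Variables (k : fieldType) (m : nat) (s : seq 'X_{1..m}).
Hypothesis us : uniq s.

Definition polv (v : 'rV[k]_(size s)) : {mpoly k[m]} := \sum_i v ord0 i *: 'X_[nth 0%MM s i].
Definition vecp (p : {mpoly k[m]}) : 'rV[k]_(size s) := \row_i p@_(nth 0%MM s i).

Lemma polvD v w : polv (v + w) = polv v + polv w.
Proof. by rewrite /polv -big_split; apply: eq_bigr => i _; rewrite mxE scalerDl. Qed.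
Lemma polv0 : polv 0 = 0.
Proof. by rewrite /polv big1 // => i _; rewrite mxE scale0r. Qed.
Lemma polvZ c v : polv (c *: v) = c *: polv v.
Proof. by rewrite /polv scaler_sumr; apply: eq_bigr => i _; rewrite mxE scalerA. Qed.
Lemma polv_sum (T : Type) (r : seq T) (F : T -> 'rV[k]_(size s)) :
  polv (\sum_(x <- r) F x) = \sum_(x <- r) polv (F x).
Proof. exact: (big_morph polv polvD polv0). Qed.
Lemma polvN v : polv (- v) = - polv v.
Proof. by rewrite -scaleN1r polvZ scaleN1r. Qed.

Lemma polvK : cancel polv vecp.
Proof.
move=> v; apply/rowP => i; rewrite mxE /polv raddf_sum /=.
rewrite (bigD1 i) //= mcoeffZ mcoeffX eqxx mulr1 big1 ?addr0 // => j hj.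
by rewrite mcoeffZ mcoeffX nth_uniq // val_eqE (negbTE hj) mulr0.
Qed.

Lemma polv_supp v u : u \in msupp (polv v) -> u \in s.
Proof.
rewrite mcoeff_msupp /polv raddf_sum /=; apply: contraR => hu; rewrite big1 // => i _.
rewrite mcoeffZ mcoeffX; case: eqP => [e|_]; last by rewrite mulr0.
by move: hu; rewrite -e mem_nth.
Qed.

Lemma vecpK p : (forall u, u \in msupp p -> u \in s) -> polv (vecp p) = p.
Proof.
move=> hp; apply/mpolyP => u; rewrite /polv raddf_sum /=.
have [hu|hu] := boolP (u \in s).
  have hi : (index u s < size s)%N by rewrite index_mem.
  rewrite (bigD1 (Ordinal hi)) //= mcoeffZ mcoeffX mxE /= nth_index // eqxx mulr1 big1 ?addr0 //.
  move=> j hj; rewrite mcoeffZ mcoeffX; case: eqP => [e|_]; last by rewrite mulr0.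
  by case/eqP: hj; apply: val_inj; rewrite /= -e index_uniq.
rewrite (memN_msupp_eq0 (contra (hp u) hu)) big1 // => i _.
rewrite mcoeffZ mcoeffX; case: eqP => [e|_]; last by rewrite mulr0.
by move: hu; rewrite -e mem_nth.
Qed.

Lemma mulmx_polv n (v : 'rV[k]_n) (M : 'M[k]_(n, size s)) : polv (v *m M) = \sum_i v ord0 i *: polv (row i M).
Proof. by rewrite mulmx_sum_row polv_sum; apply: eq_bigr => i _; rewrite polvZ. Qed.

End PolV.

Section Initial.
Variables (k : fieldType) (m : nat) (le : rel 'X_{1..m}).
Hypothesis hle : term_order le.
Implicit Types (I A : {mpoly k[m]} -> Prop) (u v w : 'X_{1..m}).

Lemma torder_refl u : le u u. Proof. by case: hle. Qed.
Lemma torder_anti u v : le u v -> le v u -> u = v.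
Proof. by case: hle => _ [h _] h1 h2; apply: h; rewrite h1. Qed.
Lemma torder_trans v u w : le u v -> le v w -> le u w.
Proof. by case: hle => _ [_ [h _]]; apply: h. Qed.
Lemma torder_total u v : le u v \/ le v u.
Proof. by case: hle => _ [_ [_ [h _]]]; apply/orP. Qed.
Lemma torder_add u v w : le u v -> le (u + w)%MM (v + w)%MM.
Proof. by case: hle => _ [_ [_ [_ [_ h]]]]; apply: h. Qed.

Lemma torder_max (s : seq 'X_{1..m}) u : u \in s -> exists2 x, x \in s & forall v, v \in s -> le v x.
Proof.
elim: s u => // a s IH u _; case: s IH => [|b s] IH.
  by exists a; rewrite ?mem_head // => v; rewrite inE => /eqP ->; apply: torder_refl.
have [x hx1 hx2] := IH b (mem_head _ _).
case: (torder_total a x) => h.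
  by exists x => [|v]; [rewrite inE hx1 orbT|rewrite inE => /orP[/eqP -> //|/hx2]].
exists a; first exact: mem_head.
by move=> v; rewrite inE => /orP[/eqP ->|/hx2 h']; [apply: torder_refl|apply: torder_trans h].
Qed.

Lemma torder_min (s : seq 'X_{1..m}) u : u \in s -> exists2 x, x \in s & forall v, v \in s -> le x v.
Proof.
elim: s u => // a s IH u _; case: s IH => [|b s] IH.
  by exists a; rewrite ?mem_head // => v; rewrite inE => /eqP ->; apply: torder_refl.
have [x hx1 hx2] := IH b (mem_head _ _).
case: (torder_total a x) => h.
  exists a; first exact: mem_head.
  by move=> v; rewrite inE => /orP[/eqP ->|/hx2 h']; [apply: torder_refl|apply: torder_trans h'].
by exists x => [|v]; [rewrite inE hx1 orbT|rewrite inE => /orP[/eqP -> //|/hx2]].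
Qed.

Lemma lead_ex (f : {mpoly k[m]}) : f != 0 -> exists u, is_lead le f u.
Proof.
move=> /mlead_supp /torder_max [x h1 h2]; by exists x.
Qed.

Lemma is_leadX (f : {mpoly k[m]}) u v : is_lead le f u -> is_lead le ('X_[v] * f) (v + u)%MM.
Proof.
move=> [h1 h2]; split; first by rewrite mcoeff_msupp coeff_X_mulD -mcoeff_msupp.
move=> w /mem_msuppXM [hv /h2 h].
by rewrite -(submK hv) [(v + u)%MM]addmC; apply: torder_add.
Qed.

Lemma initialX I u : initial le I 'X_[u] <-> exists f, I f /\ is_lead le f u.
Proof.
split=> [h|h v]; first by apply: h; rewrite msuppX inE.
by rewrite msuppX inE => /eqP ->.
Qed.

Lemma initial_ideal I : is_ideal I -> is_ideal (initial le I).
Proof.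
move=> hI; split; first by move=> u; rewrite -mpolyC0 msupp0.
split=> [p q hp hq u /msuppD_le|a p hp u /msuppM_le].
  by rewrite mem_cat => /orP[/hp|/hq].
move=> /allpairsP [[v w] /= [hv /hp [f [hf hl]] ->]].
exists ('X_[v] * f); split; first exact: idMl.
exact: is_leadX.
Qed.

Lemma initial_mono I : is_ideal I -> mono_ideal (initial le I).
Proof.
move=> hI; split; first exact: initial_ideal.
by move=> p u hp hu; apply/initialX; apply: hp.
Qed.

Lemma initial_initial I : is_ideal I -> forall p, initial le (initial le I) p <-> initial le I p.
Proof.
move=> hI p; split=> h u hu.
  have [f [hf [hl _]]] := h u hu; exact: hf.
exists 'X_[u]; split; first by apply/initialX; apply: h.
by split; [rewrite msuppX inE|move=> v; rewrite msuppX inE => /eqP ->; apply: torder_refl].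
Qed.

Lemma initial_sub I A : (forall p, I p -> A p) -> forall p, initial le I p -> initial le A p.
Proof. by move=> h p hp u /hp [f [hf hl]]; exists f; split=> //; apply: h. Qed.

Lemma initial_homog_lead I u : homog_ideal I -> initial le I 'X_[u] ->
  exists2 f, I f /\ is_homog (mdeg u) f & is_lead le f u.
Proof.
move=> [hI hh] /initialX [f [hf [h1 h2]]]; exists (hcomp (mdeg u) f).
  by split; [apply: hh|apply: homog_hcomp].
split; first by rewrite mcoeff_msupp coeff_hcomp eqxx -mcoeff_msupp.
move=> v; rewrite mcoeff_msupp coeff_hcomp; case: ifP => _; last by rewrite eqxx.
by rewrite -mcoeff_msupp; apply: h2.
Qed.

Lemma initial_mul A B C p q : (forall x y, A x -> B y -> C (x * y)) -> is_ideal C ->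
  initial le A p -> initial le B q -> initial le C (p * q).
Proof.
move=> hABC hC hp hq u /msuppM_le /allpairsP [[v w] /= [hv hw ->]].
have [f [hf lf]] := hp v hv; have [g [hg lg]] := hq w hw.
have [h1 h2] := lf; have [h3 h4] := lg.
exists (f * g); split; first exact: hABC.
have key v' w' : v' \in msupp f -> w' \in msupp g -> (v' + w' = v + w)%MM -> v' = v.
  move=> hv' hw' e; apply: (@addIm _ w'); apply: torder_anti; first by apply: torder_add; apply: h2.
  by rewrite e [(v + w')%MM]addmC [(v + w)%MM]addmC; apply: torder_add; apply: h4.
split.
  rewrite mcoeff_msupp {1}(mpolyE f) mulr_suml raddf_sum /= (bigD1_seq v) ?msupp_uniq //=.
  rewrite -scalerAl mcoeffZ coeff_X_mulD big_seq_cond big1 ?addr0.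
    by rewrite mulf_neq0 // -mcoeff_msupp.
  move=> v' /andP[hv' /eqP hne]; rewrite -scalerAl mcoeffZ coeff_X_mul; case: ifP => [hle'|_]; last by rewrite mulr0.
  rewrite [g@__]memN_msupp_eq0 ?mulr0 //; apply/negP => hw'; apply: hne.
  by apply: (key _ _ hv' hw'); rewrite addmC submK.
move=> u' /msuppM_le /allpairsP [[v' w'] /= [hv' hw' ->]].
apply: (torder_trans (v := (v + w')%MM)); first by apply: torder_add; apply: h2.
by rewrite ![(v + _)%MM]addmC; apply: torder_add; apply: h4.
Qed.

Definition stdm I d : seq 'X_{1..m} := [seq u <- mons m d | ~~ asbool (initial le I 'X_[u])].
(** For homogeneous I, [nf_ex] and [nf_uniq] make the standard monomials of degree d a basis of
    (R/I)_d, so this is the Hilbert function of R/I. *)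
Definition hilb I d : nat := size (stdm I d).

Lemma stdmP I d u : reflect (mdeg u = d /\ ~ initial le I 'X_[u]) (u \in stdm I d).
Proof.
rewrite mem_filter mem_mons; apply: (iffP andP) => [[/asboolP h /eqP]|[/eqP h1 h2]] //.
by split=> //; apply/asboolP.
Qed.

Lemma stdm_uniq I d : uniq (stdm I d).
Proof. by apply/filter_uniq/mons_uniq. Qed.

Lemma hilb_ext I A d : (forall p, initial le I p <-> initial le A p) -> hilb I d = hilb A d.
Proof.
move=> h; rewrite /hilb /stdm; congr size; apply: eq_filter => u; congr (~~ _).
by apply/asboolP/asboolP => /h.
Qed.

Lemma hilb_initial I d : is_ideal I -> hilb (initial le I) d = hilb I d.
Proof. by move=> hI; apply: hilb_ext; apply: initial_initial. Qed.

Lemma polv_homog I d (v : 'rV[k]_(hilb I d)) : is_homog d (polv v).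
Proof. by apply/is_homogP => u /polv_supp /stdmP[]. Qed.

Lemma nf_uniq I d (v : 'rV[k]_(hilb I d)) : I (polv v) -> v = 0.
Proof.
move=> hv; have [e|/lead_ex [u hl]] := eqVneq (polv v) 0.
  by rewrite -[v](polvK (stdm_uniq I d)) e; apply/rowP => i; rewrite !mxE mcoeff0.
have /stdmP[_ []] : u \in stdm I d by case: hl => /polv_supp.
by apply/initialX; exists (polv v).
Qed.

Lemma count_le_lt d u v : mdeg u = d -> mdeg v = d -> le v u -> v != u ->
  (count (le^~ v) (mons m d) < count (le^~ u) (mons m d))%N.
Proof.
move=> hu hv hvu hne.
have hin : u \in mons m d by rewrite mem_mons hu.
rewrite !(permP (perm_to_rem hin)) /= torder_refl.
have -> : le u v = false by apply/negP => h; move: hne; rewrite (torder_anti hvu h) eqxx.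
by rewrite add0n add1n ltnS; apply: sub_count => w h; apply: torder_trans hvu.
Qed.

Lemma nf_ex I d p : homog_ideal I -> is_homog d p -> exists v : 'rV[k]_(hilb I d), I (p - polv v).
Proof.
move=> hI hp; have iI := homog_is_ideal hI.
suff [r hr1 hr2] : exists2 r, (forall u, u \in msupp r -> u \in stdm I d) & I (p - r).
  by exists (vecp (stdm I d) r); rewrite vecpK // stdm_uniq.
(* Division algorithm. A fixed degree has finitely many monomials, so the induction can run on a
   bound for the ranks of those still reducible. *)
pose rk u := count (le^~ u) (mons m d).
have [n hn] : exists n, forall u, u \in msupp p -> initial le I 'X_[u] -> (rk u < n)%N.
  by exists (size (mons m d)).+1 => u _ _; rewrite ltnS count_size.
elim: n p hp hn => [|n IH] p hp hn.
  exists p; last by rewrite subrr; apply: id0.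
  move=> u hu; apply/stdmP; split; first by move/is_homogP: hp; apply.
  by move=> /(hn u hu).
have [/hasP[u hu /andP[/asboolP hiu /eqP hru]]|hno] :=
    boolP (has (fun u => asbool (initial le I 'X_[u]) && (rk u == n)) (msupp p)); last first.
  apply: IH => // u hu hiu; have := hn u hu hiu; rewrite ltnS leq_eqVlt => /orP[/eqP e|//].
  by move/hasPn: hno => /(_ u hu); rewrite -e eqxx andbT => /asboolP.
have hdu : mdeg u = d by move/is_homogP: hp; apply.
have [f [hf1 hf2] [hf3 hf4]] := initial_homog_lead hI hiu; rewrite hdu in hf2.
have fu : f@_u != 0 by rewrite -mcoeff_msupp.
pose c := p@_u / f@_u.
have hp' : is_homog d (p - c *: f) by apply: homogB => //; apply: homogZ.
have [|r hr1 hr2] := IH (p - c *: f) hp'.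
  move=> w hw hiw.
  have hdw : mdeg w = d by move/is_homogP: hp'; apply.
  have hwu : w != u.
    by apply: contraTneq hw => ->; rewrite mcoeff_msupp mcoeffB mcoeffZ /c divfK // subrr eqxx.
  have : w \in msupp p ++ msupp f.
    have := msuppB_le hw; rewrite !mem_cat => /orP[->//|/msuppZ_le ->]; exact: orbT.
  rewrite mem_cat => /orP[hwp|/hf4 hwf].
    have := hn w hwp hiw; rewrite ltnS leq_eqVlt => /orP[/eqP e|//].
    case: (torder_total w u) => h.
      by have := count_le_lt hdu hdw h hwu; rewrite -/(rk w) -/(rk u) e hru ltnn.
    by have := count_le_lt hdw hdu h; rewrite eq_sym hwu => /(_ isT); rewrite -/(rk w) -/(rk u) e hru ltnn.
  by rewrite -hru; apply: count_le_lt.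
exists r => //.
have -> : p - r = (p - c *: f - r) + c *: f by rewrite addrAC subrK.
by apply: idD => //; apply: idZ.
Qed.

Definition nf I d (p : {mpoly k[m]}) : 'rV[k]_(hilb I d) := epsilon (inhabits 0) (fun v : 'rV[k]_(hilb I d) => I (p - polv v)).

Lemma nfP I d p : homog_ideal I -> is_homog d p -> I (p - polv (nf I d p)).
Proof. by move=> hI hp; apply: (epsilon_spec (inhabits 0) (fun v : 'rV[k]_(hilb I d) => I (p - polv v))); apply: nf_ex. Qed.

(** Multiplication by z from (R/I)_d to (R/I)_(d+1) in the bases of standard monomials, acting on
    row vectors: onto becomes [row_full] and injective becomes [row_free]. *)
Definition mulM I d (z : {mpoly k[m]}) : 'M[k]_(hilb I d, hilb I d.+1) :=
  \matrix_(i, j) nf I d.+1 (z * 'X_[nth 0%MM (stdm I d) i]) ord0 j.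

Lemma mulMP I d (z : {mpoly k[m]}) (v : 'rV[k]_(hilb I d)) : homog_ideal I -> is_homog 1 z -> I (z * polv v - polv (v *m mulM I d z)).
Proof.
move=> hI hz; have iI := homog_is_ideal hI.
rewrite mulmx_polv mulr_sumr -sumrB; apply: id_sum => // i _ _.
rewrite -scalerAr -scalerBr; apply: idZ => //.
have -> : row i (mulM I d z) = nf I d.+1 (z * 'X_[nth 0%MM (stdm I d) i]).
  by apply/rowP => j; rewrite !mxE.
apply: nfP => //; rewrite -add1n; apply: homogM => //; apply: homogXd.
by have /stdmP[] : nth 0%MM (stdm I d) i \in stdm I d by apply: mem_nth.
Qed.

Lemma onto_row_full I d z : homog_ideal I -> is_homog 1 z -> mul_onto I z d.+1 -> row_full (mulM I d z).
Proof.
move=> hI hz hc; have iI := homog_is_ideal hI.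
apply/row_fullP.
have H (i : 'I_(hilb I d.+1)) : exists v : 'rV_(hilb I d), v *m mulM I d z = delta_mx ord0 i.
  have [b hb1 hb2] := onto_homog hI hz hc (polv_homog (delta_mx ord0 i : 'rV_(hilb I d.+1))).
  exists (nf I d b); apply/eqP; rewrite -subr_eq0; apply/eqP; apply: nf_uniq.
  rewrite polvD polvN.
  apply: (id_trans iI (q := z * polv (nf I d b))); first by apply: id_sym => //; apply: mulMP.
  apply: (id_trans iI (q := z * b)); last by apply: id_sym.
  by rewrite -mulrBr; apply: idMl => //; apply: id_sym => //; apply: nfP.
pose B : 'M_(hilb I d.+1, hilb I d) := \matrix_(i, j) (proj1_sig (constructive_indefinite_description _ (H i))) ord0 j.
exists B; apply/row_matrixP => i; rewrite row_mul row1.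
have -> : row i B = proj1_sig (constructive_indefinite_description _ (H i)).
  by apply/rowP => j; rewrite !mxE.
by case: constructive_indefinite_description.
Qed.

Lemma inj_row_free I d z : homog_ideal I -> is_homog 1 z -> mul_inj I z d <-> row_free (mulM I d z).
Proof.
move=> hI hz; have iI := homog_is_ideal hI.
split=> [hi|/row_free_inj hf f hf1 hf2].
  rewrite -kermx_eq0; apply/eqP/row_matrixP => i; rewrite row0; apply: (@nf_uniq I d).
  apply: hi; first exact: polv_homog.
  apply: (id_move iI (mulMP _ hI hz)).
  have /sub_kermxP -> : (row i (kermx (mulM I d z)) <= kermx (mulM I d z))%MS by apply: row_sub.
  by rewrite polv0; apply: id0.
have h1 := nfP hI hf1.
have h2 : nf I d f *m mulM I d z = 0.
  apply: nf_uniq; apply: (id_move iI (id_sym iI (mulMP _ hI hz))).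
  apply: (id_move iI _ hf2); rewrite -mulrBr; apply: idMl => //; exact: id_sym.
have h3 : nf I d f = 0 by apply: hf; rewrite h2 mul0mx.
by move: h1; rewrite h3 polv0 subr0.
Qed.

Lemma hilb_onto I d z : homog_ideal I -> is_homog 1 z -> mul_onto I z d.+1 -> (hilb I d.+1 <= hilb I d)%N.
Proof.
by move=> hI hz /(onto_row_full hI hz) /eqP <-; apply: rank_leq_row.
Qed.

Lemma hilb_onto_inj I d z : homog_ideal I -> is_homog 1 z -> mul_onto I z d.+1 -> mul_inj I z d ->
  hilb I d.+1 = hilb I d.
Proof.
move=> hI hz /(onto_row_full hI hz) /eqP <- /(inj_row_free _ hI hz) /eqP //.
Qed.

Lemma hilb_eq_inj I d z : homog_ideal I -> is_homog 1 z -> mul_onto I z d.+1 ->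
  hilb I d.+1 = hilb I d -> mul_inj I z d.
Proof.
move=> hI hz /(onto_row_full hI hz) /eqP h e; apply/(inj_row_free _ hI hz).
by apply/eqP; rewrite h e.
Qed.

Lemma mul_bij_hilb I z a : homog_ideal I -> is_homog 1 z -> mul_bij I z a ->
  forall j, (a <= j)%N -> hilb I j.+1 = hilb I j.
Proof.
move=> hI hz hc j hj; apply: (hilb_onto_inj hI hz); last exact: (mul_bij_inj hc).
exact: (mul_bij_onto hc (leqW hj)).
Qed.

Lemma hilb_mul_bij I z a : homog_ideal I -> is_homog 1 z -> mul_onto I z a ->
  (forall j, (a <= j)%N -> hilb I j.+1 = hilb I j) -> mul_bij I z a.
Proof.
move=> hI hz hc hh j hj; have iI := homog_is_ideal hI.
split; first exact: (onto_mono iI hj hc).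
apply: (hilb_eq_inj hI hz); last exact: hh.
exact: (onto_mono iI (leqW hj) hc).
Qed.

(** From degree a on the Hilbert function is nonincreasing, hence eventually constant; the induction
    is on its value, which every strict drop lowers. *)
Lemma onto_eventually_mul_bij I z a : homog_ideal I -> is_homog 1 z -> mul_onto I z a -> exists b, mul_bij I z b.
Proof.
move=> hI hz hc; have iI := homog_is_ideal hI.
have hdec j : (a <= j)%N -> (hilb I j.+1 <= hilb I j)%N.
  by move=> hj; apply: (hilb_onto hI hz); apply: (onto_mono iI (leqW hj) hc).
have [n] := ubnP (hilb I a); elim: n a hc hdec => // n IH a hc hdec hn.
case: (classic (forall j, (a <= j)%N -> hilb I j.+1 = hilb I j)) => [h|/not_all_ex_not [j hj]].
  by exists a; apply: hilb_mul_bij.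
have [haj hne] := imply_to_and _ _ hj.
have hdec' i : (hilb I (a + i) <= hilb I a)%N.
  elim: i => [|i IHi]; first by rewrite addn0.
  by rewrite addnS; apply: leq_trans IHi; apply: hdec; rewrite leq_addr.
apply: (IH j.+1).
- by apply: (onto_mono iI _ hc); rewrite leqW.
- by move=> i hi; apply: hdec; apply: leq_trans hi; rewrite leqW.
have := hdec' (j - a)%N; rewrite subnKC // => h1.
by have := hdec j haj; move/eqP: hne; lia.
Qed.

End Initial.

(** * Generic linear forms *)

Lemma frac_ex (R : idomainType) (x : {fraction R}) : exists n d : R, d != 0 /\ x * tofrac d = tofrac n.
Proof.
elim/quotW: x => r; exists (frac r).1, (frac r).2; split; first exact: denom_ratioP.
have <- : FracField.mul (\pi_({fraction R})%qT r) (tofrac (frac r).2)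
  = \pi_({fraction R})%qT r * tofrac (frac r).2 by [].
apply/eqP; rewrite !piE FracField.equivfE /FracField.mulf.
by rewrite !numden_Ratio ?mulf_neq0 ?denom_ratioP ?oner_eq0 // !mulr1 mulrC.
Qed.

Lemma clear_denominators (R : idomainType) (T : finType) (x : T -> {fraction R}) :
  exists (y : T -> R) (d : R), d != 0 /\ forall i, tofrac (y i) = x i * tofrac d.
Proof.
pose n i := proj1_sig (constructive_indefinite_description _ (frac_ex (x i))).
have hn i : exists d : R, d != 0 /\ x i * tofrac d = tofrac (n i).
  by rewrite /n; case: constructive_indefinite_description.
pose d i := proj1_sig (constructive_indefinite_description _ (hn i)).
have hd i : d i != 0 /\ x i * tofrac (d i) = tofrac (n i).
  by rewrite /d; case: constructive_indefinite_description.
exists (fun i => n i * \prod_(j | j != i) d j), (\prod_j d j); split.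
  by apply/prodf_neq0 => i _; case: (hd i).
by move=> i; rewrite [in RHS](bigD1 i) //= !rmorphM /= -(proj2 (hd i)) mulrA.
Qed.

(** * Nonvanishing of polynomials over an infinite field *)

Section Nonvanishing.
Variable k : fieldType.
Hypothesis hk : infinite_field k.

Lemma infinite_uniq n : exists s : seq k, uniq s /\ size s = n.
Proof.
elim: n => [|n [s [us ss]]]; first by exists [::].
by have [x hx] := hk s; exists (x :: s); rewrite /= hx us ss.
Qed.

Lemma poly_nonroot (p : {poly k}) : p != 0 -> exists x, p.[x] != 0.
Proof.
move=> p0; have [s [us ss]] := infinite_uniq (size p).
have : ~~ all (root p) s.
  by apply: contraTN us => h; apply/negP => us; have := max_poly_roots p0 h us; rewrite ss ltnn.
by case/allPn => x _ hx; exists x.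
Qed.

Lemma digits_inj n b (u v : 'I_n -> nat) : (forall i, u i < b)%N -> (forall i, v i < b)%N ->
  (\sum_i u i * b ^ i = \sum_i v i * b ^ i)%N -> u =1 v.
Proof.
elim: n u v => [|n IH] u v hu hv e i; first by case: i.
move: e; rewrite !big_ord_recl /= !expn0 !muln1.
have E (w : 'I_n.+1 -> nat) : (\sum_(i < n) w (lift ord0 i) * b ^ bump 0 i =
    (\sum_(i < n) w (lift ord0 i) * b ^ i) * b)%N.
  by rewrite big_distrl /=; apply: eq_bigr => j _; rewrite /bump leq0n add1n expnSr mulnA.
rewrite !E => e.
have b0 : (0 < b)%N by apply: leq_ltn_trans (hu ord0).
have e0 : u ord0 = v ord0.
  by have := congr1 (modn^~ b) e; rewrite ![(_ + _ * b)%N]addnC !modnMDl !modn_small.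
move/eqP: e; rewrite e0 eqn_add2l eqn_pmul2r // => /eqP e.
have {}IH := IH _ _ (fun i => hu (lift ord0 i)) (fun i => hv (lift ord0 i)) e.
by case: (unliftP ord0 i) => [j ->|->].
Qed.

(* Kronecker substitution x_i := t ^ (b ^ i) with b larger than all the exponents *)
Lemma mpoly_nonroot n (p : {mpoly k[n]}) : p != 0 -> exists c : 'I_n -> k, p.@[c] != 0.
Proof.
move=> p0; pose b := msize p.
pose wt (u : 'X_{1..n}) := (\sum_i u i * b ^ i)%N.
pose q : {poly k} := \sum_(u <- msupp p) p@_u *: 'X^(wt u).
have wt_inj u v : u \in msupp p -> v \in msupp p -> wt u = wt v -> u = v.
  have hb w : w \in msupp p -> forall i, (w i < b)%N.
    by move=> /msize_mdeg_lt h i; apply: leq_ltn_trans h; rewrite mdegE (bigD1 i) //= leq_addr.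
  by move=> hu hv /(digits_inj (hb _ hu) (hb _ hv)) h; apply/mnmP.
have q0 : q != 0.
  have hl := mlead_supp p0.
  apply: contraTneq hl => /polyP /(_ (wt (mlead p))); rewrite coef0 /q coef_sum.
  rewrite mcoeff_msupp negbK.
  have [hl|hl] := boolP (mlead p \in msupp p); last by rewrite (memN_msupp_eq0 hl).
  rewrite (bigD1_seq (mlead p)) ?msupp_uniq //= coefZ coefXn eqxx mulr1.
  rewrite big_seq_cond big1 ?addr0; first by move=> ->.
  move=> u /andP[hu hne]; rewrite coefZ coefXn; case: eqP => [e|_]; last by rewrite mulr0.
  by case/eqP: hne; apply: wt_inj.
have [x hx] := poly_nonroot q0.
exists (fun i => x ^+ (b ^ i)); apply: contra hx; rewrite mevalE /q horner_sum => /eqP e.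
apply/eqP; rewrite -[RHS]e; apply: eq_bigr => u _; rewrite hornerZ hornerXn; congr (_ * _).
by rewrite /wt expr_sum; apply: eq_bigr => i _; rewrite mulnC exprM.
Qed.

End Nonvanishing.

Definition lform (k : fieldType) (m : nat) (c : 'I_m -> k) : {mpoly k[m]} := \sum_i c i *: 'X_i.

Lemma lform_homog (k : fieldType) (m : nat) (c : 'I_m -> k) : is_homog 1 (lform c).
Proof.
by apply: homog_sum => i _ _; apply: homogZ; apply: homogXd; rewrite mdeg1.
Qed.

Lemma lform_coeff (k : fieldType) (m : nat) (c : 'I_m -> k) i : (lform c)@_U_(i) = c i.
Proof.
rewrite /lform raddf_sum /= (bigD1 i) //= mcoeffZ mcoeffX eqxx mulr1 big1 ?addr0 // => j hj.
by rewrite mcoeffZ mcoeffX eq_mnm1 (negbTE hj) mulr0.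
Qed.

Section Generic.
Variables (k : fieldType) (m : nat) (le : rel 'X_{1..m}) (I : {mpoly k[m]} -> Prop) (d : nat).
Hypothesis hle : term_order le.
Hypothesis hI : homog_ideal I.
Let iI : is_ideal I := homog_is_ideal hI.
Let C := {mpoly k[m]}.
Let s := mons m d.
(** The monomials by which the linear form gets multiplied; in degree 0 there are none. *)
Let t : seq 'X_{1..m} := if d is d'.+1 then mons m d' else [::].
Let hs : uniq s := mons_uniq m d.
Let sn j := nth 0%MM s j.
Let tn j := nth 0%MM t j.

(** Total in u so that it can index the rows of a matrix: outside in(I) any element of I_d is
    allowed, and 0 is available. *)
Let fu_spec u (f : {mpoly k[m]}) :=
  [/\ I f, is_homog d f & (mdeg u = d -> initial le I 'X_[u] -> is_lead le f u)].

Let fu u : {mpoly k[m]} := epsilon (inhabits 0) (fu_spec u).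

Let fuP u : fu_spec u (fu u).
Proof.
apply: (epsilon_spec (inhabits 0) (fu_spec u)).
have [e|ne] := eqVneq (mdeg u) d; last first.
  by exists 0; split; [apply: id0|apply: homog0|move=> e; rewrite e eqxx in ne].
have [hi|hi] := asboolP (initial le I 'X_[u]); last first.
  by exists 0; split; [apply: id0|apply: homog0|].
have [f [h1 h2] h3] := initial_homog_lead hI hi.
by exists f; split=> //; rewrite -e.
Qed.

(* rows: elements of I_d with the prescribed leading monomials, then the products of
   the linear form with undetermined coefficients by the monomials of degree d-1 *)
Definition genM : 'M[C]_(size s + size t, size s) :=
  col_mx (\matrix_(i, j) ((fu (sn i))@_(sn j))%:MP)
         (\matrix_(i, j) \sum_l 'X_l *+ ((U_(l) + tn i)%MM == sn j)).

Lemma genM_row (c : 'I_m -> k) r : exists b,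
  I (polv (row r (map_mx (meval c) genM)) - lform c * b).
Proof.
rewrite /genM map_col_mx; case: (split_ordP r) => i ->.
  rewrite rowKu.
  have -> : row i (map_mx (meval c) (\matrix_(i, j) ((fu (sn i))@_(sn j))%:MP)) = vecp s (fu (sn i)).
    by apply/rowP => j; rewrite !mxE mevalC.
  exists 0; rewrite mulr0 subr0; have [h1 h2 _] := fuP (sn i).
  rewrite vecpK // => u hu; rewrite mem_mons; apply/eqP.
  by move/is_homogP: h2; apply.
exists 'X_[tn i]; rewrite rowKd.
have hd : d = (mdeg (tn i)).+1.
  have H w : w \in t -> d = (mdeg w).+1.
    by rewrite /t; case: (d) => // d'; rewrite mem_mons => /eqP ->.
  by apply: H; apply: mem_nth.
have -> : row i (map_mx (meval c) (\matrix_(i, j) \sum_l 'X_l *+ ((U_(l) + tn i)%MM == sn j)))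
    = vecp s (lform c * 'X_[tn i]).
  apply/rowP => j; rewrite !mxE /lform mulr_suml !raddf_sum /=; apply: eq_bigr => l _.
  rewrite -scalerAl mcoeffZ -mpolyXD mcoeffX raddfMn /= mevalXU.
  by case: eqP => _; rewrite ?mulr1 ?mulr0.
rewrite vecpK ?subrr //; first exact: id0.
move=> u hu; rewrite mem_mons; apply/eqP; move: u hu; apply/is_homogP.
by rewrite hd -add1n; apply: homogM (lform_homog _) (homogXm _ _).
Qed.

(** Full rank over the fraction field yields a nonzero maximal minor D. Where D does not vanish, the
    specialized rows still span the forms of degree d, and [genM_row] places each of them in I +
    (lform c). *)
Lemma genM_full : row_full (map_mx (@tofrac {mpoly k[m]}) genM) ->
  exists2 D : C, D != 0 & forall c : 'I_m -> k, D.@[c] != 0 -> mul_onto I (lform c) d.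
Proof.
move=> hf; pose f := fullrankfun hf.
exists (\det (rowsub f genM)).
  have := fullrowsub_unit hf; rewrite -/f -map_mxsub unitmxE unitfE det_map_mx.
  by rewrite tofrac_eq0.
move=> c hc p hp.
have hu : rowsub f (map_mx (meval c) genM) \in unitmx.
  by rewrite unitmxE unitfE -map_mxsub det_map_mx.
pose x := vecp s p *m invmx (rowsub f (map_mx (meval c) genM)).
have -> : p = polv (x *m rowsub f (map_mx (meval c) genM)).
  rewrite /x mulmxKV // vecpK // => u hu'; rewrite mem_mons; apply/eqP; by move/is_homogP: hp; apply.
rewrite mulmx_polv.
apply: (big_ind (fun y => exists b, I (y - lform c * b))).
- by exists 0; rewrite mulr0 subr0; apply: id0.
- by move=> y y' [b hb] [b' hb']; exists (b + b'); rewrite mulrDr opprD addrACA; apply: idD.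
move=> i _; rewrite row_rowsub; have [b hb] := genM_row c (f i).
by exists (x ord0 i *: b); rewrite -scalerAr -scalerBr; apply: idZ.
Qed.

(* Rescale the entry of a kernel vector L at the monomial w by X_w; the le-smallest
   coefficients of the rescaled entries then define a functional that kills in(I)_d and the
   multiples of the form with coordinates 1. *)
Lemma genM_ker (L : 'I_(size s) -> C) :
  mul_onto (initial le I) (lform (fun=> 1)) d ->
  (forall r, \sum_j genM r j * L j = 0) -> forall j, L j = 0.
Proof.
move=> hcov hL j0; apply/eqP/negPn/negP => L0.
pose mu (j : 'I_(size s)) := 'X_[sn j] * L j.
pose E := flatten [seq msupp (mu j) | j <- enum 'I_(size s)].
have inE' j u : u \in msupp (mu j) -> u \in E.
  by move=> hu; apply/flattenP; exists (msupp (mu j)) => //; apply: map_f; rewrite mem_enum.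
have mu0 : mu j0 != 0.
  by rewrite mulf_neq0 // -msupp_eq0 msuppX.
have [e heE he] := torder_min hle (inE' _ _ (mlead_supp mu0)).
pose nu (j : 'I_(size s)) := (mu j)@_e.
have [j1 hj1] : exists j, nu j != 0.
  by move/flattenP: heE => [_ /mapP[j _ ->]]; rewrite mcoeff_msupp; exists j.
have sd (j : 'I_(size s)) : mdeg (sn j) = d by apply/eqP; rewrite -mem_mons mem_nth.
pose phi (p : {mpoly k[m]}) := \sum_(j < size s) p@_(sn j) * nu j.
have phiD p q : phi (p + q) = phi p + phi q.
  by rewrite /phi -big_split; apply: eq_bigr => j _; rewrite mcoeffD mulrDl.
have phi0 : phi 0 = 0 by rewrite /phi big1 // => j _; rewrite mcoeff0 mul0r.
have phiZ c p : phi (c *: p) = c * phi p.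
  by rewrite /phi mulr_sumr; apply: eq_bigr => j _; rewrite mcoeffZ mulrA.
(* Take the coefficient at e of X_(sn j) times the relation of row j. A term i that contributes has
   sn i + (e - sn j) >= e by minimality of e, while sn i <= sn j because sn j leads; so only i = j
   remains. *)
have hin (j : 'I_(size s)) : initial le I 'X_[sn j] -> nu j = 0.
  move=> hi; have [_ _ /(_ (sd j) hi) [l1 l2]] := fuP (sn j).
  have := hL (lshift _ j).
  under eq_bigr => j' _ do rewrite /genM col_mxEu mxE mul_mpolyC.
  move=> /(congr1 (fun p => ('X_[sn j] * p)@_e)).
  rewrite mulr0 mcoeff0 mulr_sumr raddf_sum /= (bigD1 j) //= big1 ?addr0.
    rewrite -scalerAr mcoeffZ -/(mu j) -/(nu j) => /eqP; rewrite mulf_eq0.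
    by rewrite -[_@__ == 0]negbK -mcoeff_msupp l1 => /eqP.
  move=> i hij; rewrite -scalerAr mcoeffZ.
  have [/eqP ->|hfi] := boolP ((fu (sn j))@_(sn i) == 0); first by rewrite mul0r.
  rewrite coeff_X_mul; case: ifP => [hle'|_]; last by rewrite mulr0.
  have [/eqP ->|hLi] := boolP ((L i)@_(e - sn j) == 0); first by rewrite mulr0.
  exfalso; move: hij; rewrite -val_eqE -(nth_uniq 0%MM (ltn_ord i) (ltn_ord j) hs) => /negP; apply.
  apply/eqP; apply: (@addIm _ (e - sn j)%MM); apply: (torder_anti hle).
    by apply: (torder_add hle); apply: l2; rewrite mcoeff_msupp.
  have -> : (nth 0 s j + (e - sn j) = e)%MM by rewrite addmC submK.
  by apply: he; apply: (inE' i); rewrite mcoeff_msupp coeff_X_mulD.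
(* Multiplied by X_v, the relation of the row of v becomes a sum of rescaled entries with
   coefficient 1: the undetermined coefficients have turned into those of the all-ones form. *)
have hz v : phi (lform (fun=> 1) * 'X_[v]) = 0.
  have hc w : (lform (fun=> 1 : k) * 'X_[v])@_w = \sum_l ((U_(l) + v)%MM == w)%:R.
    rewrite /lform mulr_suml raddf_sum /=; apply: eq_bigr => l _.
    by rewrite scale1r -mpolyXD mcoeffX.
  have [hv|hv] := eqVneq (mdeg v).+1 d; last first.
    rewrite /phi; apply: big1 => j _; rewrite hc big1 ?mul0r // => l _.
    case: eqP => // /(congr1 (@mdeg m)); rewrite mdegD mdeg1 sd add1n => e2.
    by rewrite e2 eqxx in hv.
  have htv : v \in t by move: hv; rewrite /t; case: (d) => // d' [<-]; rewrite mem_mons.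
  have hi : (index v t < size t)%N by rewrite index_mem.
  have := hL (rshift _ (Ordinal hi)).
  under eq_bigr => j' _ do rewrite /genM col_mxEd mxE /tn /= nth_index //.
  move=> /(congr1 (fun p => ('X_[v] * p)@_e)); rewrite mulr0 mcoeff0 => e'.
  rewrite -[RHS]e' mulr_sumr raddf_sum /=; apply: eq_bigr => j _.
  rewrite hc mulr_suml mulr_suml mulr_sumr raddf_sum /=; apply: eq_bigr => l _.
  case: eqP => [e1|_]; last by rewrite !mulr0n !mul0r mulr0 mcoeff0.
  by rewrite !mulr1n mul1r /nu /mu -e1 mulrA -mpolyXD [(v + _)%MM]addmC.
(* X_(sn j1) is a multiple of the all-ones form modulo in(I); [phi] kills both parts, although its
   value there is the nonzero [nu j1]. *)
have [b hb] := hcov _ (homogXd k (sd j1)).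
suff : nu j1 = 0 by apply/eqP.
have -> : nu j1 = phi 'X_[sn j1].
  rewrite /phi (bigD1 j1) //= mcoeffX eqxx mul1r big1 ?addr0 // => j hj.
  by rewrite mcoeffX nth_uniq // val_eqE eq_sym (negbTE hj) mul0r.
rewrite -['X_[sn j1]](subrK (lform (fun=> 1) * b)) phiD.
have -> : phi (lform (fun=> 1) * b) = 0.
  rewrite {1}(mpolyE b) mulr_sumr (big_morph phi phiD phi0) big1 // => v _.
  by rewrite -scalerAr phiZ hz mulr0.
rewrite addr0 /phi; apply: big1 => j _.
have [/eqP ->|h] := boolP (('X_[sn j1] - lform (fun=> 1) * b)@_(sn j) == 0); first by rewrite mul0r.
rewrite hin ?mulr0 //; apply/initialX; apply: hb; by rewrite mcoeff_msupp.
Qed.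

Lemma onto_generic : mul_onto (initial le I) (lform (fun=> 1)) d ->
  exists2 D : C, D != 0 & forall c : 'I_m -> k, D.@[c] != 0 -> mul_onto I (lform c) d.
Proof.
move=> hcov; apply: genM_full.
rewrite -cokermx_eq0; apply/eqP/matrixP => i0 j0; rewrite [RHS]mxE.
(* A column of the cokernel, cleared of denominators, is a kernel vector over the polynomial ring,
   to which [genM_ker] applies. *)
have [L [D [D0 hL]]] := clear_denominators (fun i => cokermx (map_mx (@tofrac {mpoly k[m]}) genM) i j0).
suff L0 : L i0 = 0.
  have := hL i0; rewrite L0 tofrac0 => /esym/eqP; rewrite mulf_eq0 tofrac_eq0 (negbTE D0) orbF.
  by move/eqP.
apply: genM_ker => // r; apply/eqP; rewrite -tofrac_eq0 rmorph_sum /=; apply/eqP.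
have /matrixP /(_ r j0) := mulmx_coker (map_mx (@tofrac {mpoly k[m]}) genM).
rewrite mxE [RHS]mxE => e.
transitivity (\sum_i map_mx (@tofrac {mpoly k[m]}) genM r i * cokermx (map_mx (@tofrac {mpoly k[m]}) genM) i j0 * tofrac D);
  last by rewrite -mulr_suml e mul0r.
by apply: eq_bigr => i _; rewrite rmorphM /= hL mulrA [in RHS]mxE.
Qed.

End Generic.

(** * Hilbert's basis theorem *)

Section Dickson.

(** Take a minimum of f on one tail after another. *)
Lemma mono_subseq (f : nat -> nat) : exists phi : nat -> nat,
  (forall i, (phi i < phi i.+1)%N) /\ forall i, (f (phi i) <= f (phi i.+1))%N.
Proof.
have hmin N : exists i, (N <= i)%N /\ forall j, (N <= j)%N -> (f i <= f j)%N.
  have hex : exists v, asbool (exists2 i, (N <= i)%N & f i = v) by exists (f N); apply/asboolP; exists N.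
  case: (ex_minnP hex) => v /asboolP [i hi <-] hv; exists i; split=> // j hj.
  by apply: hv; apply/asboolP; exists j.
pose g N := proj1_sig (constructive_indefinite_description _ (hmin N)).
have hg N : (N <= g N)%N /\ forall j, (N <= j)%N -> (f (g N) <= f j)%N.
  by rewrite /g; case: constructive_indefinite_description.
pose phi := fix phi n := if n is n'.+1 then g (phi n').+1 else g 0%N.
have hphi i : exists N, phi i = g N by case: i => [|i]; [exists 0%N|exists (phi i).+1].
exists phi; split=> i; first by case: (hg (phi i).+1).
have [N e] := hphi i; rewrite {1}e; apply: (proj2 (hg N)).
have [h1 _] := hg N; have [h2 _] := hg (phi i).+1.
by apply: leq_trans h1 _; rewrite -e; apply: leq_trans h2; apply: leqnSn.
Qed.

Lemma mono_subseq_lt (phi : nat -> nat) : (forall i, (phi i < phi i.+1)%N) -> forall i j, (i < j)%N -> (phi i < phi j)%N.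
Proof. by move=> h i j; apply: (homo_ltn ltn_trans h). Qed.

Lemma mono_subseq_le (f : nat -> nat) : (forall i, (f i <= f i.+1)%N) -> forall i j, (i <= j)%N -> (f i <= f j)%N.
Proof. by move=> h i j; apply: (homo_leq leqnn leq_trans h). Qed.

Lemma dickson_seq n (u : nat -> 'X_{1..n}) (s : seq 'I_n) : exists phi : nat -> nat,
  (forall i, (phi i < phi i.+1)%N) /\ forall l, l \in s -> forall i, (u (phi i) l <= u (phi i.+1) l)%N.
Proof.
elim: s => [|l s [phi [h1 h2]]]; first by exists id.
have [psi [h3 h4]] := mono_subseq (fun i => u (phi i) l).
exists (phi \o psi); split=> [i|l' hl' i] /=; first exact: mono_subseq_lt.
move: hl'; rewrite inE => /orP[/eqP ->|hl']; first exact: h4.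
by apply: (mono_subseq_le (h2 l' hl')); apply: ltnW.
Qed.

(** Otherwise elements of P divisible by no earlier one could be chosen endlessly, against the
    nondecreasing subsequence of [dickson_seq]. *)
Lemma dickson n (P : 'X_{1..n} -> Prop) : exists F : seq 'X_{1..n},
  (forall u, u \in F -> P u) /\ forall v, P v -> exists2 u, u \in F & (u <= v)%MM.
Proof.
apply: NNPP => hno.
have step (F : seq 'X_{1..n}) : exists v, (forall u, u \in F -> P u) -> P v /\ forall u, u \in F -> ~~ (u <= v)%MM.
  case: (classic (forall u, u \in F -> P u)) => [hF|hF]; last by exists 0%MM.
  apply: NNPP => hv; apply: hno; exists F; split=> // v Pv.
  apply: NNPP => hu; apply: hv; exists v => _; split=> // u uF.
  by apply/negP => huv; apply: hu; exists u.
pose v (F : seq 'X_{1..n}) := proj1_sig (constructive_indefinite_description _ (step F)).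
have hv (F : seq 'X_{1..n}) : (forall u, u \in F -> P u) -> P (v F) /\ forall u, u \in F -> ~~ (u <= v F)%MM.
  by rewrite /v; case: constructive_indefinite_description.
pose L := fix L i := if i is i'.+1 then v (L i') :: L i' else [::].
have hL i : forall u, u \in L i -> P u.
  by elim: i => [|i IH] u //=; rewrite inE => /orP[/eqP ->|/IH //]; case: (hv _ IH).
have hin i j : (i < j)%N -> v (L i) \in L j.
  elim: j => // j IH; rewrite ltnS leq_eqVlt => /orP[/eqP ->|/IH h]; first exact: mem_head.
  by rewrite inE h orbT.
have [phi [h1 h2]] := dickson_seq (fun i => v (L i)) (enum 'I_n).
have [_ /(_ _ (hin _ _ (h1 0%N))) /negP[]] := hv _ (hL (phi 1%N)).
by apply/mnm_lepP => l; apply: h2; rewrite mem_enum.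
Qed.

End Dickson.

(* Hilbert's basis theorem; the weights keep track of the degrees of the cofactors. *)
Lemma graded_basis (k : fieldType) (n : nat) (W : eqType) (wt : 'X_{1..n} -> W) (H : W -> {mpoly k[n]} -> Prop) :
  (forall w F u, H w F -> u \in msupp F -> wt u = w) ->
  (forall w w' F G v c, H w F -> H w' G -> F != 0 -> G != 0 -> mlead F = (v + mlead G)%MM ->
     H w (F - c *: ('X_[v] * G))) ->
  exists Fs : seq (W * {mpoly k[n]}), (forall x, x \in Fs -> H x.1 x.2 /\ x.2 != 0) /\
    forall w F, H w F -> exists s : seq (k * 'X_{1..n} * (W * {mpoly k[n]})),
      (forall x, x \in s -> x.2 \in Fs /\ wt (x.1.2 + mlead x.2.2)%MM = w) /\
      F = \sum_(x <- s) x.1.1 *: ('X_[x.1.2] * x.2.2).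
Proof.
move=> hwt hdiv.
pose P u := exists x : W * {mpoly k[n]}, (H x.1 x.2 /\ x.2 != 0) /\ mlead x.2 = u.
have [Us [hU1 hU2]] := dickson P.
have hex u : exists x : W * {mpoly k[n]}, u \in Us -> (H x.1 x.2 /\ x.2 != 0) /\ mlead x.2 = u.
  case: (boolP (u \in Us)) => [/hU1 [x hx]|_]; first by exists x.
  by exists (wt u, 0).
pose b u := proj1_sig (constructive_indefinite_description _ (hex u)).
have hb u : u \in Us -> (H (b u).1 (b u).2 /\ (b u).2 != 0) /\ mlead (b u).2 = u.
  by rewrite /b; case: constructive_indefinite_description.
exists [seq b u | u <- Us]; split; first by move=> _ /mapP[u /hb [hu _] ->].
move=> w F; have [l] : exists l, mlead F = l by exists (mlead F).
elim/(well_founded_ind (@ltom_wf n)): l F => l IH F el hF.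
have [F0|F0] := eqVneq F 0; first by exists [::]; rewrite big_nil.
have [u uU hu] : exists2 u, u \in Us & (u <= mlead F)%MM by apply: hU2; exists (w, F).
have [[hG G0] hl] := hb u uU; set G := (b u).2 in hG G0 hl.
pose v := (mlead F - u)%MM; have ev : mlead F = (v + mlead G)%MM by rewrite hl submK.
pose c := mleadc F / mleadc G.
have hF' := hdiv _ _ _ _ v c hF hG F0 G0 ev.
have hG' : G@_(mlead G) != 0 by rewrite mleadc_eq0.
set F' := F - _ in hF'.
have [s [hs1 hs2]] : exists s : seq (k * 'X_{1..n} * (W * {mpoly k[n]})),
      (forall x, x \in s -> x.2 \in [seq b u | u <- Us] /\ wt (x.1.2 + mlead x.2.2)%MM = w) /\
      F' = \sum_(x <- s) x.1.1 *: ('X_[x.1.2] * x.2.2).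
  have [->|F'0] := eqVneq F' 0; first by exists [::]; rewrite big_nil.
  apply: (IH (mlead F')) => //; have hin := mlead_supp F'0.
  rewrite -el Order.POrderTheory.lt_neqAle; apply/andP; split.
    apply: contraTneq hin => ->; rewrite mcoeff_msupp /F' mcoeffB mcoeffZ {2}ev coeff_X_mulD.
    by rewrite divfK // subrr eqxx.
  have := msuppB_le hin; rewrite mem_cat => /orP[/msupp_le_mlead //|/msuppZ_le /mem_msuppXM [h1 /msupp_le_mlead h2]].
  by rewrite ev -(submK h1) addmC lemc_add2r.
exists ((c, v, b u) :: s); split; last by rewrite big_cons -hs2 /F' addrC subrK.
move=> x; rewrite inE => /orP[/eqP -> /=|/hs1 //]; split; first exact: map_f.
by rewrite -ev; apply: hwt hF _; apply: mlead_supp.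
Qed.

(** * Powers of an ideal *)

Lemma mul_bij_pow (k : fieldType) (m : nat) (I : {mpoly k[m]} -> Prop) z al n : homog_ideal I -> is_homog 1 z ->
  mul_bij I z al -> mul_bij (ideal_pow I n) z (n * al).
Proof.
move=> hI hz hc; elim: n => [|n IH].
  by move=> j _; split=> [p _|f _ _]; [exists 0|]; apply: ideal_pow0.
have h1 : mul_bij (ideal_pow I 1) z al.
  have e := fun p => ideal_pow1 p (homog_is_ideal hI).
  by move=> j /hc [h1 h2]; split=> [p /h1 [b /e hb]|f hf /e hzf]; [exists b|apply/e; apply: h2].
rewrite mulSn addnC -addn1; apply: (mul_bij_prod (A := ideal_pow I n) (B := ideal_pow I 1)) => //.
- exact: ideal_pow_homog.
- exact: ideal_pow_homog.
- exact: ideal_pow_homog.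
- by move=> x y; apply: ideal_powM.
- move=> q p hp hq; rewrite -(hcomp_id hq); apply: ideal_powD_span => //; exact: ideal_pow_homog.
Qed.

(** * Linear bounds for powers through the Rees algebra *)

Section Asymptotic.
Variables (k : fieldType) (m s : nat) (I : {mpoly k[m]} -> Prop) (g : 'I_s -> {mpoly k[m]})
  (dg : 'I_s -> nat) (d : nat) (z : {mpoly k[m]}) (al : nat).
Hypothesis hI : homog_ideal I.
Hypothesis hg : forall b, is_homog (dg b) (g b).
Hypothesis hdg : forall b, (dg b <= d)%N.
Hypothesis gI : forall b, I (g b).
Hypothesis Ig : forall p, I p -> exists r : 'I_s -> {mpoly k[m]}, p = \sum_b r b * g b.
Hypothesis hz : is_homog 1 z.
Hypothesis hcm : mul_bij I z al.
Let iI : is_ideal I := homog_is_ideal hI.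
Let iP n : is_ideal (ideal_pow I n) := @ideal_pow_is_ideal k m I n.

Lemma gens_homog D p : I p -> is_homog D p -> exists r : 'I_s -> {mpoly k[m]},
  (forall b, is_homog (D - dg b) (r b) /\ ((D < dg b)%N -> r b = 0)) /\ p = \sum_b r b * g b.
Proof.
move=> /Ig [r ->] hD; exists (fun b => if (dg b <= D)%N then hcomp (D - dg b) (r b) else 0); split.
  move=> b; case: leqP => h; split=> //; try exact: homog_hcomp.
  exact: homog0.
rewrite -[LHS](hcomp_id hD) hcomp_sum; apply: eq_bigr => b _.
rewrite mulrC; case: leqP => h; last by rewrite mul0r (hcompM_low _ (hg b)).
by rewrite -{1}(subnKC h) hcompM_homog // mulrC.
Qed.

(** A form of degree j is zb + sum r_i g_i. Each generator uses up degree at most d, so the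
    induction hypothesis applies to the r_i and its relation is multiplied by g_i. *)
Lemma onto_pow_linear n j : (n * d + al <= j)%N -> mul_onto (ideal_pow I n) z j.
Proof.
elim: n j => [|n IH] j hj p hp; first by exists 0; apply: ideal_pow0.
have haj : (al <= j)%N by apply: leq_trans hj; apply: leq_addl.
have [b hb hIb] : exists2 b, is_homog j (z * b) & I (p - z * b).
  case: (j) haj hp => [|j'] haj hp.
    by exists 0; rewrite mulr0 ?subr0; [apply: homog0|apply: (onto_deg0 hI hz (mul_bij_onto hcm haj) hp)].
  have [b hb1 hb2] := onto_homog hI hz (mul_bij_onto hcm haj) hp.
  by exists b => //; rewrite -add1n; apply: homogM.
have [r [hr e]] := gens_homog hIb (homogB hp hb).
suff [c hc] : exists c, ideal_pow I n.+1 ((p - z * b) - z * c).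
  by exists (b + c); rewrite mulrDr opprD addrA.
rewrite e; apply: (big_ind (fun y => exists c, ideal_pow I n.+1 (y - z * c))).
- by exists 0; rewrite mulr0 subr0; apply: id0.
- by move=> y y' [c hc] [c' hc']; exists (c + c'); rewrite mulrDr opprD addrACA; apply: idD.
move=> i _; have [hr1 hr2] := hr i.
have [hlt|hle] := ltnP j (dg i).
  by exists 0; rewrite hr2 // mul0r mulr0 subr0; apply: id0.
have [|c hc] := IH (j - dg i)%N _ _ hr1; first by have := hdg i; move: hj; rewrite mulSn; lia.
exists (c * g i); rewrite mulrA -mulrBl -addn1; apply: ideal_powM => //.
by apply/ideal_pow1.
Qed.

(* presentation of the Rees algebra of I as a quotient of a bigraded polynomial ring *)
Let n' := (m + s)%N.
Let h (i : 'I_n') : {mpoly k[m]} := match split i with inl a => 'X_a | inr b => g b end.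
Let phi : {mpoly k[n']} -> {mpoly k[m]} := mmap (@mpolyC m k) h.
(** Bigrading: [wN] is a power of I containing the image of the monomial under [phi], and [wD] is
    the degree of that image. *)
Let wN (u : 'X_{1..n'}) : nat := \sum_(b < s) u (rshift m b).
Let wX (u : 'X_{1..n'}) : nat := \sum_(a < m) u (lshift s a).
Let wD (u : 'X_{1..n'}) : nat := (wX u + \sum_(b < s) u (rshift m b) * dg b)%N.
Let wt u := (wN u, wD u).

Let wND u v : wN (u + v)%MM = (wN u + wN v)%N.
Proof. by rewrite /wN -big_split; apply: eq_bigr => b _; rewrite mnmDE. Qed.
Let wDD u v : wD (u + v)%MM = (wD u + wD v)%N.
Proof.
rewrite /wD /wX.
under eq_bigr => b _ do rewrite mnmDE.
under [X in (_ + X)%N]eq_bigr => b _ do rewrite mnmDE mulnDl.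
by rewrite !big_split /=; lia.
Qed.

Let phiD p q : phi (p + q) = phi p + phi q. Proof. exact: mmapD. Qed.
Let phi0 : phi 0 = 0. Proof. exact: mmap0. Qed.
Let phiM p q : phi (p * q) = phi p * phi q.
Proof. exact: (rmorphM (mmap (@mpolyC m k) h)). Qed.
Let phiZ c p : phi (c *: p) = c *: phi p.
Proof. by rewrite /phi mmapZ mul_mpolyC. Qed.
Let phi_sum (T : Type) (r : seq T) (F : T -> {mpoly k[n']}) :
  phi (\sum_(x <- r) F x) = \sum_(x <- r) phi (F x).
Proof. exact: (big_morph phi phiD phi0). Qed.

Let xp (u : 'X_{1..n'}) : 'X_{1..m} := [multinom u (lshift s a) | a < m].
Let gp (u : 'X_{1..n'}) : {mpoly k[m]} := \prod_(b < s) g b ^+ u (rshift m b).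

Let phiX u : phi 'X_[u] = 'X_[xp u] * gp u.
Proof.
rewrite /phi mmapX /mmap1 big_split_ord /=; congr (_ * _).
  rewrite mpolyXE_id; apply: eq_bigr => a _; rewrite mnmE /h.
  by case: (split_ordP (lshift s a)) => [j /lshift_inj ->|j /eqP]; rewrite ?eq_lrshift.
apply: eq_bigr => b _; rewrite /h.
by case: (split_ordP (rshift m b)) => [j /eqP|j /rshift_inj ->]; rewrite ?eq_rlshift.
Qed.

Let xp_deg u : mdeg (xp u) = wX u.
Proof. by rewrite mdegE; apply: eq_bigr => a _; rewrite mnmE. Qed.

Let gp_pow u : ideal_pow I (wN u) (gp u).
Proof.
rewrite /wN /gp; elim/big_ind2: _ => [|n1 p1 n2 p2|b _]; first exact: ideal_pow0.
  exact: ideal_powM.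
elim: (u _) => [|e IH]; first exact: ideal_pow0.
by rewrite exprS -add1n; apply: ideal_powM => //; apply/ideal_pow1.
Qed.

Let gp_homog (u : 'X_{1..n'}) : is_homog (\sum_(b < s) u (rshift m b) * dg b) (gp u).
Proof.
rewrite /gp; elim/big_ind2: _ => [|n1 p1 n2 p2|b _]; first by rewrite is_homogE dhomog1.
  exact: homogM.
elim: (u _) => [|e IH]; first by rewrite is_homogE dhomog1.
by rewrite exprS mulSn; apply: homogM.
Qed.

Definition rees_homog (w : nat * nat) (F : {mpoly k[n']}) := forall u, u \in msupp F -> wt u = w.

Lemma rees_image w F : rees_homog w F -> ideal_pow I w.1 (phi F) /\ is_homog w.2 (phi F).
Proof.
move=> hF; rewrite {1 2}(mpolyE F) phi_sum; split.
  apply: id_sum => // u /hF <- _; rewrite phiZ; apply: idZ => //.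
  by rewrite phiX; apply: idMl => //; apply: gp_pow.
apply: homog_sum => u /hF <- _; rewrite phiZ; apply: homogZ; rewrite phiX /= /wD -xp_deg.
by apply: homogM; [apply: homogXm|apply: gp_homog].
Qed.

Lemma rees_rep n D p : ideal_pow I n p -> is_homog D p -> exists2 F, rees_homog (n, D) F & phi F = p.
Proof.
have sumR w (T : eqType) (r : seq T) (F : T -> {mpoly k[m]}) :
    (forall x, x \in r -> exists2 G, rees_homog w G & phi G = F x) ->
    exists2 G, rees_homog w G & phi G = \sum_(x <- r) F x.
  move=> H; rewrite big_seq.
  apply: (big_ind (fun y => exists2 G, rees_homog w G & phi G = y)) => [|y y' [G hG <-] [G' hG' <-]|x /H //].
    by exists 0 => // u; rewrite -mpolyC0 msupp0.
  by exists (G + G') => // u /msuppD_le; rewrite mem_cat => /orP[/hG|/hG'].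
have mulR w w' y y' : (exists2 G, rees_homog w G & phi G = y) -> (exists2 G, rees_homog w' G & phi G = y') ->
    exists2 G, rees_homog (w.1 + w'.1, w.2 + w'.2)%N G & phi G = y * y'.
  move=> [G hG <-] [G' hG' <-]; exists (G * G'); last exact: phiM.
  move=> u /msuppM_le /allpairsP [[v v'] /= [/hG hv /hG' hv' ->]].
  by rewrite /wt wND wDD -hv -hv'.
have baseX w : exists2 G, rees_homog (0%N, mdeg w) G & phi G = 'X_[w].
  pose u : 'X_{1..n'} := [multinom (match split i with inl a => w a | inr b => 0%N end) | i < n'].
  have ul a : u (lshift s a) = w a.
    rewrite mnmE; by case: (split_ordP (lshift s a)) => [j /lshift_inj ->|j /eqP]; rewrite ?eq_lrshift.
  have ur b : u (rshift m b) = 0%N.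
    by rewrite mnmE; case: (split_ordP (rshift m b)) => [j /eqP|j _]; rewrite ?eq_rlshift.
  exists 'X_[u].
    move=> u'; rewrite msuppX inE => /eqP ->; rewrite /wt /wN /wD /wX.
    congr (_, _); first by rewrite big1 // => b _; rewrite ur.
    rewrite [X in (_ + X)%N]big1 => [|b _]; last by rewrite ur.
    by rewrite addn0 mdegE; apply: eq_bigr => a _; rewrite ul.
  rewrite phiX; have -> : xp u = w by apply/mnmP => a; rewrite mnmE ul.
  by rewrite /gp big1 ?mulr1 // => b _; rewrite ur.
have baseR D' q : is_homog D' q -> exists2 G, rees_homog (0%N, D') G & phi G = q.
  move/is_homogP=> hq; rewrite (mpolyE q); apply: (sumR) => u /hq <-.
  have [G hG eG] := baseX u; exists (q@_u *: G); last by rewrite phiZ eG.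
  by move=> v /msuppZ_le /hG.
have baseg b : exists2 G, rees_homog (1%N, dg b) G & phi G = g b.
  pose u : 'X_{1..n'} := U_(rshift m b)%MM.
  have ul a : u (lshift s a) = 0%N by rewrite mnm1E eq_rlshift.
  have ur b' : u (rshift m b') = (b == b') by rewrite mnm1E eq_rshift.
  exists 'X_[u]; last first.
    rewrite /phi mmapX mmap1U /h.
    by case: (split_ordP (rshift m b)) => [j /eqP|j /rshift_inj ->]; rewrite ?eq_rlshift.
  move=> u'; rewrite msuppX inE => /eqP ->; rewrite /wt /wN /wD /wX.
  congr (_, _).
    by rewrite (bigD1 b) //= ur eqxx big1 // => b' hb'; rewrite ur eq_sym (negbTE hb').
  rewrite big1 => [|a _]; last by rewrite ul.
  rewrite add0n (bigD1 b) //= ur eqxx mul1n big1 ?addn0 // => b' hb'.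
  by rewrite ur eq_sym (negbTE hb').
elim: n D p => [|n IH] D p hp hD; first exact: baseR.
rewrite -(hcomp_id hD); rewrite -addn1 in hp.
have h1 := ideal_pow_homog 1 hI; have hn := ideal_pow_homog n hI.
have [t [ht ->]] := ideal_powD_span D hI hn h1 hp.
apply: (sumR) => x /ht [hx1 hx2 hx3 /(ideal_pow1 _ iI) hx4 hx5].
have H : exists2 G, rees_homog (1%N, (D - x.1)%N) G & phi G = x.2.2.
  have [r [hr ->]] := gens_homog hx4 hx5; apply: (sumR) => b _.
  have [hr1 hr2] := hr b.
  have [hlt|hle] := ltnP (D - x.1) (dg b).
    by exists 0; [move=> u; rewrite -mpolyC0 msupp0|rewrite phi0 hr2 // mul0r].
  by have := mulR _ _ _ _ (baseR _ _ hr1) (baseg b); rewrite /= add0n subnK.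
by have := mulR _ _ _ _ (IH _ _ hx2 hx3) H; rewrite /= addn1 subnKC.
Qed.

(** The F with [phi F] in zR form a finitely generated bigraded ideal. For a generator with image z
    a in I^n0, multiplication by monomials of high degree brings a into I^n0; finitely many
    generators need a single e. An element zf of I^n, lifted to this ideal, then gets a cofactor in
    I^n. *)
Lemma inj_pow_linear : exists e, forall n j, (n * d + e <= j)%N -> mul_inj (ideal_pow I n) z j.
Proof.
pose H (w : nat * nat) (F : {mpoly k[n']}) := rees_homog w F /\ exists a, phi F = z * a.
have [||Fs [hF1 hF2]] := @graded_basis k n' _ wt H.
- by move=> w F u [hF _]; apply: hF.
- move=> w w' F G v c [hF [a ha]] [hG [b hb]] F0 G0 el; split; last first.
    exists (a - c *: (phi 'X_[v] * b)).
    rewrite -scaleN1r phiD !phiZ phiM ha hb mulrBr scaleN1r -scalerAr; congr (_ - _ *: _); ring.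
  have hw : wt (v + mlead G)%MM = w by rewrite -el; apply: hF; apply: mlead_supp.
  have hw' : wt (mlead G) = w' by apply: hG; apply: mlead_supp.
  move=> u /msuppB_le; rewrite mem_cat => /orP[/hF //|/msuppZ_le /mem_msuppXM [hvu /hG hu]].
  rewrite -(submK hvu) -hw; move: hw' hu => <-; rewrite /wt => -[e1 e2].
  by rewrite !wND !wDD e1 e2; congr (_, _); apply: addnC.
have hp (x : (nat * nat) * {mpoly k[n']}) : exists (a : {mpoly k[m]}) (p : nat), x \in Fs -> phi x.2 = z * a /\
    forall u, (p <= mdeg u)%N -> ideal_pow I x.1.1 ('X_[u] * a).
  case: (boolP (x \in Fs)) => [/hF1 [[hx [a ha]] _]|_]; last by exists 0, 0%N.
  have [hi hh] := rees_image hx.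
  case e: x.1.2 hh => [|D] hh.
    exists 0, 0%N => _; split; last by move=> u _; rewrite mulr0; apply: id0.
    by rewrite mulr0 -(hcomp_id hh) ha (hcompM_low _ hz).
  (* z X_u a lies in the power x.1.1 of I, on whose quotient z is injective from degree x.1.1 al on;
     this is the bound for the degree of u. *)
  exists (hcomp D a), (x.1.1 * al)%N => _; split.
    by rewrite -(hcompM_homog _ _ hz) add1n -ha hcomp_id.
  move=> u hu; have hc := @mul_bij_pow _ _ _ _ _ x.1.1 hI hz hcm.
  apply: (mul_bij_inj hc (j := mdeg u + D)); first by apply: leq_trans hu _; apply: leq_addr.
    by apply: homogM; [apply: homogXm|apply: homog_hcomp].
  rewrite mulrCA; apply: idMl => //.
  by rewrite -(hcompM_homog _ _ hz) add1n -ha hcomp_id.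
pose a x := proj1_sig (constructive_indefinite_description _ (hp x)).
have hp1 x : exists p : nat, x \in Fs -> phi x.2 = z * a x /\
    forall u, (p <= mdeg u)%N -> ideal_pow I x.1.1 ('X_[u] * a x).
  by rewrite /a; case: constructive_indefinite_description.
pose p x := proj1_sig (constructive_indefinite_description _ (hp1 x)).
have hp2 x : x \in Fs -> phi x.2 = z * a x /\
    forall u, (p x <= mdeg u)%N -> ideal_pow I x.1.1 ('X_[u] * a x).
  by rewrite /p; case: constructive_indefinite_description.
(* A sum in place of a maximum: [p x] is the monomial degree that generator x requires and [x.1.2]
   its own degree; [al] serves the case z = 0. *)
pose e := (al + \sum_(x <- Fs) (p x + x.1.2))%N.
exists e => n j hj f hf hzf.
have hee x : x \in Fs -> (p x + x.1.2 <= e)%N.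
  by move=> hx; rewrite /e (big_rem x) //=; lia.
have [z0|z0] := eqVneq z 0.
  have [|b] := @onto_pow_linear n j _ f hf; first by apply: leq_trans hj; rewrite leq_add2l /e leq_addr.
  by rewrite z0 mul0r subr0.
have hh : is_homog j.+1 (z * f) by rewrite -add1n; apply: homogM.
have [F hF eF] := rees_rep hzf hh.
have hH : H (n, j.+1) F by split=> //; exists f.
have [t [ht1 ht2]] := hF2 _ _ hH.
suff [q hq] : exists2 q, ideal_pow I n q & phi F = z * q by rewrite eF => /(mulfI z0) ->.
rewrite ht2 phi_sum big_seq.
apply: (big_ind (fun y => exists2 q, ideal_pow I n q & y = z * q)).
- by exists 0; rewrite ?mulr0 //; apply: id0.
- by move=> y y' [q1 h1 ->] [q2 h2 ->]; exists (q1 + q2); rewrite ?mulrDr //; apply: idD.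
move=> x /ht1 [hx hw]; have [hx1 hx2] := hp2 _ hx; have [[hx3 _] hx4] := hF1 _ hx.
have hwl : wt (mlead x.2.2) = x.2.1 by apply: hx3; apply: mlead_supp.
set v := x.1.2 in hw *.
have [eN eD] : (wN v + x.2.1.1 = n /\ wD v + x.2.1.2 = j.+1)%N.
  by move: hw; rewrite -hwl /wt wND wDD /= => -[].
exists (x.1.1 *: ('X_[xp v] * a x.2 * gp v)); last first.
  by rewrite phiZ phiM phiX hx1 -scalerAr; congr (_ *: _); ring.
apply: idZ => //; rewrite -eN addnC; apply: ideal_powM; last exact: gp_pow.
apply: hx2; rewrite xp_deg.
(* The generator variables of v account for degree at most d each, so the choice of e leaves at
   least [p x.2] to its x-part. *)
have hdv : (\sum_(b < s) v (rshift m b) * dg b <= wN v * d)%N.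
  by rewrite /wN big_distrl /=; apply: leq_sum => b _; rewrite leq_mul2l hdg orbT.
have := hee _ hx; move: eD hj; rewrite /wD -eN mulnDl; lia.
Qed.

Lemma mul_bij_pow_linear : exists e, forall n, mul_bij (ideal_pow I n) z (n * d + e).
Proof.
have [e he] := inj_pow_linear; exists (al + e)%N => n j hj; split.
  by apply: onto_pow_linear; lia.
by apply: he; lia.
Qed.

End Asymptotic.

(** * Krull dimension *)

Section Adjoin.
Variables (k : fieldType) (m : nat).
Implicit Types (A P M : {mpoly k[m]} -> Prop) (f g : {mpoly k[m]}).

Definition adjoin A g f := exists x r, A x /\ f = x + r * g.

Lemma adjoin_sub A g f : A f -> adjoin A g f.
Proof. by move=> hf; exists f, 0; rewrite mul0r addr0. Qed.

Lemma adjoin_mem A g : is_ideal A -> adjoin A g g.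
Proof. by move=> hA; exists 0, 1; rewrite mul1r add0r; split=> //; apply: id0. Qed.

Lemma adjoin_homog A g d : homog_ideal A -> is_homog d g -> homog_ideal (adjoin A g).
Proof.
move=> [hA hh] hg; split; first split.
- exact: adjoin_sub (id0 hA).
- split=> [_ _ [x [r [hx ->]]] [y [s [hy ->]]]|a _ [x [r [hx ->]]]].
    by exists (x + y), (r + s); rewrite mulrDl addrACA; split=> //; apply: idD.
  by exists (a * x), (a * r); rewrite mulrDr mulrA; split=> //; apply: idMl.
move=> _ e [x [r [hx ->]]]; rewrite hcompD mulrC.
have [hde|hde] := leqP d e; last first.
  by rewrite (hcompM_low _ hg hde) addr0; apply: adjoin_sub; apply: hh.
by rewrite -(subnKC hde) hcompM_homog // mulrC subnKC //; exists (hcomp e x), (hcomp (e - d) r); split=> //; apply: hh.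
Qed.

Definition avoids A M := forall f, A f -> ~ M f.

(** Without a maximal ideal there would be a strictly increasing chain; by [graded_basis] its union
    has a finite basis, which already lies in one member of the chain. *)
Lemma max_avoiding A M : homog_ideal A -> avoids A M -> exists P,
  [/\ homog_ideal P, avoids P M, (forall f, A f -> P f)
    & forall P', homog_ideal P' -> avoids P' M -> (forall f, P f -> P' f) -> forall f, P' f -> P f].
Proof.
move=> hA hAM; apply: NNPP => hno.
pose good P := homog_ideal P /\ avoids P M /\ (forall f, A f -> P f).
have step P : exists P', good P -> good P' /\ (forall f, P f -> P' f) /\ exists f, P' f /\ ~ P f.
  case: (classic (good P)) => [[h1 [h2 h3]]|h]; last by exists P.
  apply: NNPP => hn; apply: hno; exists P; split=> // P' h1' h2' h3' f hf.
  apply: NNPP => hPf; apply: hn; exists P' => _; split; last by split=> //; exists f.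
  by split=> //; split=> // g /h3 /h3'.
pose nxt P := proj1_sig (constructive_indefinite_description _ (step P)).
have hn P : good P -> good (nxt P) /\ (forall f, P f -> nxt P f) /\ exists f, nxt P f /\ ~ P f.
  by rewrite /nxt; case: constructive_indefinite_description.
pose S i := iter i nxt A.
have hS i : good (S i).
  by elim: i => [|i IH]; [split|case: (hn _ IH)].
have hmono i j : (i <= j)%N -> forall f, S i f -> S j f.
  elim: j => [|j IH]; first by rewrite leqn0 => /eqP ->.
  rewrite leq_eqVlt => /orP[/eqP -> //|/IH h f /h hf].
  by case: (hn _ (hS j)) => _ [+ _]; apply.
pose U f := exists i, S i f.
have hU : is_ideal U.
  have hi i : is_ideal (S i) by case: (hS i) => [[]].
  split; first by exists 0%N; apply: id0; case: hA.
  split=> [f g [i hf] [j hg]|a f [i hf]].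
    exists (maxn i j); apply: (idD (hi _)).
      by apply: (hmono i) => //; apply: leq_maxl.
    by apply: (hmono j) => //; apply: leq_maxr.
  by exists i; apply: (idMl (hi i)).
have [||Fs [hF1 hF2]] := @graded_basis k m unit (fun=> tt) (fun _ f => U f).
- by move=> [].
- by move=> _ _ F G v c hF hG _ _ _; apply: idB => //; apply: idZ => //; apply: idMl.
have [N hN] : exists N, forall x, x \in Fs -> S N x.2.
  have : forall x, x \in Fs -> U x.2 by move=> x /hF1 [].
  elim: (Fs) => [|x s IH] hs; first by exists 0%N.
  have [N hN] := IH (fun y hy => hs y (mem_behead (s := x :: s) hy)).
  have [i hi] := hs x (mem_head _ _).
  exists (maxn i N) => y; rewrite inE => /orP[/eqP ->|/hN h].
    by apply: (hmono i) => //; apply: leq_maxl.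
  by apply: (hmono N) => //; apply: leq_maxr.
have [hgN [_ [f [hf hnf]]]] := hn _ (hS N).
apply: hnf; have hUf : U f by exists N.+1.
have [s [hs1 ->]] := hF2 tt f hUf.
have hi : is_ideal (S N) by case: (hS N) => [[]].
apply: id_sum => // x /hs1 [hx _] _; apply: idZ => //; apply: idMl => //; exact: hN.
Qed.

(** Top components lying in P are subtracted one after another; this stops before 0 because f is
    outside P. *)
Lemma top_comp P f : homog_ideal P -> ~ P f ->
  exists i f', [/\ P (f - f'), (msize f' <= i.+1)%N & ~ P (hcomp i f')].
Proof.
move=> [iP hP]; move: {2}(msize f) (leqnn (msize f)) => n; elim: n f => [|n IH] f hn hf.
  by case: hf; move: hn; rewrite leqn0 msize_poly_eq0 => /eqP ->; apply: id0.
case: (classic (P (hcomp n f))) => h; last first.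
  by exists n, f; rewrite subrr; split=> //; apply: id0.
have e : f = hcomp n f + \sum_(d < n) hcomp d f.
  by rewrite {1}(hcomp_partition hn) big_ord_recr addrC.
have [||i [f' [h1 h2 h3]]] := IH (\sum_(d < n) hcomp d f).
- apply: leq_trans (msize_sum _ _ _) _; apply/bigmax_leqP => d _.
  by apply: leq_trans (homog_msize (homog_hcomp _ _)) _.
- by move=> h'; apply: hf; rewrite e; apply: idD.
exists i, f'; split=> //; rewrite e -addrA; exact: idD.
Qed.

Lemma hcomp_top i j f g : (msize f <= i.+1)%N -> (msize g <= j.+1)%N ->
  hcomp (i + j) (f * g) = hcomp i f * hcomp j g.
Proof.
move=> hf hg; rewrite {1}(hcomp_partition hf) big_ord_recr mulrDl hcompD /=.
rewrite [X in _ + X](hcompM_homog _ _ (homog_hcomp i f)) mulr_suml hcomp_sum big1 ?add0r // => d _.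
have hd : (i + j = d + (i + j - d))%N by have := ltn_ord d; lia.
rewrite hd hcompM_homog ?homog_hcomp //.
suff -> : hcomp (i + j - d) g = 0 by rewrite mulr0.
apply/mpolyP => u; rewrite coeff_hcomp mcoeff0; case: eqP => // hu.
apply: memN_msupp_eq0; apply: msize_mdeg_ge; rewrite hu; have := ltn_ord d; lia.
Qed.

(** Maximality among homogeneous ideals gives primality for homogeneous elements; for arbitrary a
    and b it is applied to top components of representatives modulo P. *)
Lemma max_avoiding_prime P M : homog_ideal P -> avoids P M ->
  (forall P', homog_ideal P' -> avoids P' M -> (forall f, P f -> P' f) -> forall f, P' f -> P f) ->
  M 1 -> (forall f g, M f -> M g -> M (f * g)) -> prime_ideal P.
Proof.
move=> hP hPM hmax M1 MM; have iP := homog_is_ideal hP.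
have meet a d : is_homog d a -> ~ P a -> exists2 f, adjoin P a f & M f.
  move=> ha hPa; apply: NNPP => hno; apply: hPa; apply: (hmax (adjoin P a)).
  - exact: adjoin_homog ha.
  - by move=> f hf Mf; apply: hno; exists f.
  - exact: adjoin_sub.
  - exact: adjoin_mem.
have homog_prime a b d e : is_homog d a -> is_homog e b -> P (a * b) -> ~ P a -> ~ P b -> False.
  move=> ha hb hab /(meet _ _ ha) [_ [x [r [hx ->]]] hM] /(meet _ _ hb) [_ [y [s [hy ->]]] hM'].
  apply: (hPM _ _ (MM _ _ hM hM')).
  have -> : (x + r * a) * (y + s * b) = x * (y + s * b) + (r * a * y + r * s * (a * b)) by ring.
  by apply: idD => //; [apply: idMr|apply: idD => //; apply: idMl].
split=> //; split; first by move=> /hPM; apply.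
move=> a b hab; apply: NNPP => /not_or_and [ha hb].
have [i [a' [ha1 ha2 ha3]]] := top_comp hP ha.
have [j [b' [hb1 hb2 hb3]]] := top_comp hP hb.
apply: (homog_prime _ _ _ _ (homog_hcomp i a') (homog_hcomp j b')) => //.
rewrite -hcomp_top //; case: hP => _; apply.
have -> : a' * b' = a * b - ((a - a') * b + a' * (b - b')) by ring.
by apply: idB => //; apply: idD => //; [apply: idMr|apply: idMl].
Qed.

End Adjoin.

Section Krull.
Variables (k : fieldType) (m : nat) (le : rel 'X_{1..m}) (I : {mpoly k[m]} -> Prop).
Hypothesis hle : term_order le.
Hypothesis hI : homog_ideal I.

(** Pigeonhole: a monomial of degree above the sum of the exponents N_l is divisible by some
    X_l^(N_l), hence lies in P + (z). *)
Lemma pow_onto (P : {mpoly k[m]} -> Prop) z : is_ideal P ->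
  (forall l, exists N, adjoin P z ('X_l ^+ N)) -> exists a, mul_onto P z a.
Proof.
move=> iP H; pose N l := proj1_sig (constructive_indefinite_description _ (H l)).
have hN l : adjoin P z ('X_l ^+ N l) by rewrite /N; case: constructive_indefinite_description.
exists (\sum_l N l).+1; apply: ontoX => // u hu.
have [l hl] : exists l, (N l <= u l)%N.
  apply/existsP; apply: contraPT hu => /existsPn h; rewrite mdegE => e.
  suff : (\sum_i u i <= \sum_l N l)%N by rewrite e ltnn.
  by apply: leq_sum => l _; apply: ltnW; rewrite ltnNge; apply: h.
have [x [r [hx e]]] := hN l.
have hd : (U_(l) *+ N l <= u)%MM.
  apply/mnm_lepP => i; rewrite mulmnE mnm1E; case: eqP => [<-|_]; last by rewrite mul0n.
  by rewrite mul1n.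
exists ('X_[u - U_(l) *+ N l] * r).
have -> : 'X_[u] - z * ('X_[u - U_(l) *+ N l] * r) = 'X_[u - U_(l) *+ N l] * x.
  rewrite -{1}(submK hd) mpolyXD -mpolyXn e; ring.
exact: idMl.
Qed.

(** Otherwise I contains no nonzero polynomial in X_p and X_q alone, since its leading monomial
    would divide a power of X_p X_q. A chain P0 < P1 < (x_1, ..., x_m) of primes above I is then
    built. *)
Lemma krull_nilpotent (p q : 'I_m) : krull_dim_le1 I -> p != q ->
  exists N, initial le I 'X_[(U_(p) + U_(q)) *+ N].
Proof.
move=> hkr hpq; apply: NNPP => hno.
have iI := homog_is_ideal hI.
pose M0 (f : {mpoly k[m]}) := f != 0 /\ forall u, u \in msupp f -> forall l, l != p -> l != q -> u l = 0%N.
have IM0 : avoids I M0.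
  move=> f hf [f0 hM]; have [u [hu1 hu2]] := lead_ex hle f0.
  apply: hno; exists (mdeg u).
  have hJu : initial le I 'X_[u] by apply/initialX; exists f.
  apply: (id_mdvd (initial_ideal hle iI)) hJu; apply/mnm_lepP => l.
  rewrite mulmnE mnmDE !mnm1E.
  have hul : (u l <= mdeg u)%N by rewrite mdegE (bigD1 l) //= leq_addr.
  have [e|h1] := eqVneq l p; first by rewrite (leq_trans hul) // leq_pmull // ?addn_gt0 ?orbT.
  have [e|h2] := eqVneq l q; first by rewrite (leq_trans hul) // leq_pmull // ?addn_gt0 ?orbT.
  by rewrite (hM u hu1 l h1 h2).
have [P0 [hP0 P0M IP0 P0max]] := max_avoiding hI IM0.
have iP0 := homog_is_ideal hP0.
have M01 : M0 1.
  split; first exact: oner_neq0.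
  by move=> u; rewrite msupp1 inE => /eqP -> l; rewrite mnm0E.
have M0M f g : M0 f -> M0 g -> M0 (f * g).
  move=> [f0 hf] [g0 hg]; split; first exact: mulf_neq0.
  move=> u /msuppM_le /allpairsP [[v w] /= [hv hw ->]] l h1 h2.
  by rewrite mnmDE (hf v) // (hg w).
have pr0 := max_avoiding_prime hP0 P0M P0max M01 M0M.
have M0X a b : M0 'X_[U_(p) *+ a + U_(q) *+ b].
  split; first by rewrite -msupp_eq0 msuppX.
  move=> u; rewrite msuppX inE => /eqP -> l h1 h2.
  by rewrite mnmDE !mulmnE !mnm1E eq_sym (negbTE h1) eq_sym (negbTE h2).
have hXp : ~ P0 'X_p.
  by move=> /P0M; apply; have := M0X 1%N 0%N; rewrite mulm1n mulm0n addm0.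
have hX1 l : is_homog 1 ('X_l : {mpoly k[m]}) by apply: homogXd; rewrite mdeg1.
(* If P0 + (X_p) contained a power of every variable, X_p would be onto on R/P0 in high degrees and
   bound the Hilbert function; but the monomials in X_p and X_q are independent modulo P0. *)
case: (classic (forall l, exists N, adjoin P0 'X_p ('X_l ^+ N))) => [hall|].
  have [a ha] := pow_onto iP0 hall.
  have hdec i : (hilb le P0 (a + i) <= hilb le P0 a)%N.
    elim: i => [|i IH]; first by rewrite addn0.
    rewrite addnS; apply: leq_trans IH; apply: (hilb_onto hle hP0 (hX1 p)).
    by apply: (onto_mono iP0 _ ha); rewrite -addnS leq_addr.
  (* Degree j has j + 1 monomials in X_p and X_q, more than the bound [hilb le P0 a]. *)
  pose j := (a + hilb le P0 a)%N.
  pose mon (i : nat) : 'X_{1..m} := (U_(p) *+ i + U_(q) *+ (j - i))%MM.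
  have hmon (i : 'I_j.+1) : is_homog j ('X_[mon i] : {mpoly k[m]}).
    by apply: homogXd; rewrite /mon mdegD !mdegMn !mdeg1 !mul1n subnKC // -ltnS.
  pose B : 'M[k]_(j.+1, hilb le P0 j) := \matrix_(i, c) nf le P0 j 'X_[mon i] ord0 c.
  have rowB i : row i B = nf le P0 j 'X_[mon i] by apply/rowP => c; rewrite !mxE.
  suff : row_free B.
    move=> /eqP e; have := rank_leq_col B; rewrite e => h.
    by have := hdec (hilb le P0 a); rewrite -/j => h'; move: h h'; rewrite /j; lia.
  rewrite -kermx_eq0; apply/eqP/row_matrixP => r; rewrite row0.
  set v := row r _.
  have hv : v *m B = 0 by apply/sub_kermxP; apply: row_sub.
  pose f : {mpoly k[m]} := \sum_i v ord0 i *: 'X_[mon i].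
  have hf : P0 f.
    have e : polv (v *m B) = 0 by rewrite hv polv0.
    rewrite -[f]subr0 -e mulmx_polv /f -sumrB; apply: id_sum => // i _ _.
    by rewrite -scalerBr rowB; apply: idZ => //; apply: nfP.
  have fc (i : 'I_j.+1) : f@_(mon i) = v ord0 i.
    rewrite /f raddf_sum /= (bigD1 i) //= mcoeffZ mcoeffX eqxx mulr1 big1 ?addr0 // => i' hi'.
    rewrite mcoeffZ mcoeffX; case: eqP => [/mnmP /(_ p)|_]; last by rewrite mulr0.
    rewrite !mnmDE !mulmnE !mnm1E eqxx eq_sym (negbTE hpq) !mul1n !mul0n !addn0 => e.
    by case/eqP: hi'; apply: val_inj.
  have [f0|f0] := eqVneq f 0.
    by apply/rowP => i; rewrite [RHS]mxE -fc f0 mcoeff0.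
  case: (P0M _ hf); split=> // u hu l h1 h2.
  have : u \in [seq mon i | i : 'I_j.+1].
    apply: contraTT hu => hu; rewrite mcoeff_msupp negbK /f raddf_sum /= big1 // => i _.
    rewrite mcoeffZ mcoeffX; case: eqP => [e|_]; last by rewrite mulr0.
    by case/negP: hu; rewrite -e; apply/imageP; exists i.
  move=> /imageP [i _ ->].
  by have [_ /(_ (mon i))] := M0X i (j - i)%N; rewrite msuppX mem_head => /(_ isT); apply.
move=> /not_all_ex_not [l hl].
(* P1 will contain P0 and X_p but no power of X_l, which places it strictly between P0 and (x_1,
   ..., x_m). *)
pose M1 (f : {mpoly k[m]}) := exists N, f = 'X_l ^+ N.
have hA1 := adjoin_homog hP0 (hX1 p).
have A1M : avoids (adjoin P0 'X_p) M1 by move=> f hf [N e]; apply: hl; exists N; rewrite -e.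
have [P1 [hP1 P1M AP1 P1max]] := max_avoiding hA1 A1M.
have pr1 : prime_ideal P1.
  apply: (max_avoiding_prime hP1 P1M P1max); first by exists 0%N.
  by move=> _ _ [a ->] [b ->]; exists (a + b)%N; rewrite exprD.
apply: hkr; exists P0, P1, (fun f : {mpoly k[m]} => f@_0%MM = 0); split=> //.
- split; [split; [|split]|split].
  + exact: mcoeff0.
  + by move=> f g; rewrite mcoeffD => -> ->; rewrite addr0.
  + by move=> f g; rewrite (rmorphM (mcoeff 0%MM)) /= => ->; rewrite mulr0.
  + by rewrite mcoeff1 eqxx => /eqP; rewrite oner_eq0.
  + move=> f g; rewrite (rmorphM (mcoeff 0%MM)) /= => /eqP; rewrite mulf_eq0.
    by case/orP => /eqP; [left|right].
split=> //.
- split; first by move=> f hf; apply: AP1; apply: adjoin_sub.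
  by exists 'X_p; split=> //; apply: AP1; apply: adjoin_mem.
split.
  (* A nonzero constant term would put 1, the power of X_l with exponent 0, into P1. *)
  move=> f hf; apply: NNPP => hf0.
  have : P1 (hcomp 0 f) by case: hP1 => _; apply.
  have -> : hcomp 0 f = (f@_0%MM)%:MP.
    apply/mpolyP => u; rewrite coeff_hcomp mcoeffC mdeg_eq0.
    by case: eqP => [->|_]; rewrite ?mulr1 ?mulr0.
  move=> /(idMl (homog_is_ideal hP1) ((f@_0%MM)^-1)%:MP).
  rewrite -mpolyCM mulVf; last by apply/eqP.
  by move=> /P1M; apply; exists 0%N.
exists 'X_l; split; first by rewrite mcoeffX mnm1_eq0.
by move=> /P1M; apply; exists 1%N.
Qed.

End Krull.

(** * Monomial ideals of dimension at most one *)

Section MonoSat.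
Variables (k : fieldType) (m : nat) (J : {mpoly k[m]} -> Prop).
Hypothesis hJ : mono_ideal J.
Let iJ : is_ideal J := mono_is_ideal hJ.
Implicit Types (u v w A : 'X_{1..m}) (p q : 'I_m) (b y : {mpoly k[m]}).

(* monomials of the localization of J at X_p *)
Definition Jloc p A := exists N, J 'X_[A + U_(p) *+ N].

Lemma Jloc_mem p A : J 'X_[A] -> Jloc p A.
Proof. by move=> h; exists 0%N; rewrite mulm0n addm0. Qed.

Lemma Jloc_le p A u : (A <= u)%MM -> Jloc p A -> Jloc p u.
Proof.
move=> h [N hN]; exists N; apply: (id_mdvd iJ _ hN).
by apply/mnm_lepP => l; rewrite !mnmDE leq_add2r; move/mnm_lepP: h.
Qed.

Lemma Jloc_addp p A n : Jloc p (A + U_(p) *+ n)%MM -> Jloc p A.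
Proof.
move=> [N hN]; exists (n + N)%N; apply: (id_mdvd iJ _ hN).
by apply/mnm_lepP => l; rewrite !mnmDE !mulmnE mulnDr addnA.
Qed.

Lemma Jloc_add1 p A : Jloc p (A + U_(p))%MM -> Jloc p A.
Proof. by rewrite -{1}[U_(p)%MM]mulm1n; apply: Jloc_addp. Qed.

Lemma coeff_lmul y b w : is_homog 1 y ->
  (y * b)@_w = \sum_i y@_U_(i) * (if (U_(i) <= w)%MM then b@_(w - U_(i)) else 0).
Proof.
move=> hy; rewrite {1}(homog1E hy) mulr_suml raddf_sum /=; apply: eq_bigr => i _.
by rewrite -scalerAl mcoeffZ coeff_X_mul.
Qed.

(** Choose v outside the localization with the largest exponent at p. Any other monomial of b
    reaching v + U_p has a larger exponent at p, so it lies in the localization, and v would too. *)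
Lemma top_coeff p y b v0 : is_homog 1 y -> v0 \in msupp b -> ~ Jloc p v0 ->
  exists v, [/\ v \in msupp b, ~ Jloc p v & (y * b)@_(v + U_(p)) = y@_U_(p) * b@_v].
Proof.
move=> hy hv0 hn0.
pose s := [seq v <- msupp b | ~~ asbool (Jloc p v)].
have hs v : reflect (v \in msupp b /\ ~ Jloc p v) (v \in s).
  rewrite mem_filter; apply: (iffP andP) => [[/asboolP h1 h2]|[h1 h2]] //.
  by split=> //; apply/asboolP.
have [v hv hmax] : exists2 v, v \in s & forall w, w \in s -> (w p <= v p)%N.
  have : v0 \in s by apply/hs.
  elim: (s) v0 {hv0 hn0} => // x t IH v0 _; case: t IH => [|x' t] IH.
    by exists x; rewrite ?mem_head // => w; rewrite inE => /eqP ->.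
  have [v h1 h2] := IH x' (mem_head _ _).
  have [h|h] := leqP (x p) (v p).
    by exists v => [|w]; [rewrite inE h1 orbT|rewrite inE => /orP[/eqP -> //|/h2]].
  exists x; first exact: mem_head.
  by move=> w; rewrite inE => /orP[/eqP ->|/h2 h'] //; apply: leq_trans h' (ltnW h).
have [h1 h2] := hs _ hv.
exists v; split=> //; rewrite coeff_lmul // (bigD1 p) //= lem_addl addmK big1 ?addr0 // => i hi.
case: ifP => [hle|_]; last by rewrite mulr0.
have [/eqP ->|hc] := boolP (b@_(v + U_(p) - U_(i)) == 0); first by rewrite mulr0.
case: h2; apply: Jloc_add1; apply: (@Jloc_le _ (v + U_(p) - U_(i))%MM); first exact: lem_subr.
apply: NNPP => hno.
have := hmax _ (introT (hs _) (conj _ hno)); rewrite mcoeff_msupp => /(_ hc).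
by rewrite mnmBE mnmDE !mnm1E eqxx (negbTE hi); lia.
Qed.

(** y is a nonzerodivisor modulo the localization at X_p: by [top_coeff], a monomial of b outside it
    leaves one in y b. *)
Lemma Jloc_nzd p y b : is_homog 1 y -> y@_U_(p) != 0 ->
  (forall w, w \in msupp (y * b) -> Jloc p w) -> forall v, v \in msupp b -> Jloc p v.
Proof.
move=> hy y0 H v hv; apply: NNPP => hn.
have [w [h1 h2 h3]] := top_coeff hy hv hn.
apply: h2; apply: Jloc_add1; apply: H; rewrite mcoeff_msupp h3.
by rewrite mulf_neq0 // -mcoeff_msupp.
Qed.

(** X_p^a must occur in a multiple of y, which is possible only if X_p occurs in y. *)
Lemma onto_coord p y a : is_homog 1 y -> mul_onto J y a -> (forall N, ~ J 'X_[U_(p) *+ N]) -> y@_U_(p) != 0.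
Proof.
move=> hy hc hN; apply/eqP => y0.
have [b hb] : exists b, J ('X_[U_(p) *+ a] - y * b) by apply: hc; apply: homogXd; rewrite mdegMn mdeg1 mul1n.
apply: (hN a); apply: (proj2 hJ _ _ hb); rewrite mcoeff_msupp mcoeffB mcoeffX eqxx coeff_lmul //.
rewrite big1 ?subr0 ?oner_neq0 // => i _.
have [->|hi] := eqVneq i p; first by rewrite y0 mul0r.
by rewrite lep1mP mulmnE mnm1E [p == i]eq_sym (negbTE hi) mul0n eqxx mulr0.
Qed.

Lemma Jloc_nopow p A : ~ Jloc p A -> forall N, ~ J 'X_[U_(p) *+ N].
Proof.
move=> h N hN; apply: h; exists N; apply: (id_mdvd iJ _ hN); exact: lem_addl.
Qed.

(** Serves multidegrees negative at p. Write X_u = y b modulo J. A monomial of b outside the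
    localization would by [top_coeff] give one in y b divisible by X_p, hence different from X_u and
    so in J. *)
Lemma onto_Jloc_face p y a u : is_homog 1 y -> mul_onto J y a -> u p = 0%N -> (a <= mdeg u)%N -> Jloc p u.
Proof.
move=> hy hc up hu; apply: NNPP => hn.
have y0 := onto_coord hy hc (Jloc_nopow hn).
have [b hb] := onto_mono iJ hu hc (homogXm _ u).
have hx v : v != u -> v \in msupp (y * b) -> J 'X_[v].
  move=> hv hv'; apply: (proj2 hJ _ _ hb); rewrite mcoeff_msupp mcoeffB mcoeffX [_ == v]eq_sym (negbTE hv) sub0r oppr_eq0.
  by rewrite -mcoeff_msupp.
case: (classic (exists2 v, v \in msupp b & ~ Jloc p v)) => [[v hv hnv]|hno].
  have [w [h1 h2 h3]] := top_coeff hy hv hnv.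
  apply: h2; apply: Jloc_add1; apply: Jloc_mem; apply: hx.
    by apply: contraPneq up => <-; rewrite mnmDE mnm1E eqxx addn1.
  by rewrite mcoeff_msupp h3 mulf_neq0 // -mcoeff_msupp.
apply: hn; have [hu'|hu'] := boolP (u \in msupp (y * b)); last first.
  apply: Jloc_mem; apply: (proj2 hJ _ _ hb); rewrite mcoeff_msupp mcoeffB mcoeffX eqxx.
  by rewrite (memN_msupp_eq0 hu') subr0 oner_neq0.
have := msuppM_le hu' => /allpairsP [[i v] /= [hi hv eu]].
rewrite eu; apply: (@Jloc_le _ v); first exact: lem_addl.
by apply: NNPP => hnv; apply: hno; exists v.
Qed.

Hypothesis nilp : forall p q, p != q -> exists N, J 'X_[(U_(p) + U_(q)) *+ N].

(** Serves nonnegative multidegrees. Multiply A by X_p up to the last B outside the localization at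
    q, and write X_p B = y h modulo J. Then h lies in the localization at q, yet [top_coeff] at p
    finds B among its monomials. *)
Lemma onto_Jloc_pair p q y a A : p != q -> is_homog 1 y -> mul_onto J y a -> (a <= (mdeg A).+1)%N ->
  Jloc p A \/ Jloc q A.
Proof.
move=> hpq hy hc hA; apply: NNPP => /not_or_and [hp hq].
have yp := onto_coord hy hc (Jloc_nopow hp).
have yq := onto_coord hy hc (Jloc_nopow hq).
have [N hN] := nilp hpq.
have hqN : Jloc q (A + U_(p) *+ N)%MM.
  exists N; apply: (id_mdvd iJ _ hN); apply/mnm_lepP => l; rewrite !mnmDE !mulmnE mnmDE mulnDl; lia.
have [n [hn1 hn2]] : exists n, ~ Jloc q (A + U_(p) *+ n)%MM /\ Jloc q (A + U_(p) *+ n.+1)%MM.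
  elim: N {hN} hqN => [|N IH]; first by rewrite mulm0n addm0.
  by move=> h; case: (classic (Jloc q (A + U_(p) *+ N)%MM)) => [/IH //|h']; exists N.
pose B := (A + U_(p) *+ n)%MM.
have eB : (A + U_(p) *+ n.+1 = U_(p) + B)%MM by rewrite mulmS addmCA.
have hpB : ~ Jloc p B by move=> /Jloc_addp.
have hd : (a <= mdeg (U_(p) + B)%MM)%N by rewrite /B !mdegD mdeg1; lia.
have [h hh] := onto_mono iJ hd hc (homogXm _ _).
have hx v : v != (U_(p) + B)%MM -> v \in msupp (y * h) -> J 'X_[v].
  move=> hv hv'; apply: (proj2 hJ _ _ hh); rewrite mcoeff_msupp mcoeffB mcoeffX [_ == v]eq_sym (negbTE hv) sub0r oppr_eq0.
  by rewrite -mcoeff_msupp.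
have hqh : forall v, v \in msupp h -> Jloc q v.
  apply: (Jloc_nzd hy yq) => w hw; have [->|hne] := eqVneq w (U_(p) + B)%MM; first by rewrite -eB.
  by apply: Jloc_mem; apply: hx.
have [v0 hv0 hnv0] : exists2 v, v \in msupp h & ~ Jloc p v.
  apply: NNPP => hno; apply: hpB; apply: Jloc_add1; rewrite addmC.
  have [hu'|hu'] := boolP ((U_(p) + B)%MM \in msupp (y * h)); last first.
    apply: Jloc_mem; apply: (proj2 hJ _ _ hh); rewrite mcoeff_msupp mcoeffB mcoeffX eqxx.
    by rewrite (memN_msupp_eq0 hu') subr0 oner_neq0.
  have := msuppM_le hu' => /allpairsP [[i v] /= [hi hv ->]].
  apply: (@Jloc_le _ v); first exact: lem_addl.
  by apply: NNPP => hnv; apply: hno; exists v.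
have [v [h1 h2 h3]] := top_coeff hy hv0 hnv0.
have [e|hne] := eqVneq (v + U_(p))%MM (U_(p) + B)%MM.
  by apply: hn1; rewrite -/B; apply: hqh; rewrite addmC in e; move/addmI: e => <-.
apply: h2; apply: Jloc_add1; apply: Jloc_mem; apply: hx => //.
by rewrite mcoeff_msupp h3 mulf_neq0 // -mcoeff_msupp.
Qed.

(** Each monomial of a high power of y contains some X_l often enough to bring X_A into J;
    injectivity then removes the factors y one at a time. *)
Lemma inj_Jloc_all y a A : is_homog 1 y -> mul_bij J y a -> (forall p, Jloc p A) -> (a <= mdeg A)%N -> J 'X_[A].
Proof.
move=> hy hc hA hd.
pose N p := proj1_sig (constructive_indefinite_description _ (hA p)).
have hN p : J 'X_[A + U_(p) *+ N p] by rewrite /N; case: constructive_indefinite_description.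
pose n := (\sum_p N p).+1.
have yn i : is_homog i (y ^+ i).
  elim: i => [|i IH]; first by rewrite is_homogE expr0 dhomog1.
  by rewrite exprS -add1n; apply: homogM.
have hyn : J (y ^+ n * 'X_[A]).
  rewrite (mpolyE (y ^+ n)) mulr_suml; apply: id_sum => // v hv _.
  rewrite -scalerAl; apply: idZ => //; rewrite -mpolyXD addmC.
  have hvn : mdeg v = n by move/is_homogP: (yn n); apply.
  have [l hl] : exists l, (N l <= v l)%N.
    apply/existsP; apply: contraPT hvn => /existsPn h; rewrite mdegE => e.
    suff : (\sum_i v i <= \sum_l N l)%N by rewrite e ltnn.
    by apply: leq_sum => l _; apply: ltnW; rewrite ltnNge; apply: h.
  apply: (id_mdvd iJ _ (hN l)); apply/mnm_lepP => i; rewrite !mnmDE mulmnE mnm1E leq_add2l.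
  by case: eqP => [<-|_]; rewrite ?mul1n ?mul0n.
elim: (n) hyn => [|i IH]; first by rewrite expr0 mul1r.
rewrite exprS -mulrA => h; apply: IH; apply: (mul_bij_inj hc (j := i + mdeg A)) h.
  by apply: leq_trans hd _; apply: leq_addl.
by apply: homogM => //; apply: homogXm.
Qed.

Lemma onto_exists y : is_homog 1 y -> (forall p, (forall N, ~ J 'X_[U_(p) *+ N]) -> y@_U_(p) != 0) ->
  exists a, mul_onto J y a.
Proof.
move=> hy hp; apply: pow_onto => // l.
case: (classic (exists N, J 'X_[U_(l) *+ N])) => [[N hN]|hno].
  by exists N; rewrite mpolyXn; apply: adjoin_sub.
have yl : y@_U_(l) != 0 by apply: hp => N hN; apply: hno; exists N.
have hq q : exists N, q != l -> J 'X_[(U_(l) + U_(q)) *+ N].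
  have [->|hne] := eqVneq q l; first by exists 0%N.
  by have [|N hN] := @nilp l q; [rewrite eq_sym|exists N].
pose Nq q := proj1_sig (constructive_indefinite_description _ (hq q)).
have hNq q : q != l -> J 'X_[(U_(l) + U_(q)) *+ Nq q] by rewrite /Nq; case: constructive_indefinite_description.
pose N := \max_q Nq q.
have hN q : q != l -> J 'X_[(U_(l) + U_(q)) *+ N].
  move=> /hNq h; apply: (id_mdvd iJ _ h); apply/mnm_lepP => i; rewrite !mulmnE leq_mul2l.
  by rewrite (leq_bigmax q) orbT.
(* Modulo y, X_l is a form e in the other variables, so X_l^(N+K) is X_l^N e^K. As K > m N, each
   monomial of e^K has some X_q with exponent above N, and (X_l X_q)^N is in J. *)
pose K := (m * N).+1.
pose e : {mpoly k[m]} := - (y@_U_(l))^-1 *: (\sum_(q | q != l) y@_U_(q) *: 'X_q).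
have ee : 'X_l - e = (y@_U_(l))^-1 *: y.
  have ey : y = y@_U_(l) *: 'X_l + \sum_(q | q != l) y@_U_(q) *: 'X_q by rewrite {1}(homog1E hy) (bigD1 l).
  by rewrite /e scaleNr opprK [X in _ = _ *: X]ey scalerDr scalerA mulVf // scale1r.
have he1 : is_homog 1 e.
  by apply: homogZ; apply: homog_sum => q _ _; apply: homogZ; apply: homogXd; rewrite mdeg1.
have he2 : e@_U_(l) = 0.
  rewrite /e mcoeffZ raddf_sum /= big1 ?mulr0 // => q hql.
  by rewrite mcoeffZ mcoeffX eq_mnm1 (negbTE hql) mulr0.
exists (N + K)%N.
have eK i : forall v, v \in msupp (e ^+ i) -> v l = 0%N /\ mdeg v = i.
  elim: i => [|i IH] v; first by rewrite expr0 msupp1 inE => /eqP ->; rewrite mnm0E mdeg0.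
  rewrite exprS => /msuppM_le /allpairsP [[u w] /= [hu /IH [hw1 hw2] ->]].
  rewrite mnmDE mdegD hw1 hw2.
  have hu1 : mdeg u = 1%N by move/is_homogP: he1; apply.
  rewrite hu1 add1n; split=> //; move/eqP/mdeg1P: hu1 hu => [q /eqP ->].
  rewrite mnm1E; case: eqP => // ->; by rewrite mcoeff_msupp he2 eqxx.
have [r hr] : exists r, 'X_l ^+ K - e ^+ K = r * y.
  rewrite subrXX ee; set s := \sum_(_ < _) _.
  by exists ((y@_U_(l))^-1 *: s); rewrite -!scalerAl mulrC.
exists ('X_l ^+ N * e ^+ K), ('X_l ^+ N * r); split; last first.
  by rewrite exprD -mulrA -hr mulrBr addrC subrK.
rewrite (mpolyE (e ^+ K)) mulr_sumr; apply: id_sum => // v /eK [hv1 hv2] _.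
rewrite -scalerAr; apply: idZ => //; rewrite mpolyXn -mpolyXD.
have [q hvq] : exists q, (N < v q)%N.
  apply/existsP; apply: contraPT hv2 => /existsPn h; rewrite mdegE => e1.
  suff : (\sum_i v i <= m * N)%N by rewrite e1 ltnn.
  rewrite -[X in (_ <= X * _)%N]card_ord -sum_nat_const; apply: leq_sum => i _; rewrite leqNgt; exact: h.
have hql : q != l by apply: contraTneq hvq => ->; rewrite hv1.
apply: (id_mdvd iJ _ (hN q hql)); apply/mnm_lepP => i; rewrite !mnmDE !mulmnE mnmDE !mnm1E mulnDl leq_add2l.
by case: eqP => [<-|_]; rewrite ?mul1n ?mul0n // ltnW.
Qed.

End MonoSat.

(** * Regularity: the upper bound *)

Section Signs.
Variables (k : fieldType) (m : nat).
Implicit Types (S T : {set 'I_m}) (j x : 'I_m).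

Definition sgn (j : 'I_m) (S : {set 'I_m}) : k := (-1) ^+ #|[set i in S | (i < j)%N]|.

Lemma csignE j S : csign k j S = (sgn j S)%:MP.
Proof. by rewrite /csign /sgn rmorphXn rmorphN1. Qed.

Lemma sgn_sqr j S : sgn j S * sgn j S = 1.
Proof. by rewrite /sgn -exprD -signr_odd oddD addbb expr0. Qed.

Lemma sgn_add j x S : x \notin S -> sgn j (x |: S) = (-1) ^+ (x < j)%N * sgn j S.
Proof.
move=> hx; rewrite /sgn; case: ltnP => h.
  have -> : [set i in x |: S | (i < j)%N] = x |: [set i in S | (i < j)%N].
    by apply/setP => i; rewrite !inE; case: eqP => [->|_] //=; rewrite h.
  by rewrite cardsU1 inE (negbTE hx) /= exprD.
have -> : [set i in x |: S | (i < j)%N] = [set i in S | (i < j)%N].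
  by apply/setP => i; rewrite !inE; case: eqP => [->|_] //=; rewrite ltnNge h andbF.
by rewrite expr0 mul1r.
Qed.

Lemma sgn_self j S : sgn j (S :\ j) = sgn j S.
Proof.
rewrite /sgn; congr (_ ^+ #|pred_of_set _|); apply/setP => i; rewrite !inE.
by case: eqP => [->|_] //=; rewrite ltnn andbF.
Qed.

Lemma sgn_swap (x y : 'I_m) : x != y -> (-1) ^+ (x < y)%N * (-1) ^+ (y < x)%N = -1 :> k.
Proof.
by rewrite -val_eqE neq_ltn => /orP[h|h]; rewrite h ltnNge ltnW ?expr0 ?expr1 ?mulr1 ?mul1r.
Qed.

(* The cone over j0 is a contracting homotopy of the full simplicial cochain complex. *)
Lemma cone (phi : {set 'I_m} -> k) (i : nat) (j0 : 'I_m) :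
  (forall T, #|T| = i.+1 -> \sum_(j in T) sgn j T * phi (T :\ j) = 0) ->
  forall S, #|S| = i ->
  \sum_(j in S) sgn j S * (if j0 \in S :\ j then 0 else sgn j0 (S :\ j) * phi (j0 |: (S :\ j))) = phi S.
Proof.
move=> hd S hS; have [hj|hj] := boolP (j0 \in S).
  rewrite (bigD1 j0) //= !inE eqxx /= big1 ?addr0.
    by rewrite setD1K // sgn_self mulrA sgn_sqr mul1r.
  by move=> j /andP[hjS hne]; rewrite !inE eq_sym hne hj mulr0.
have hT : #|j0 |: S| = i.+1 by rewrite cardsU1 hj hS.
have := hd _ hT; rewrite (bigD1 j0) ?setU11 //= setU1K // => e.
have e0 : sgn j0 (j0 |: S) = sgn j0 S by rewrite -sgn_self setU1K.
rewrite e0 in e.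
have -> : phi S = - (sgn j0 S * \sum_(i in j0 |: S | i != j0) sgn i (j0 |: S) * phi ((j0 |: S) :\ i)).
  have := congr1 ( *%R (sgn j0 S)) e; rewrite mulrDr mulrA sgn_sqr mul1r mulr0 => /eqP.
  by rewrite addr_eq0 => /eqP.
rewrite mulr_sumr -sumrN; apply: eq_big => [j|j hjS].
  by rewrite !inE; case: eqP => [->|]; rewrite ?(negbTE hj) ?andbF ?andbT.
have hne : j0 != j by apply: contraNneq hj => ->.
rewrite !inE (negbTE hj) andbF.
have -> : (j0 |: S) :\ j = j0 |: (S :\ j).
  by apply/setP => x; rewrite !inE; case: (eqVneq x j0) => [->|] //=; rewrite hne.
rewrite sgn_add // -[in sgn j0 S](setD1K hjS) sgn_add ?setD11 //.
rewrite !mulrA -mulNr; congr (_ * _).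
have -> : - ((-1) ^+ (j < j0)%N * sgn j0 (S :\ j) * (-1) ^+ (j0 < j)%N * sgn j S) =
  - ((-1) ^+ (j0 < j)%N * (-1) ^+ (j < j0)%N) * (sgn j S * sgn j0 (S :\ j)) by ring.
by rewrite sgn_swap // opprK mul1r.
Qed.

Lemma sgn_pair (x y : 'I_m) : x != y -> \sum_(j in [set x; y]) sgn j [set x; y] = 0.
Proof.
move=> hxy; rewrite (bigD1 x) ?inE ?eqxx //= (bigD1 y) /=; last by rewrite !inE eqxx orbT eq_sym.
rewrite big1 ?addr0; last by move=> j; rewrite !inE => /andP[/andP[/orP[]/eqP -> ]]; rewrite eqxx ?andbF.
have s1 (z : 'I_m) : sgn z [set z] = 1.
  rewrite /sgn (_ : [set i in _ | _] = set0) ?cards0 //; apply/setP => i; rewrite !inE.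
  by case: eqP => //= ->; rewrite ltnn.
rewrite [sgn y _]sgn_add ?inE // s1 mulr1 setUC sgn_add ?inE 1?eq_sym // s1 mulr1.
have := sgn_swap hxy; rewrite -val_eqE neq_ltn in hxy *.
by case/orP: hxy => h; rewrite h ltnNge ltnW //= ?expr0 ?expr1 ?subrr ?addNr.
Qed.

End Signs.

Lemma ord_sum_const m c : (c * m = \sum_(l < m) c)%N.
Proof. by rewrite sum_nat_const card_ord mulnC. Qed.

Section CechUpper.
Variables (k : fieldType) (m : nat) (J : {mpoly k[m]} -> Prop).
Hypothesis hJ : mono_ideal J.
Hypothesis nilp : forall p q : 'I_m, p != q -> exists N, J 'X_[(U_(p) + U_(q)) *+ N].
Let iJ : is_ideal J := mono_is_ideal hJ.
Implicit Types (S T : {set 'I_m}) (b : 'X_{1..m}).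

Definition mon_in S t : 'X_{1..m} := [multinom if l \in S then t else 0%N | l < m].
Definition mon_out S t : 'X_{1..m} := [multinom if l \in S then 0%N else t | l < m].
(* numerator over x_S^(t+N) of the Laurent monomial x^b / (x_1...x_m)^t *)
Definition loc t b S N : 'X_{1..m} := [multinom if l \in S then (b l + N)%N else (b l - t)%N | l < m].

Lemma xpowE S t : xpow k S t = 'X_[mon_in S t].
Proof.
rewrite /xpow mpolyXE_id big_mkcond; apply: eq_bigr => j _.
by rewrite mnmE; case: ifP => _; rewrite ?expr0.
Qed.

Lemma mon_out_D1 S t j : j \in S -> mon_out (S :\ j) t = (U_(j) *+ t + mon_out S t)%MM.
Proof.
move=> hj; apply/mnmP => l; rewrite mnmDE mulmnE mnm1E !mnmE !inE.
by case: eqVneq => [->|_]; rewrite ?hj ?mul1n ?addn0 ?mul0n ?add0n.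
Qed.

Lemma cech_dE (f : {set 'I_m} -> {mpoly k[m]}) t T :
  'X_[mon_out T t] * cech_d f t T = \sum_(j in T) sgn k j T *: ('X_[mon_out (T :\ j) t] * f (T :\ j)).
Proof.
rewrite /cech_d mulr_sumr; apply: eq_bigr => j hj.
rewrite mon_out_D1 // csignE -!mulrA mul_mpolyC -!scalerAr mpolyXD mpolyXn.
by congr (_ *: _); ring.
Qed.

Lemma loc_mono t b S N N' : (N <= N')%N -> J 'X_[loc t b S N] -> J 'X_[loc t b S N'].
Proof.
move=> h; apply: (id_mdvd iJ); apply/mnm_lepP => l; rewrite !mnmE; case: ifP => // _.
by rewrite leq_add2l.
Qed.

(** Multiplication by (x_1...x_m)^t clears the denominators of the cochain; this is its component in
    the Laurent multidegree b - (t, ..., t), a scalar simplicial cochain. *)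
Definition phi (f : {set 'I_m} -> {mpoly k[m]}) t b S : k := ('X_[mon_out S t] * f S)@_b.

Lemma phi_coeff f t b S : phi f t b S != 0 ->
  [/\ forall l, l \notin S -> (t <= b l)%N & loc t b S 0 \in msupp (f S)].
Proof.
rewrite /phi coeff_X_mul; case: ifP => [/mnm_lepP h hc|]; last by rewrite eqxx.
split; first by move=> l hl; move: (h l); rewrite mnmE (negbTE hl).
rewrite mcoeff_msupp; congr (_@__ != 0): hc; apply/mnmP => l.
by rewrite mnmBE !mnmE; case: ifP; rewrite ?subn0 ?addn0.
Qed.

Lemma loc_deg t b S N : (forall l, l \notin S -> (t <= b l)%N) ->
  (mdeg (loc t b S N) + t * m = mdeg b + #|S| * (N + t))%N.
Proof.
move=> h; have -> : (#|S| * (N + t) = \sum_(l < m) if l \in S then N + t else 0)%N.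
  by rewrite -sum_nat_const big_mkcond.
rewrite !mdegE ord_sum_const -!big_split /=; apply: eq_bigr => l _; rewrite mnmE.
by case: ifP => hl; [lia|move: (h l (negbT hl)); lia].
Qed.

Lemma cocycle_phi f t i b : cocycle i t f ->
  forall T, #|T| = i.+1 -> \sum_(j in T) sgn k j T * phi f t b (T :\ j) = 0.
Proof.
move=> hc T /hc /(congr1 (fun p => ('X_[mon_out T t] * p)@_b)); rewrite mulr0 mcoeff0 cech_dE => e.
by apply: etrans e; rewrite raddf_sum /=; apply: eq_bigr => j _; rewrite mcoeffZ.
Qed.

Lemma coboundary_of (f : {set 'I_m} -> {mpoly k[m]}) t i (psi : 'X_{1..m} -> {set 'I_m} -> k) :
  (forall b S, #|S| = i.+1 -> \sum_(j in S) sgn k j S * psi b (S :\ j) = phi f t b S) ->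
  (forall b S, #|S| = i -> psi b S != 0 ->
     (forall l, l \notin S -> (t <= b l)%N) /\ exists N, J 'X_[loc t b S N]) ->
  coboundary J i.+1 t f.
Proof.
move=> h1 h2; pose B := \max_(S : {set 'I_m}) msize ('X_[mon_out S t] * f S).
have hN (x : 'X_{1..m < B} * {set 'I_m}) : exists N, #|x.2| = i -> psi x.1 x.2 != 0 -> J 'X_[loc t x.1 x.2 N].
  case: (classic (#|x.2| = i /\ psi x.1 x.2 != 0)) => [[e1 e2]|hn]; last by exists 0%N => e1 e2; case: hn.
  by have [_ [N hN]] := h2 _ _ e1 e2; exists N.
pose N0 x := proj1_sig (constructive_indefinite_description _ (hN x)).
have hN0 (x : 'X_{1..m < B} * {set 'I_m}) : #|x.2| = i -> psi x.1 x.2 != 0 -> J 'X_[loc t x.1 x.2 (N0 x)].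
  by rewrite /N0; case: constructive_indefinite_description.
pose N := \max_x N0 x.
have hN1 (b : 'X_{1..m < B}) S : #|S| = i -> psi b S != 0 -> J 'X_[loc t b S N].
  by move=> e1 e2; apply: (loc_mono _ (hN0 (b, S) e1 e2)); apply: (leq_bigmax (b, S)).
pose g S : {mpoly k[m]} := \sum_(b : 'X_{1..m < B}) psi b S *: 'X_[loc t b S N].
pose c a : 'X_{1..m} := [multinom a | l < m].
exists (t + N)%N, g; split.
  move=> S hS; apply: id_sum => // b _ _.
  have [->|e] := eqVneq (psi b S) 0; first by rewrite scale0r; apply: id0.
  by apply: idZ => //; apply: hN1.
move=> S hS; rewrite !xpowE.
have nz : 'X_[mon_out S (t + N)] != 0 :> {mpoly k[m]} by rewrite -msupp_eq0 msuppX.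
apply: (mulfI nz); rewrite mulrA cech_dE.
have hg S' : #|S'| = i -> 'X_[mon_out S' (t + N)] * g S' = 'X_[c N] * \sum_(b : 'X_{1..m < B}) psi b S' *: 'X_[b].
  move=> hS'; rewrite /g !mulr_sumr; apply: eq_bigr => b _.
  have [->|e] := eqVneq (psi b S') 0; first by rewrite !scale0r !mulr0.
  have [h _] := h2 _ _ hS' e.
  rewrite -!scalerAr -!mpolyXD; congr (_ *: 'X_[_]); apply/mnmP => l; rewrite !mnmDE !mnmE.
  by case: ifP => hl; [lia|move: (h l (negbT hl)); lia].
have -> : \sum_(j in S) sgn k j S *: ('X_[mon_out (S :\ j) (t + N)] * g (S :\ j)) =
    'X_[c N] * ('X_[mon_out S t] * f S).
  have hle : (msize ('X_[mon_out S t] * f S) <= B)%N by apply: (leq_bigmax S).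
  rewrite [X in _ = _ * X](mpolywE hle) mulr_sumr.
  under eq_bigr => j hj.
    rewrite hg; last by move: hS; rewrite (cardsD1 j) hj add1n => -[].
    rewrite scalerAr scaler_sumr mulr_sumr; over.
  rewrite exchange_big /=; apply: eq_bigr => b _; rewrite -mulr_sumr.
  rewrite -[('X_[mon_out S t] * f S)@_b]/(phi f t b S) -(h1 b S hS) scaler_suml.
  by congr (_ * _); apply: eq_bigr => j _; rewrite scalerA.
have e : (c N + mon_out S t + mon_in S t = mon_out S (t + N) + mon_in S (t + N))%MM.
  by apply/mnmP => l; rewrite !mnmDE !mnmE; case: ifP => _; lia.
transitivity ('X_[c N + mon_out S t + mon_in S t] * f S); first by rewrite !mpolyXD; ring.
by rewrite e mpolyXD; ring.
Qed.

Section Upper.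
Variables (y : {mpoly k[m]}) (a : nat).
Hypothesis hy : is_homog 1 y.
Hypothesis hc : mul_bij J y a.
Variables (r : Z) (t : nat) (f : {set 'I_m} -> {mpoly k[m]}).

Lemma phi_deg i b S : cochain J i r t f -> #|S| = i -> phi f t b S != 0 ->
  [/\ forall l, l \notin S -> (t <= b l)%N, J 'X_[loc t b S 0] & Z.of_nat (mdeg b) = Z.add r (Z.of_nat (t * m))].
Proof.
move=> hf hS /phi_coeff [h1 h2]; have [hJf hd] := hf S hS; split=> //; first exact: (proj2 hJ _ _ hJf).
case: hd => [e|[d [/is_homogP /(_ _ h2) hd e]]]; first by move: h2; rewrite e -mpolyC0 msupp0.
have := loc_deg 0 h1; rewrite hd hS; move: e; lia.
Qed.

(** The cone over j0 is a primitive in multidegree b; j0 must be chosen so that its values lie in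
    the localizations of J. The three cases for i concern H^1(J), H^2(J) and the higher ones. *)
Lemma cone_exists i b : cochain J i.+1 r t f -> cocycle i.+1 t f -> Z.lt (Z.of_nat a) (Z.add r (Z.of_nat i.+1)) ->
  (exists2 S : {set 'I_m}, #|S| = i.+1 & phi f t b S != 0) ->
  exists j0, forall S, #|S| = i -> j0 \notin S -> phi f t b (j0 |: S) != 0 ->
    (forall l, l \notin S -> (t <= b l)%N) /\ exists N, J 'X_[loc t b S N].
Proof.
move=> hf hcy hr [S0 hS0 hp0].
have [h1 h2 hdeg] := phi_deg hf hS0 hp0.
have card (S : {set 'I_m}) (j0 : 'I_m) : #|S| = i -> j0 \notin S -> #|j0 |: S| = i.+1 by move=> e hj; rewrite cardsU1 hj e.
have hi : (i < m)%N by rewrite -hS0 -[X in (_ <= X)%N]card_ord max_card.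
have out (S : {set 'I_m}) (j0 : 'I_m) : #|S| = i -> j0 \notin S -> phi f t b (j0 |: S) != 0 -> (t <= b j0)%N ->
    forall l, l \notin S -> (t <= b l)%N.
  move=> hS hj hp ht l hl; have [->//|hne] := eqVneq l j0.
  have [h _ _] := phi_deg hf (card _ _ hS hj) hp; apply: h.
  by rewrite !inE negb_or hne.
(* Were all exponents below t, the degree r would be at most -m, against r + i + 1 > a and i < m. *)
have [j hj] : exists j, (t <= b j)%N.
  apply/existsP; apply: contraT => /existsPn h.
  have : (mdeg b + m <= t * m)%N.
    have -> : (mdeg b + m = \sum_(l < m) (b l + 1))%N by rewrite big_split /= -ord_sum_const mul1n mdegE.
    rewrite ord_sum_const.
    by apply: leq_sum => l _; move: (h l); rewrite -ltnNge; lia.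
  by move: hdeg hr; lia.
case: i hf hcy hr S0 hS0 hp0 h1 h2 card hi out => [|[|i]] hf hcy hr S0 hS0 hp0 h1 h2 card hi out.
(* H^1: the cocycle condition on pairs makes it nonzero at every vertex, so the monomial lies in all
   localizations at one variable and, by [inj_Jloc_all], in J. *)
- have hall l : phi f t b [set l] != 0.
    move/eqP/cards1P: hS0 => [l0 e]; rewrite e in hp0.
    have [->//|hne] := eqVneq l l0.
    have hT : #|[set l0; l]| = 2 by rewrite cards2 eq_sym hne.
    have := cocycle_phi b hcy hT; rewrite (bigD1 l0) ?inE ?eqxx //= (bigD1 l) /=; last first.
      by rewrite !inE eqxx orbT hne.
    rewrite big1 ?addr0; last by move=> x; rewrite !inE => /andP[/andP[/orP[]/eqP -> ]]; rewrite eqxx ?andbF.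
    have -> : [set l0; l] :\ l0 = [set l] by rewrite setU1K // inE eq_sym.
    have -> : [set l0; l] :\ l = [set l0] by rewrite setUC setU1K // inE.
    move=> e'; apply: contraNneq hp0 => e0; move: e'; rewrite e0 mulr0 add0r => /eqP.
    by rewrite mulf_eq0 => /orP[/eqP es|//]; have := sgn_sqr k l [set l0; l]; rewrite es mul0r => /esym/eqP; rewrite oner_eq0.
  have hall' l := phi_deg hf (cards1 l) (hall l).
  have htl l : (t <= b l)%N.
    case: (classic (exists l', l' != l)) => [[l' hl']|hno].
      by have [h _ _] := hall' l'; apply: h; rewrite inE eq_sym.
    (* With a single variable, t <= b l comes from the degree instead. *)
    have : mdeg b = b l.
      rewrite mdegE (bigD1 l) //= big1 ?addn0 // => l' hl'; by case: hno; exists l'.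
    have m1 : m = 1%N.
      have : #|[set: 'I_m]| = 1%N.
        apply/eqP/cards1P; exists l; apply/setP => x; rewrite !inE; apply/esym/eqP.
        by apply: NNPP => hx; apply: hno; exists x; apply/eqP.
      by rewrite cardsT card_ord.
    have tm : (t * m = t)%N by rewrite m1 muln1.
    by move: hdeg hr; lia.
  exists j => S hS _ _; split=> // ; exists 0%N.
  have -> : S = set0 by apply/eqP; rewrite -cards_eq0 hS.
  have hA : (mdeg (loc t b set0 0) + t * m = mdeg b)%N.
    by rewrite loc_deg ?cards0 ?addn0 // => l _.
  apply: (inj_Jloc_all hJ hy hc); last by move: hdeg hr; lia.
  move=> l; exists t; have [_ h _] := hall' l.
  apply: (id_mdvd iJ _ h); apply/mnm_lepP => x; rewrite mnmDE mulmnE mnm1E !mnmE !inE [x == l]eq_sym.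
  by case: eqP => _; have := htl x; lia.
(* H^2 with an exponent below t at p: {p} is the only vertex where the cone can be nonzero, and
   [onto_Jloc_face] covers it. *)
- case: (classic (exists p, (b p < t)%N)) => [[p hp]|hno].
    exists j => S hS hjS hp'.
    have hjp : j != p by apply: contraTneq hp => <-; rewrite -leqNgt.
    move/eqP/cards1P: (hS) => [l el]; rewrite el in hS hjS hp' *.
    have elp : p = l.
      have [h _ _] := phi_deg hf (card _ _ hS hjS) hp'.
      apply/eqP; apply: contraTT hp => hne; rewrite -leqNgt; apply: h.
      by rewrite !inE negb_or hne eq_sym hjp.
    have hout := out _ _ hS hjS hp' hj; split=> //; rewrite -elp in hout *.
    pose u : 'X_{1..m} := [multinom if x == p then 0%N else (b x - t)%N | x < m].
    have hu : (mdeg u + t * m + b p = mdeg b + t)%N.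
      rewrite !mdegE ord_sum_const -big_split /=.
      rewrite (bigD1 p) //= [in RHS](bigD1 p) //= mnmE eqxx.
      rewrite (eq_bigr (fun x => b x)); first by lia.
      move=> x hx; rewrite mnmE (negbTE hx) subnK //; apply: hout; by rewrite inE.
    have [N hN] : Jloc J p u.
      have hca : mul_onto J y a by apply: (mul_bij_onto hc).
      apply: (onto_Jloc_face hJ hy hca); first by rewrite mnmE eqxx.
      by move: hdeg hr hp; lia.
    exists N; apply: (id_mdvd iJ _ hN); apply/mnm_lepP => x; rewrite mnmDE mulmnE mnm1E !mnmE !inE.
    by rewrite [p == x]eq_sym; case: eqP => _; lia.
  (* With all exponents at least t, [onto_Jloc_pair] lets A miss the localization at one vertex p at
     most, and the cone over p vanishes on that vertex. *)
  have htl l : (t <= b l)%N by rewrite leqNgt; apply/negP => h; apply: hno; exists l.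
  pose A : 'X_{1..m} := [multinom (b x - t)%N | x < m].
  have hA : (mdeg A + t * m = mdeg b)%N.
    rewrite !mdegE ord_sum_const -big_split /=; apply: eq_bigr => x _.
    by rewrite mnmE subnK.
  have hA' : (a <= (mdeg A).+1)%N by move: hdeg hr; lia.
  have key l : Jloc J l A -> exists N, J 'X_[loc t b [set l] N].
    move=> [N hN]; exists N; apply: (id_mdvd iJ _ hN); apply/mnm_lepP => x; rewrite mnmDE mulmnE mnm1E !mnmE !inE.
    by rewrite [l == x]eq_sym; case: eqP => _; lia.
  case: (classic (exists p, ~ Jloc J p A)) => [[p hp]|hall].
    exists p => S hS hpS _; split=> //; move/eqP/cards1P: hS hpS => [l ->]; rewrite inE => hpl.
    have hca : mul_onto J y a by apply: (mul_bij_onto hc).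
    by case: (onto_Jloc_pair hJ nilp hpl hy hca hA') => // /key.
  exists j => S hS _ _; split=> //; move/eqP/cards1P: hS => [l ->]; apply: key.
  by apply: NNPP => h; apply: hall; exists l.
(* S contains two variables, whose product is nilpotent modulo J, so localizing at S makes J the
   unit ideal. *)
- exists j => S hS hjS hp; split; first exact: (out _ _ hS hjS hp hj).
  have /card_gt1P [p [q [hpS hqS hpq]]] : (1 < #|S|)%N by rewrite hS.
  have [N hN] := nilp hpq; exists N; apply: (id_mdvd iJ _ hN); apply/mnm_lepP => x.
  rewrite mulmnE mnmDE !mnm1E !mnmE; case: ifP => hx.
    have [e|_] := eqVneq p x; have [e'|_] := eqVneq q x; rewrite ?mul0n ?mul1n ?leq_addl //.
    by move: hpq; rewrite e e' eqxx.
  have -> : (p == x) = false by apply: contraFF hx => /eqP <-.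
  by have -> : (q == x) = false by apply: contraFF hx => /eqP <-.
Qed.

End Upper.

Lemma cech_upper y a i r : is_homog 1 y -> mul_bij J y a -> lc_nonzero J i r -> Z.le (Z.add r (Z.of_nat i)) (Z.of_nat a).
Proof.
move=> hy hc [t [f [hf [hcy hnb]]]]; apply: NNPP => hr.
have {}hr : Z.lt (Z.of_nat a) (Z.add r (Z.of_nat i)) by lia.
apply: hnb; case: i hf hcy hr => [|i] hf hcy hr.
  move=> S hS; have e : S = set0 by apply/eqP; rewrite -cards_eq0 hS.
  case: (posnP m) => [m0|m0].
    have [_ [//|[d [/is_homogP hd e']]]] := hf S hS.
    apply/eqP; apply: contraT => hfS; have := hd _ (mlead_supp hfS).
    have -> : mdeg (mlead (f S)) = 0%N.
      by rewrite mdegE big1 // => x _; have := ltn_ord x; rewrite {2}m0.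
    by lia.
  have hT := hcy [set Ordinal m0]; rewrite cards1 in hT; move/(_ erefl): hT.
  rewrite /cech_d big_set1 setDv -e => /eqP; rewrite !mulf_eq0 => /orP[/orP[|]|/eqP //].
    rewrite csignE mpolyC_eq0 => /eqP es.
    by have := sgn_sqr k (Ordinal m0) [set Ordinal m0]; rewrite es mul0r => /esym/eqP; rewrite oner_eq0.
  by rewrite mpolyXn -msupp_eq0 msuppX.
have H b : exists psi : {set 'I_m} -> k,
    (forall S, #|S| = i.+1 -> \sum_(j in S) sgn k j S * psi (S :\ j) = phi f t b S) /\
    (forall S, #|S| = i -> psi S != 0 ->
       (forall l, l \notin S -> (t <= b l)%N) /\ exists N, J 'X_[loc t b S N]).
  case: (classic (exists2 S : {set 'I_m}, #|S| = i.+1 & phi f t b S != 0)) => [hex|hno].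
    have [j0 hj0] := cone_exists hy hc hf hcy hr hex.
    exists (fun S => if j0 \in S then 0 else sgn k j0 S * phi f t b (j0 |: S)); split.
      by apply: cone; apply: cocycle_phi.
    move=> S hS; case: ifP => [_|hj]; first by rewrite eqxx.
    by rewrite mulf_eq0 negb_or => /andP[_]; apply: hj0 => //; apply: negbT.
  exists (fun=> 0); split; last by move=> S _; rewrite eqxx.
  move=> S hS; rewrite big1 => [|j _]; last by rewrite mulr0.
  by apply/esym/eqP; apply: NNPP => h; apply: hno; exists S => //; apply/negP.
pose psi b := proj1_sig (constructive_indefinite_description _ (H b)).
have H1 b : (forall S, #|S| = i.+1 -> \sum_(j in S) sgn k j S * psi b (S :\ j) = phi f t b S) /\
    (forall S, #|S| = i -> psi b S != 0 ->
       (forall l, l \notin S -> (t <= b l)%N) /\ exists N, J 'X_[loc t b S N]).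
  by rewrite /psi; case: constructive_indefinite_description.
by apply: (@coboundary_of f t i psi) => b; case: (H1 b).
Qed.

End CechUpper.

(** * Regularity: the lower bound *)

Section CechLower.
Variables (k : fieldType) (m : nat) (J : {mpoly k[m]} -> Prop).
Hypothesis hJ : mono_ideal J.
Hypothesis nilp : forall p q : 'I_m, p != q -> exists N, J 'X_[(U_(p) + U_(q)) *+ N].
Hypothesis J0 : exists u, J 'X_[u].
Let iJ : is_ideal J := mono_is_ideal hJ.
Implicit Types (S T : {set 'I_m}) (A b u v w : 'X_{1..m}) (p q : 'I_m).

Lemma mono_supp f u : J f -> f@_u != 0 -> J 'X_[u].
Proof. by move=> hf hu; apply: (proj2 hJ _ _ hf); rewrite mcoeff_msupp. Qed.

(** The class of 1/(x_1...x_m), with numerator and denominator multiplied by a power of x_1...x_m so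
    that the numerator lies in J. It shows reg J >= 0. *)
Lemma lc_top : lc_nonzero J m (Z.opp (Z.of_nat m)).
Proof.
have [u hu] := J0; pose c n : 'X_{1..m} := [multinom n | l < m].
have hc : J 'X_[c (mdeg u)].
  apply: (id_mdvd iJ _ hu); apply/mnm_lepP => l.
  by rewrite mnmE mdegE (bigD1 l) //= leq_addr.
have hd n : mdeg (c n) = (n * m)%N.
  by rewrite mdegE ord_sum_const; apply: eq_bigr => l _; rewrite mnmE.
exists (mdeg u).+1, (fun=> 'X_[c (mdeg u)]); split; [|split].
- move=> S _; split=> //; right; exists (mdeg u * m)%N; split; first exact: homogXd.
  by rewrite mulSn; lia.
- move=> T hT; have := max_card (mem T); rewrite hT card_ord => h.
  by have := leq_ltn_trans h (ltnSn m); rewrite ltnn.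
suff H i : i = m -> ~ coboundary J i (mdeg u).+1 (fun=> 'X_[c (mdeg u)]) by exact: H.
case: i => [_ /(_ set0)|i ei [s [g [_ hg]]]].
  by rewrite cards0 => /(_ erefl) /eqP; rewrite -msupp_eq0 msuppX.
have := hg setT; rewrite cardsT card_ord => /(_ (esym ei)).
rewrite !xpowE /cech_d mulr_suml.
have eT n : mon_in (m := m) setT n = c n by apply/mnmP => l; rewrite !mnmE inE.
rewrite !eT -mpolyXD => /(congr1 (mcoeff (c (mdeg u) + c s)%MM)).
rewrite mcoeffX eqxx raddf_sum big1 /= => [|j _]; first by move/eqP; rewrite eq_sym oner_eq0.
have -> : csign k j setT * 'X_j ^+ s * g (setT :\ j) * 'X_[c (mdeg u).+1] =
    'X_[U_(j) *+ s + c (mdeg u).+1] * (csign k j setT * g (setT :\ j)).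
  by rewrite mpolyXD mpolyXn; ring.
rewrite coeff_X_mul; case: ifP => // /mnm_lepP /(_ j).
by rewrite !mnmDE mulmnE mnm1E !mnmE eqxx; lia.
Qed.

(** X_A defines a class in H^0(R/J), which the connecting map carries to H^1(J): the constant
    cochain X_A, whose only primitive is X_A itself. *)
Lemma lc_one A : (0 < m)%N -> (forall p, Jloc J p A) -> ~ J 'X_[A] -> lc_nonzero J 1 (Z.of_nat (mdeg A)).
Proof.
move=> m0 hA hnA.
pose N p := proj1_sig (constructive_indefinite_description _ (hA p)).
have hN p : J 'X_[A + U_(p) *+ N p] by rewrite /N; case: constructive_indefinite_description.
pose t := \max_p N p.
have es l n : mon_in [set l] n = (U_(l) *+ n)%MM.
  by apply/mnmP => x; rewrite mulmnE mnm1E mnmE inE eq_sym; case: eqP => _; rewrite ?mul1n ?mul0n.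
exists t, (fun S => 'X_[mon_in S t + A]); split; [|split].
- move=> S /eqP/cards1P [l ->]; rewrite es; split.
    apply: (id_mdvd iJ _ (hN l)); apply/mnm_lepP => x; rewrite !mnmDE !mulmnE addnC leq_add2r leq_mul2l.
    by rewrite (leq_bigmax l) orbT.
  right; exists (t + mdeg A)%N; split; last by lia.
  by apply: homogXd; rewrite mdegD mdegMn mdeg1 mul1n.
- move=> T hT; have /card_gt1P [x [y [hx hy hxy]]] : (1 < #|T|)%N by rewrite hT.
  have eT : T = [set x; y].
    apply/eqP; rewrite eq_sym eqEcard hT cards2 hxy leqnn andbT.
    by apply/subsetP => z; rewrite !inE => /orP[]/eqP ->.
  rewrite /cech_d (eq_bigr (fun j => csign k j T * 'X_[mon_in T t + A])).
    rewrite -mulr_suml; under eq_bigr => j _ do rewrite csignE.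
    by rewrite -(rmorph_sum (mpolyC m (R := k))) /= eT sgn_pair // mpolyC0 mul0r.
  move=> j hj; rewrite -mulrA mpolyXn -mpolyXD; congr (_ * 'X_[_]); rewrite addmA; congr (_ + _)%MM.
  apply/mnmP => l; rewrite mnmDE mulmnE mnm1E !mnmE !inE eq_sym.
  by case: eqVneq => [->|_]; rewrite ?hj ?mul1n ?addn0 ?mul0n ?add0n.
move=> [s [g [hg1 hg2]]]; apply: hnA.
have := hg2 [set Ordinal m0]; rewrite cards1 => /(_ erefl).
rewrite !xpowE !es /cech_d big_set1 setDv csignE.
have -> : sgn k (Ordinal m0) [set Ordinal m0] = 1.
  rewrite /sgn (_ : [set i in _ | _] = set0) ?cards0 //; apply/setP => i; rewrite !inE.
  by case: eqP => //= ->; rewrite ltnn.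
rewrite mpolyC1 mul1r mpolyXn mpolyXD => e.
have nz : 'X_[U_(Ordinal m0) *+ s] * 'X_[U_(Ordinal m0) *+ t] != 0 :> {mpoly k[m]}.
  by rewrite -mpolyXD -msupp_eq0 msuppX.
have <- : g set0 = 'X_[A].
  by apply: (mulfI nz); rewrite mulrAC e; ring.
by apply: hg1; rewrite cards0.
Qed.

(** The cocycle is the coboundary, taken in R, of the Laurent monomial x^b / (x_1...x_m)^t placed at
    vertex p. Its values lie in J because J localized at two variables is the unit ideal. On {p, q}
    a primitive in J would need this monomial in J localized at p or at q, which the hypotheses
    exclude. *)
Lemma lc_two p q t b : p != q -> (forall l, l != p -> (t <= b l)%N) ->
  (forall N, ~ J 'X_[loc t b [set p] N]) -> ((b p < t)%N \/ forall N, ~ J 'X_[loc t b [set q] N]) ->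
  lc_nonzero J 2 (Z.sub (Z.of_nat (mdeg b)) (Z.of_nat (t * m))).
Proof.
move=> hpq hb hp hq.
pose tau S : k := (-1) ^+ #|[set l in S | (p < l)%N]|.
pose psi S : k := if p \in S then tau S else 0.
have hex S : exists N, (1 < #|S|)%N -> J 'X_[loc t b S N].
  have [|h] := ltnP 1 #|S|; last by exists 0%N.
  move=> /card_gt1P [x [y [hx hy hxy]]]; have [N hN] := nilp hxy; exists N => _.
  apply: (id_mdvd iJ _ hN); apply/mnm_lepP => l; rewrite mulmnE mnmDE !mnm1E !mnmE; case: ifP => hl.
    have [e|_] := eqVneq x l; have [e'|_] := eqVneq y l; rewrite ?mul0n ?mul1n ?leq_addl //.
    by move: hxy; rewrite e e' eqxx.
  have -> : (x == l) = false by apply: contraFF hl => /eqP <-.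
  by have -> : (y == l) = false by apply: contraFF hl => /eqP <-.
pose NS S := proj1_sig (constructive_indefinite_description _ (hex S)).
have hNS S : (1 < #|S|)%N -> J 'X_[loc t b S (NS S)] by rewrite /NS; case: constructive_indefinite_description.
pose N := \max_(S : {set 'I_m}) NS S.
have hN S : (1 < #|S|)%N -> J 'X_[loc t b S N].
  by move=> /hNS h; apply: (loc_mono hJ _ h); apply: leq_bigmax.
exists (t + N)%N, (fun S => psi S *: 'X_[loc t b S N]); split; [|split].
- move=> S hS; split; first by apply: idZ => //; apply: hN; rewrite hS.
  rewrite /psi; case: ifP => hpS; last by left; rewrite scale0r.
  right; exists (mdeg (loc t b S N)); split; first by apply: homogZ; apply: homogXm.
  have : forall l, l \notin S -> (t <= b l)%N by move=> l hl; apply: hb; apply: contraNneq hl => ->.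
  move=> /(loc_deg N); rewrite hS; lia.
- move=> T hT.
  have H : cech_d (fun S => psi S *: 'X_[loc t b S N]) (t + N) T =
      \sum_(j in T) (sgn k j T * psi (T :\ j)) *: 'X_[loc t b T N].
    apply: eq_bigr => j hj; rewrite csignE -mulrA mul_mpolyC -scalerA; congr (_ *: _).
    rewrite /psi; case: ifP => hpT; last by rewrite !scale0r mulr0.
    rewrite -scalerAr mpolyXn -mpolyXD; congr (_ *: 'X_[_]).
    apply/mnmP => l; rewrite mnmDE mulmnE mnm1E !mnmE !inE.
    have [<-|hne] := eqVneq j l.
      rewrite hj mul1n /=; have := hb j; move: hpT; rewrite !inE => /andP[hne _].
      by rewrite eq_sym hne => /(_ isT); lia.
    by rewrite mul0n add0n.
  rewrite H -scaler_suml.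
  have [hpT|hpT] := boolP (p \in T); last first.
    rewrite big1 ?scale0r // => j hj; rewrite /psi !inE (negbTE hpT) andbF; exact: mulr0.
  rewrite (bigD1 p) //= /psi !inE eqxx mulr0 add0r.
  have hcard : #|T :\ p| = 2 by move: hT; rewrite (cardsD1 p) hpT add1n => -[].
  have /card_gt1P [x [y [hx hy hxy]]] : (1 < #|T :\ p|)%N by rewrite hcard.
  have eT : T :\ p = [set x; y].
    apply/eqP; rewrite eq_sym eqEcard hcard cards2 hxy leqnn andbT.
    by apply/subsetP => z; rewrite in_set2 => /orP[]/eqP ->.
  suff -> : \sum_(j in T | j != p) sgn k j T * (if p \in T :\ j then tau (T :\ j) else 0) =
     tau T * \sum_(j in [set x; y]) sgn k j [set x; y] by rewrite sgn_pair // mulr0 scale0r.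
  rewrite -eT mulr_sumr; apply: eq_big => j; first by rewrite !inE andbC.
  move=> /andP[hj hjp]; rewrite !inE eq_sym hjp hpT /=.
  have -> : tau (T :\ j) = (-1) ^+ (p < j)%N * tau T.
    rewrite /tau [in RHS](_ : [set l in T | (p < l)%N] =
      if (p < j)%N then j |: [set l in T :\ j | (p < l)%N] else [set l in T :\ j | (p < l)%N]).
      case: ifP => h; last by rewrite expr0 mul1r.
      by rewrite cardsU1 !inE eqxx /= exprD mulrA -expr2 sqrrN !expr1n mul1r.
    apply/setP => l; case: ifP => h; rewrite !inE; case: eqVneq => [->|_] //=.
      by rewrite hj h.
    by rewrite h andbF.
  have -> : sgn k j T = (-1) ^+ (p < j)%N * sgn k j (T :\ p).
    by rewrite -[in LHS](setD1K hpT) sgn_add // setD11.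
  have := signrMK; rewrite mulrACA -expr2 -exprM mulnC exprM sqrrN expr1n expr1n mul1r.
  by rewrite mulrC.
move=> [s [g [hg1 hg2]]].
pose S := [set p; q].
have hS2 : #|S| = 2 by rewrite cards2 hpq.
have := hg2 S hS2; rewrite /cech_d !xpowE.
rewrite (bigD1 p) ?inE ?eqxx //= (bigD1 q) /=; last by rewrite !inE eqxx orbT eq_sym.
rewrite big1 ?addr0; last by move=> j; rewrite !inE => /andP[/andP[/orP[]/eqP -> ]]; rewrite eqxx ?andbF.
have -> : S :\ p = [set q] by rewrite setU1K // inE.
have -> : S :\ q = [set p] by rewrite /S setUC setU1K // inE eq_sym.
pose w := (loc t b S N + mon_in S s)%MM.
move=> /(congr1 (mcoeff w)).
have -> : (psi S *: 'X_[loc t b S N] * 'X_[mon_in S s])@_w = psi S.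
  by rewrite -scalerAl -mpolyXD mcoeffZ mcoeffX eqxx mulr1.
have psi0 : psi S != 0.
  by rewrite /psi !inE eqxx /= /tau expf_neq0 // oppr_eq0 oner_neq0.
have eqw x z (hx : x \in S) : csign k x S * 'X_x ^+ s * g z * 'X_[mon_in S (t + N)] =
    'X_[U_(x) *+ s + mon_in S (t + N)] * ((sgn k x S)%:MP * g z).
  by rewrite csignE mpolyXD mpolyXn; ring.
have hpS : p \in S by rewrite !inE eqxx.
have hqS : q \in S by rewrite !inE eqxx orbT.
rewrite mulrDl mcoeffD !eqw //.
suff [-> ->] : ('X_[U_(p) *+ s + mon_in S (t + N)] * ((sgn k p S)%:MP * g [set q]))@_w = 0 /\
    ('X_[U_(q) *+ s + mon_in S (t + N)] * ((sgn k q S)%:MP * g [set p]))@_w = 0.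
  by rewrite addr0 => /eqP; rewrite eq_sym (negbTE psi0).
have key x z : x \in S -> z \in S -> x != z ->
    ('X_[U_(x) *+ s + mon_in S (t + N)] * ((sgn k x S)%:MP * g [set z]))@_w != 0 ->
    (t <= b x)%N /\ J 'X_[loc t b [set z] s].
  move=> hx hz hxz; rewrite coeff_X_mul; case: ifP => [hle|_]; last by rewrite eqxx.
  rewrite mcoeffCM mulf_eq0 negb_or => /andP[_ h].
  split; first by move/mnm_lepP: hle => /(_ x); rewrite /w !mnmDE mulmnE mnm1E !mnmE hx eqxx; lia.
  have hgz : J (g [set z]) by apply: hg1; rewrite cards1.
  apply: (id_mdvd iJ _ (mono_supp hgz h)); apply/mnm_lepP => l; rewrite /w mnmBE !mnmDE mulmnE mnm1E !mnmE in_set1.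
  have [e|hlz] := eqVneq l z.
    by rewrite e hz (negbTE hxz) mul0n; lia.
  have [e|hlx] := eqVneq x l; first by rewrite -e hx mul1n; lia.
  rewrite mul0n; suff -> : l \in S = false by lia.
  apply/negbTE; rewrite eq_sym in hlz; move: hx hz hxz hlz hlx; rewrite /S !inE.
  move=> /orP[/eqP->|/eqP->] /orP[/eqP->|/eqP->]; rewrite ?eqxx // => _ h1 h2.
    by rewrite negb_or ![l == _]eq_sym h2 h1.
  by rewrite negb_or ![l == _]eq_sym h1 h2.
split; apply/eqP; apply: contraT => /key h; last first.
  by have [||| _ /hp] := h _ _; rewrite // eq_sym.
have [||| h1 h2] := h; rewrite //; case: hq => [|hq]; first by rewrite ltnNge h1.
by case: (hq _ h2).
Qed.

(** The bound excludes the classes of [lc_one] and [lc_two], which gives [b1] and then [b2], [b3].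
    With [Jloc_nzd], [b1] yields injectivity; surjectivity rewrites monomials modulo z0. *)
Lemma reg_bound_mul_bij a : (forall i r, lc_nonzero J i r -> Z.le (Z.add r (Z.of_nat i)) (Z.of_nat a)) ->
  mul_bij J (lform (fun=> 1)) a.
Proof.
move=> H.
have b1 A : (forall p, Jloc J p A) -> (a <= mdeg A)%N -> J 'X_[A].
  move=> hA hd; apply: NNPP => hn.
  case: (posnP m) => [m0|m0]; last by have := H _ _ (lc_one m0 hA hn); lia.
  have [u hu] := J0; apply: hn; apply: (id_mdvd iJ _ hu); apply/mnm_lepP => l.
  by have := ltn_ord l; rewrite {2}m0.
have b3 p q A : p != q -> (a <= (mdeg A).+1)%N -> Jloc J p A \/ Jloc J q A.
  move=> hpq hd; apply: NNPP => /not_or_and [hp hq].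
  have e l N : loc 0 A [set l] N = (A + U_(l) *+ N)%MM.
    apply/mnmP => x; rewrite mnmDE mulmnE mnm1E mnmE inE eq_sym.
    by case: eqP => _; rewrite ?mul1n ?mul0n ?subn0 ?addn0.
  have hl := @lc_two p q 0 A hpq.
  have {}hl : lc_nonzero J 2 (Z.sub (Z.of_nat (mdeg A)) (Z.of_nat (0 * m))).
    apply: hl => // [N h|]; first by apply: hp; exists N; rewrite -e.
    by right=> N h; apply: hq; exists N; rewrite -e.
  by have := H _ _ hl; lia.
have b2 p u : u p = 0%N -> (a <= mdeg u)%N -> Jloc J p u.
  move=> up hd; apply: NNPP => hn.
  case: (classic (exists q, q != p)) => [[q hq]|hno].
    (* Laurent exponent -1 at p and that of u elsewhere, stored with t = 1; its degree is one less
       than that of u. *)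
    pose b : 'X_{1..m} := [multinom if l == p then 0%N else (u l).+1 | l < m].
    have hb : (mdeg b + 1 = mdeg u + 1 * m)%N.
      rewrite !mdegE ord_sum_const -big_split /= (bigD1 p) //= [in RHS](bigD1 p) //= mnmE eqxx up.
      rewrite (eq_bigr (fun l => (u l + 1)%N)); first by lia.
      by move=> l hl; rewrite mnmE (negbTE hl) addn1.
    have hl : lc_nonzero J 2 (Z.sub (Z.of_nat (mdeg b)) (Z.of_nat (1 * m))).
      apply: (@lc_two p q); first by rewrite eq_sym.
      - by move=> l hl; rewrite mnmE (negbTE hl).
      - move=> N h; apply: hn; exists N; apply: (id_mdvd iJ _ h); apply/mnm_lepP => l.
        rewrite mnmDE mulmnE mnm1E !mnmE inE [p == l]eq_sym; case: eqP => _; lia.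
      - by left; rewrite mnmE eqxx.
    by have := H _ _ hl; lia.
  have [w hw] := J0; apply: hn; exists (w p); apply: (id_mdvd iJ _ hw); apply/mnm_lepP => l.
  rewrite mnmDE mulmnE mnm1E; have -> : l = p by apply: NNPP => h; apply: hno; exists l; apply/eqP.
  by rewrite eqxx mul1n leq_addl.
have hz := @lform_homog k m (fun=> 1).
move=> j hj; split; last first.
  move=> f /is_homogP hf hzf; apply/(mono_memP _ hJ) => v hv; apply: b1; last by rewrite (hf v hv).
  move=> p; apply: (Jloc_nzd hJ hz _ _ hv); first by rewrite lform_coeff oner_neq0.
  by move=> w hw; apply: Jloc_mem; apply: (proj2 hJ _ _ hzf).
apply: ontoX => // w hw.
(* Modulo z0, X_p w' is minus the sum of the X_q w' with q different from p. This lowers the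
   exponent at p until [b2] applies. *)
have main n : forall w p, w p = n -> mdeg w = j -> (forall q, q != p -> Jloc J q w) ->
    exists c, J ('X_[w] - lform (fun=> 1) * c).
  elim: n => [|n IH] {hw}w p hwp hw hq.
    exists 0; rewrite mulr0 subr0; apply: b1; last by rewrite hw.
    move=> q; have [->|] := eqVneq q p; last exact: hq.
    by apply: b2; rewrite ?hw.
  case: (classic (Jloc J p w)) => [hp|hp].
    exists 0; rewrite mulr0 subr0; apply: b1; last by rewrite hw.
    by move=> q; have [->|] := eqVneq q p; last exact: hq.
  have [w' ew] : exists w', w = (U_(p) + w')%MM by apply: mdvdX_ex; rewrite lep1mP hwp.
  have hw' : mdeg w = (mdeg w').+1 by rewrite ew mdegD mdeg1.
  have hq' q : q != p -> Jloc J q w'.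
    move=> hqp; case: (b3 q p w' hqp) => [|//|hd]; first by lia.
    by case: hp; apply: (Jloc_le hJ _ hd); rewrite ew lem_addl.
  have hstep q : exists c, q != p -> J ('X_[U_(q) + w'] - lform (fun=> 1) * c).
    have [_|hqp] := eqVneq q p; first by exists 0.
    have [|||b hb] := IH (U_(q) + w')%MM p.
    - by move: hwp; rewrite ew !mnmDE !mnm1E eqxx (negbTE hqp) add1n => -[->].
    - by rewrite mdegD mdeg1 -hw hw'.
    - by move=> q' hq'p; apply: (Jloc_le hJ _ (hq' _ hq'p)); apply: lem_addl.
    by exists b.
  pose B q := proj1_sig (constructive_indefinite_description _ (hstep q)).
  have hB q : q != p -> J ('X_[U_(q) + w'] - lform (fun=> 1) * B q).
    by rewrite /B; case: constructive_indefinite_description.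
  exists ('X_[w'] - \sum_(q | q != p) B q).
  have e : lform (fun=> 1 : k) * 'X_[w'] = 'X_[w] + \sum_(q | q != p) 'X_[U_(q) + w'].
    rewrite /lform mulr_suml (bigD1 p) //= scale1r -mpolyXD -ew; congr (_ + _).
    by apply: eq_bigr => q _; rewrite scale1r mpolyXD.
  have -> : 'X_[w] - lform (fun=> 1) * ('X_[w'] - \sum_(q | q != p) B q) =
      - (\sum_(q | q != p) ('X_[U_(q) + w'] - lform (fun=> 1) * B q)).
    by rewrite mulrBr e sumrB mulr_sumr; ring.
  by apply: idN => //; apply: id_sum => // q _; apply: hB.
case: (classic (exists p, ~ Jloc J p w)) => [[p hp]|hno].
  apply: (main (w p) w p) => // q hqp.
  by case: (b3 q p w hqp) => //; rewrite hw ltnW.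
exists 0; rewrite mulr0 subr0; apply: b1; last by rewrite hw.
by move=> p; apply: NNPP => h; apply: hno; exists p.
Qed.

Lemma reg_char (le : rel 'X_{1..m}) : term_order le -> exists a, [/\ reg J = Z.of_nat a, mul_bij J (lform (fun=> 1)) a
  & forall y a', is_homog 1 y -> mul_bij J y a' -> (a <= a')%N].
Proof.
move=> hle; have hz := @lform_homog k m (fun=> 1).
pose bnd a := forall i r, lc_nonzero J i r -> Z.le (Z.add r (Z.of_nat i)) (Z.of_nat a).
have hCM y a : is_homog 1 y -> mul_bij J y a -> bnd a.
  by move=> hy hc i r; apply: cech_upper hy hc.
have hex : exists a, asbool (bnd a).
  have [a ha] : exists a, mul_onto J (lform (fun=> 1)) a.
    by apply: onto_exists => // p _; rewrite lform_coeff oner_neq0.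
  have [b hb] := onto_eventually_mul_bij hle (mono_homog hJ) hz ha.
  by exists b; apply/asboolP; apply: hCM hb.
case: (ex_minnP hex) => a /asboolP ha hmin.
have hreg : is_reg J (Z.of_nat a).
  (* The bound is attained: for a = 0 by [lc_top], for a + 1 because minimality provides a class
     exceeding a. *)
  split=> //; case: a ha hmin => [|a] ha hmin.
    by exists m, (Z.opp (Z.of_nat m)); split; [exact: lc_top|lia].
  have : ~ bnd a by move=> /asboolP /hmin; rewrite ltnn.
  move=> /not_all_ex_not [i /not_all_ex_not [r hr]].
  have [h1 h2] := imply_to_and _ _ hr.
  by exists i, r; split=> //; have := ha _ _ h1; lia.
exists a; split.
- have [h1 [i [r [h2 h3]]]] := epsilon_spec (inhabits Z0) (is_reg J) (ex_intro _ _ hreg).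
  have [h4 [i' [r' [h5 h6]]]] := hreg.
  rewrite /reg; have := h1 _ _ h5; have := h4 _ _ h2; lia.
- exact: reg_bound_mul_bij.
by move=> y a' hy hc; apply: hmin; apply/asboolP; apply: hCM hc.
Qed.

End CechLower.

(** * Powers and initial ideals *)

Section MinReduction.
Variables (k : fieldType) (m : nat) (L : {mpoly k[m]} -> Prop).
Hypothesis hk : infinite_field k.
Hypothesis hL : mono_ideal L.
Hypothesis nilp : forall p q : 'I_m, p != q -> exists N, L 'X_[(U_(p) + U_(q)) *+ N].
Let iL : is_ideal L := mono_is_ideal hL.

Lemma gen1P (y p : {mpoly k[m]}) : gen_ideal (fun g => g \in [:: y]) p <-> exists b, p = y * b.
Proof.
split=> [[s [hs ->]]|[b ->]].
  exists (\sum_(x <- s) x.1); rewrite mulr_sumr big_seq [RHS]big_seq; apply: eq_bigr => x /hs.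
  by rewrite inE => /eqP ->; rewrite mulrC.
by rewrite mulrC; apply: idMl; [exact: gen_ideal_is_ideal|apply: gen_ideal_incl; rewrite mem_head].
Qed.

(* A reduction contains a linear form that is nonzero at every minimal prime of dimension
   one, and such a form already generates a reduction. *)
Lemma min_reduction_principal Q : min_reduction Q L ->
  exists2 y, is_homog 1 y & forall p, Q p <-> exists b, p = y * b.
Proof.
move=> [[[s [hs hQ]] [N hN]] hmin].
pose nopow (p : 'I_m) := forall n, ~ L 'X_[U_(p) *+ n].
(* As a polynomial in undetermined c_i, the coefficient of X_p in the combination of the generators
   of Q. It is nonzero when no power of X_p is in L, because Q covers X_p^N. *)
pose D (p : 'I_m) : {mpoly k[size s]} := lform (fun i : 'I_(size s) => (nth 0 s i)@_U_(p)).
have D0 p : nopow p -> D p != 0.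
  move=> hp; apply/eqP => e; apply: (hp N).
  have hsp x : x \in s -> x@_U_(p) = 0.
    move=> hx; have hi : (index x s < size s)%N by rewrite index_mem.
    have := congr1 (mcoeff U_(Ordinal hi)%MM) e.
    by rewrite lform_coeff mcoeff0 /= nth_index.
  have hd : is_homog N ('X_[U_(p) *+ N] : {mpoly k[m]}).
    by apply: homogXd; rewrite mdegMn mdeg1 mul1n.
  have [a [b [/hQ [t [ht ea]] [hb e']]]] := hN _ (leqnn N) _ hd.
  apply: (proj2 hL _ _ hb).
  have -> : b = 'X_[U_(p) *+ N] - a by rewrite e' addrC addrA addNr add0r.
  rewrite mcoeff_msupp mcoeffB mcoeffX eqxx ea raddf_sum /= big_seq big1 ?subr0 ?oner_neq0 //.
  move=> x /ht hx; rewrite mulrC coeff_lmul; last exact: hs.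
  rewrite big1 // => i _; have [->|hi] := eqVneq i p; first by rewrite (hsp _ hx) mul0r.
  by rewrite lep1mP mulmnE mnm1E [p == i]eq_sym (negbTE hi) mul0n eqxx mulr0.
have [c hc] : exists c, (\prod_(p | asbool (nopow p)) D p).@[c] != 0.
  by apply: mpoly_nonroot => //; apply/prodf_neq0 => p /asboolP; apply: D0.
pose y : {mpoly k[m]} := \sum_(i < size s) c i *: nth 0 s i.
have hy : is_homog 1 y.
  by apply: homog_sum => i _ _; apply: homogZ; apply: hs; apply: mem_nth.
have yp p : nopow p -> y@_U_(p) != 0.
  move=> /asboolP hp; move: hc; rewrite (rmorph_prod (meval c)) => /prodf_neq0 /(_ p hp).
  rewrite /D /lform raddf_sum /y raddf_sum /=; congr (_ != 0); apply: eq_bigr => i _.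
  by rewrite mevalZ mevalXU mcoeffZ mulrC.
have [a ha] := onto_exists hL nilp hy yp.
pose Y := gen_ideal (fun g => g \in [:: y]).
have YQ p : Y p -> Q p.
  move=> /gen1P [b ->]; apply/hQ; rewrite mulrC; apply: idMl; first exact: gen_ideal_is_ideal.
  apply: id_sum => [|i _ _]; first exact: gen_ideal_is_ideal.
  apply: idZ; first exact: gen_ideal_is_ideal.
  by apply: gen_ideal_incl; apply: mem_nth.
exists y => // p; rewrite -gen1P -/(Y p); split; last exact: YQ.
move=> hp; apply: NNPP => hn; apply: hmin; exists Y; split; last by split=> //; exists p.
split.
  exists [:: y]; split=> [x|q]; last by [].
  by rewrite inE => /eqP ->.
exists a => n hn' q hq; have [b hb] := onto_mono iL hn' ha hq.
exists (y * b), (q - y * b); split; first by apply/gen1P; exists b.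
by split=> //; rewrite addrC subrK.
Qed.

Lemma red_num_onto r : red_num L r -> exists2 y, is_homog 1 y & mul_onto L y r.+1.
Proof.
move=> [[Q [hQ [hr _]]] _]; have [y hy hQy] := min_reduction_principal hQ.
exists y => // p hp; have [a [b [/hQy [c ->] [hb ->]]]] := hr _ (ltnSn r) p hp.
by exists c; rewrite addrC addKr.
Qed.

End MinReduction.

Lemma gen_ideal_seq (k : fieldType) (m : nat) (G : seq {mpoly k[m]}) p :
  gen_ideal (fun g => g \in G) p -> exists r : 'I_(size G) -> {mpoly k[m]}, p = \sum_b r b * nth 0 G b.
Proof.
move=> [s [hs ->]]; exists (fun b : 'I_(size G) => \sum_(x <- s | index x.2 G == b) x.1).
under [RHS]eq_bigr => b _ do rewrite mulr_suml big_mkcond.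
rewrite exchange_big /= big_seq [RHS]big_seq; apply: eq_bigr => x /hs hx.
have hi : (index x.2 G < size G)%N by rewrite index_mem.
rewrite (bigD1 (Ordinal hi)) //= eqxx nth_index // big1 ?addr0 // => b hb.
by case: eqP => // e; case/eqP: hb; apply: val_inj; rewrite /= e.
Qed.

(** * Regularity of the initial ideals of powers *)

Section InitialPowers.
Variables (k : fieldType) (m : nat) (le : rel 'X_{1..m}) (I : {mpoly k[m]} -> Prop).
Hypothesis hk : infinite_field k.
Hypothesis hle : term_order le.
Hypothesis hI : homog_ideal I.
Hypothesis I0 : exists p, I p /\ p != 0.
Hypothesis hkr : krull_dim_le1 I.
Let iI : is_ideal I := homog_is_ideal hI.
Let J n := initial le (ideal_pow I n).
Let hP n : homog_ideal (ideal_pow I n) := ideal_pow_homog n hI.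
Let z0 : {mpoly k[m]} := lform (fun=> 1).
Let hz0 : is_homog 1 z0 := lform_homog (fun=> 1).

Let hJ n : mono_ideal (J n) := initial_mono hle (@ideal_pow_is_ideal _ _ I n).

Let JM n p f g : J n f -> J p g -> J (n + p) (f * g).
Proof.
apply: (initial_mul hle); last exact: ideal_pow_is_ideal.
by move=> x y; apply: ideal_powM.
Qed.

Let Jpow n u : initial le I 'X_[u] -> J n 'X_[u *+ n].
Proof.
move=> hu; elim: n => [|n IH].
  rewrite mulm0n; apply/initialX; exists 1; split; first exact: ideal_pow0.
  split; first by rewrite msupp1 mem_head.
  by move=> v; rewrite msupp1 inE => /eqP ->; apply: (torder_refl hle).
rewrite mulmSr mpolyXD -addn1; apply: JM => //; apply: initial_sub hu => p.
by move/(ideal_pow1 p iI).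
Qed.

(** Nilpotence passes from in(I) to in(I^n) because in(I)^n is contained in in(I^n). *)
Let J_nilp n (p q : 'I_m) : p != q -> exists N, J n 'X_[(U_(p) + U_(q)) *+ N].
Proof.
move=> hpq; have [N hu] := krull_nilpotent hle hI hkr hpq; have hN := @Jpow n _ hu.
exists (N * n)%N; congr (J n 'X_[_]): hN; apply/mnmP => l.
by rewrite !mulmnE mulnA.
Qed.

Let J_neq0 n : exists u, J n 'X_[u].
Proof.
have [f [hf f0]] := I0; have [u hu] := lead_ex hle f0.
by exists (u *+ n)%MM; apply: Jpow; apply/initialX; exists f.
Qed.

Let J0 p : J 0 p.
Proof.
move=> u _; exists 'X_[u]; split; first exact: ideal_pow0.
split; first by rewrite msuppX mem_head.
by move=> v; rewrite msuppX inE => /eqP ->; apply: (torder_refl hle).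
Qed.

Definition regn n : nat := Z.to_nat (reg (J n)).

Lemma regnP n : [/\ reg (J n) = Z.of_nat (regn n), mul_bij (J n) z0 (regn n)
  & forall y a', is_homog 1 y -> mul_bij (J n) y a' -> (regn n <= a')%N].
Proof.
have [a [h1 h2 h3]] := reg_char (hJ n) (@J_nilp n) (J_neq0 n) hle.
by rewrite /regn h1 Nat2Z.id.
Qed.

Lemma hilb_pow_const n j : (regn n <= j)%N -> hilb le (ideal_pow I n) j.+1 = hilb le (ideal_pow I n) j.
Proof.
move=> hj; have [_ hc _] := regnP n.
have := mul_bij_hilb hle (mono_homog (hJ n)) hz0 hc hj.
by rewrite !(hilb_initial hle _ (@ideal_pow_is_ideal _ _ I n)).
Qed.

Lemma generic_mul_bij n : exists2 D : {mpoly k[m]}, D != 0 &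
  forall c : 'I_m -> k, D.@[c] != 0 -> mul_bij (ideal_pow I n) (lform c) (regn n).
Proof.
have [_ hc _] := regnP n.
have [D D0 hD] := onto_generic hle (hP n) (mul_bij_onto hc (leqnn _)).
exists D => // c /hD hcov; apply: (hilb_mul_bij hle (hP n) (lform_homog c) hcov) => j hj.
exact: hilb_pow_const.
Qed.

Lemma mul_bij_initial n y a : is_homog 1 y -> mul_onto (J n) y a ->
  (forall j, (a <= j)%N -> hilb le (ideal_pow I n) j.+1 = hilb le (ideal_pow I n) j) -> (regn n <= a)%N.
Proof.
move=> hy hc hh; have [_ _ hmin] := regnP n; apply: (hmin y) => //.
apply: (hilb_mul_bij hle (mono_homog (hJ n)) hy hc) => j hj.
by rewrite !(hilb_initial hle _ (@ideal_pow_is_ideal _ _ I n)) hh.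
Qed.

Lemma regn_sub n p : (regn (n + p) <= regn n + regn p)%N.
Proof.
have [D1 D10 h1] := generic_mul_bij n; have [D2 D20 h2] := generic_mul_bij p.
have [c] := mpoly_nonroot hk (mulf_neq0 D10 D20).
rewrite mevalM mulf_eq0 negb_or => /andP[/h1 c1 /h2 c2].
have hspan q f : ideal_pow I (n + p) f -> is_homog q f ->
    prod_span (ideal_pow I n) (ideal_pow I p) q f.
  by move=> hf hq; rewrite -(hcomp_id hq); apply: ideal_powD_span.
have hc := mul_bij_prod (hP n) (hP p) (hP (n + p)) (@ideal_powM _ _ I n p) hspan (lform_homog c) c1 c2.
apply: (mul_bij_initial hz0).
  have [_ b1 _] := regnP n; have [_ b2 _] := regnP p.
  apply: (onto_mul (A := J n) (B := J p)); first exact: mono_is_ideal (hJ _).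
  - exact: JM.
  - exact: (mul_bij_onto b1).
  - exact: (mul_bij_onto b2).
exact: (mul_bij_hilb hle (hP _) (lform_homog c) hc).
Qed.

Lemma regn0 : regn 0 = 0%N.
Proof.
have [_ _ h] := regnP 0; apply/eqP; rewrite -leqn0; apply: (h z0) => // j _.
by split=> [p _|f _ _]; [exists 0|]; apply: J0.
Qed.

Lemma regn_mul n : (regn n <= n * regn 1)%N.
Proof.
elim: n => [|n IH]; first by rewrite regn0.
by rewrite -addn1 mulnDl mul1n; apply: leq_trans (regn_sub n 1) _; rewrite leq_add2r.
Qed.

Lemma regn_linear G r : min_homog_gens I G -> red_num (initial le I) r ->
  exists e, forall n, (regn n <= n * maxn (max_deg G) r.+1 + e)%N.
Proof.
move=> [_ hGh hGI _] hr.
have [y hy hcy] : exists2 y, is_homog 1 y & mul_onto (initial le I) y r.+1.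
  apply: (red_num_onto hk _ _ hr); first exact: initial_mono.
  by move=> p q hpq; apply: krull_nilpotent.
have hJ1 p : initial le I p -> J 1 p by apply: initial_sub => q; move/(ideal_pow1 q iI).
have hcyn n : mul_onto (J n) y (n * r.+1).
  elim: n => [|n IH]; first by move=> p _; exists 0; apply: J0.
  rewrite mulSn addnC -addn1; apply: (onto_mul (A := J n) (B := J 1)) => //.
  - exact: mono_is_ideal (hJ _).
  - exact: JM.
  - by move=> p /hcy [b hb]; exists b; apply: hJ1.
have [D D0 hD] := generic_mul_bij 1; have [c /hD hc] := mpoly_nonroot hk D0.
have hcI : mul_bij I (lform c) (regn 1).
  move=> j /hc [h1 h2]; split=> [p /h1 [b /(ideal_pow1 _ iI) hb]|f hf hzf]; first by exists b.
  by apply/(ideal_pow1 _ iI)/h2 => //; apply/(ideal_pow1 _ iI).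
(* Read off the leading monomial, so that a zero generator gets degree 0. *)
pose dg (b : 'I_(size G)) := mdeg (mlead (nth 0 G b)).
have hdgh b : is_homog (dg b) (nth 0 G b).
  have [d hd] := hGh _ (mem_nth 0 (ltn_ord b)).
  have [e|ne] := eqVneq (nth 0 G b) 0; first by rewrite e; apply: homog0.
  by rewrite /dg; move/is_homogP: (hd) => -> //; apply: mlead_supp.
have hdgd b : (dg b <= max_deg G)%N.
  have [e|ne] := eqVneq (nth 0 G b) 0; first by rewrite /dg e mlead0 mdeg0.
  apply: leq_trans (leq_bigmax_seq _ (mem_nth 0 (ltn_ord b)) isT).
  exact: (leq_bigmax_seq _ (mlead_supp ne) isT).
have hgI (b : 'I_(size G)) : I (nth 0 G b).
  by apply/hGI; apply: gen_ideal_incl; apply: mem_nth.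
have hIg p : I p -> exists r : 'I_(size G) -> {mpoly k[m]}, p = \sum_b r b * nth 0 G b.
  by move/hGI; apply: gen_ideal_seq.
have [e he] := mul_bij_pow_linear hI hdgh hdgd hgI hIg (lform_homog c) hcI.
(* The form y is used for in(I^n) and the generic form for I^n; only the Hilbert function passes
   between them. *)
exists e => n; apply: (mul_bij_initial hy).
  apply: (onto_mono (mono_is_ideal (hJ n)) _ (hcyn n)).
  by apply: leq_trans (leq_addr _ _); rewrite leq_mul2l leq_maxr orbT.
move=> j hj; apply: (mul_bij_hilb hle (hP n) (lform_homog c) (he n)).
by apply: leq_trans hj; rewrite leq_add2r leq_mul2l leq_maxl orbT.
Qed.

End InitialPowers.

Theorem theorem3p5 (k : fieldType) (m : nat) (le : rel 'X_{1..m})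
  (I : {mpoly k[m]} -> Prop) :
  infinite_field k ->
  term_order le ->
  homog_ideal I ->
  (exists p, I p /\ p != 0%R) ->
  krull_dim_le1 I ->
  (forall n : nat,
     Z.le (reg (initial le (ideal_pow I n))) (Z.mul (reg (initial le I)) (Z.of_nat n))) /\
  (exists c : R,
     Un_cv (fun n : nat => Rdiv (IZR (reg (initial le (ideal_pow I n)))) (INR n)) c /\
     forall (G : seq {mpoly k[m]}) (r : nat),
       min_homog_gens I G -> red_num (initial le I) r ->
       Rle c (Rmax (INR (max_deg G)) (Rplus (INR r) R1))).
Proof.
move=> hk hle hI I0 hkr.
have regE n : reg (initial le (ideal_pow I n)) = Z.of_nat (regn le I n).
  by have [] := regnP hle hI I0 hkr n.
(* Equality of predicates makes reg(in(I)) the term n = 1 of the sequence. *)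
have I1 : ideal_pow I 1 = I.
  apply: functional_extensionality => p; apply: propositional_extensionality.
  exact: (ideal_pow1 p (homog_is_ideal hI)).
split=> [n|].
  have := regE 1%N; rewrite I1 regE => ->.
  by have := regn_mul hk hle hI I0 hkr n; nia.
have hsub n p : (regn le I (Nat.add n p) <= regn le I n + regn le I p)%coq_nat.
  by apply/leP; apply: regn_sub.
have [c [hc hbound]] := @fekete _ hsub.
exists c; split.
  rewrite (_ : (fun n => _) = (fun n => Rdiv (INR (regn le I n)) (INR n))) //.
  by apply: functional_extensionality => n; rewrite regE -INR_IZR_INZ.
move=> G r hG hr; have [e he] := regn_linear hk hle hI I0 hkr hG hr.
apply: (Rle_trans _ (INR (maxn (max_deg G) r.+1))).
  by apply: (hbound _ e) => n; apply/leP; apply: he.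
by case: leqP => _; [rewrite S_INR; apply: Rmax_r|apply: Rmax_l].
Qed.
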